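(* Let $h\ge 0$, $c>0$. The equation $$u_t(t,x)=\Delta u(t,x)+u(t,x)(1-u(t-h,x)),\quad u\ge 0,\ x\in\mathbb{R}^m,$$ has a positive monotone wavefront $u=\varphi(\nu\cdot x+ct)$, $|\nu|=1$, connecting $0$ with $1$ if and only if one of the following conditions holds: (1) $0\le h\le 1/e$ and $2\le c<c^*(h):=+\infty$; (2) $1/e<h\le h_1$ and $2\le c\le c^*(h):=1/\sqrt{\epsilon^*(h)}$. Furthermore, when (1) or (2) holds, such a wavefront is obtained as follows: with $\phi(s):=\varphi(cs)$ and with an appropriate function $\phi_-$ of the explicit form given in the context, $\phi=\lim_{j\to+\infty}\mathcal{A}^j\phi_-$ if $c>2$, and $\phi=\lim_{j\to+\infty}\mathcal{B}^j\phi_-$ if $c=2$, where the convergence is monotone (in $j$) and uniform on $\mathbb{R}$. Finally, for each fixed $c\ne c^*(h)$ (satisfying (1) or (2)), $\phi$ is the only possible profile modulo translation, and $\phi(t)$ and $\phi_-(t)$ have the same asymptotic representation $1-e^{\lambda_2 t}(1+o(1))$ as $t\to+\infty$.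
   Context: Wavefronts. A wavefront with speed $c$ is a classical solution $u(t,x)=\varphi(\nu\cdot x+ct)$, $|\nu|=1$, with $\varphi$ positive, $\varphi(-\infty)=0$, $\varphi(+\infty)=1$; it is monotone if $\varphi$ is monotone. Throughout $\epsilon:=c^{-2}$. Critical values. $h_1=0.560771160\dots$ is the positive root of $2h^2\exp(1+\sqrt{1+4h^2}-2h)=1+\sqrt{1+4h^2}$. The continuous function $\epsilon^*(h)$ on $[1/e,h_1]$ is defined parametrically by $\epsilon^*(h(t))=t\,h(t)$, $h(t)=(2t+\sqrt{4t^2+1})\exp\big(-1-\frac{2t}{1+\sqrt{4t^2+1}}\big)$, $t\in[0,t_1]$, where $t_1=0.445\dots$ satisfies $h(t_1)=h_1$, $t_1h(t_1)=0.25$. Roots. For $c\ge2$, $0<\lambda\le\mu$ are the roots of $\epsilon z^2-z+1=0$ (so $\lambda=\mu=2$ if $c=2$). If (1) or (2) holds and $h>0$, $\lambda_1\le\lambda_2<0$ are the two negative zeros (counted with multiplicity) of $\psi(z,\epsilon)=\epsilon z^2-z-e^{-zh}$; one has $\lambda_1=\lambda_2$ iff $h>1/e$ and $c=c^*(h)$. If $h=0$, $\lambda_2$ is the unique negative zero of $\psi$ and $\lambda_1:=-\infty$. Operators. For $c>2$, $$(\mathcal{A}\varphi)(t)=\frac{1}{\epsilon(\mu-\lambda)}\int_t^{+\infty}(e^{\lambda(t-s)}-e^{\mu(t-s)})\varphi(s)\varphi(s-h)\,ds,$$ and for $c=2$, $$(\mathcal{B}\varphi)(t)=4\int_t^{+\infty}(s-t)e^{2(t-s)}\varphi(s)\varphi(s-h)\,ds.$$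 The function $\phi_-$. If $c<c^*(h)$: with $\tau=\frac1{\lambda_2}\ln\frac{\lambda}{\lambda-\lambda_2}>0$, $$\phi_-(t)=\frac{-\lambda_2}{\lambda-\lambda_2}e^{\lambda(t-\tau)}\ \text{for } t\le\tau,\qquad \phi_-(t)=1-e^{\lambda_2t}\ \text{for } t\ge\tau.$$ If $1/e<h\le h_1$ and $c=c^*(h)$: $$\phi_-(t)=0\ \text{for } t\le\tau',\qquad \phi_-(t)=1-(At+1)e^{\lambda_2t}\ \text{for } t\ge\tau',$$ where $A>(e^{-\lambda_2h}-1)/h$ is a sufficiently large constant and $\tau'$ is the positive root of $At+1=e^{-\lambda_2t}$. *)

(* Defs.v *)
Set Warnings "-notation-overridden,-ambiguous-paths".
From mathcomp Require Import ssreflect ssrfun ssrbool eqtype ssrnat fintype bigop.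
From Stdlib Require Import Reals Lra.
From Coquelicot Require Import Coquelicot.
Open Scope R_scope.

Definition Rm (m : nat) : Type := 'I_m -> R.

Definition dot (m : nat) (x y : Rm m) : R := \big[Rplus/0]_(i < m) (x i * y i).
Definition enorm (m : nat) (x : Rm m) : R := sqrt (dot m x x).

(* [x] with its [i]-th coordinate replaced by [s]. *)
Definition upd (m : nat) (x : Rm m) (i : 'I_m) (s : R) : Rm m :=
  fun j => if j == i then s else x j.

(* Partial derivatives of u(t, x) with respect to t and x_i. [Derive] is total;
   the existence of the derivatives is required in [C12]. *)
Definition d_t (m : nat) (u : R -> Rm m -> R) : R -> Rm m -> R :=
  fun t x => Derive (fun s => u s x) t.
Definition d_x (m : nat) (i : 'I_m) (u : R -> Rm m -> R) : R -> Rm m -> R :=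
  fun t x => Derive (fun s => u t (upd m x i s)) (x i).

Definition laplacian (m : nat) (u : R -> Rm m -> R) : R -> Rm m -> R :=
  fun t x => \big[Rplus/0]_(i < m) d_x m i (d_x m i u) t x.

(* ['I_m -> R] carries the uniform structure of the sup norm. *)
Definition jointly_continuous (m : nat) (f : R -> Rm m -> R) : Prop :=
  forall p : R * ('I_m -> R),
    continuous (fun q : R * ('I_m -> R) => f (fst q) (snd q)) p.

Definition C12 (m : nat) (u : R -> Rm m -> R) : Prop :=
  jointly_continuous m u /\
  (forall t x, ex_derive (fun s => u s x) t) /\
  jointly_continuous m (d_t m u) /\
  (forall i t x, ex_derive (fun s => u t (upd m x i s)) (x i)) /\
  (forall i, jointly_continuous m (d_x m i u)) /\
  (forall i j t x, ex_derive (fun s => d_x m i u t (upd m x j s)) (x j)) /\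
  (forall i j, jointly_continuous m (d_x m j (d_x m i u))).

Definition classical_solution (m : nat) (h : R) (u : R -> Rm m -> R) : Prop :=
  C12 m u /\
  (forall t x, 0 <= u t x) /\
  (forall t x, d_t m u t x = laplacian m u t x + u t x * (1 - u (t - h) x)).

Definition wavefront (m : nat) (h c : R) (nu : Rm m) (phi : R -> R) : Prop :=
  enorm m nu = 1 /\
  classical_solution m h (fun t x => phi (dot m nu x + c * t)) /\
  (forall s, 0 < phi s) /\
  is_lim phi m_infty 0 /\
  is_lim phi p_infty 1.

Definition monotone (f : R -> R) : Prop :=
  (forall s t, s <= t -> f s <= f t) \/ (forall s t, s <= t -> f t <= f s).

Definition monotone_wavefront (m : nat) (h c : R) (nu : Rm m) (phi : R -> R) :
  Prop := wavefront m h c nu phi /\ monotone phi.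

(* In what follows [iota P] is the unique real number satisfying [P]. *)

(* h1 = 0.560771160... and t1 = 0.445... *)
Definition h1 : R :=
  iota (fun h : R => 0 < h /\
    2 * h ^ 2 * exp (1 + sqrt (1 + 4 * h ^ 2) - 2 * h) = 1 + sqrt (1 + 4 * h ^ 2)).

Definition hpar (t : R) : R :=
  (2 * t + sqrt (4 * t ^ 2 + 1)) *
  exp (- 1 - 2 * t / (1 + sqrt (4 * t ^ 2 + 1))).

Definition t1 : R := iota (fun t : R => hpar t = h1 /\ t * hpar t = 1 / 4).

(* The function with eps_star (hpar t) = t * hpar t for 0 <= t <= t1; it is
   meaningful on [1/e, h1] only. *)
Definition eps_star (h : R) : R :=
  iota (fun e : R => exists t, 0 <= t <= t1 /\ hpar t = h /\ e = t * hpar t).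

(* Meaningful for 0 <= h <= h1 only. *)
Definition c_star (h : R) : Rbar :=
  if Rle_dec h (/ exp 1) then p_infty else Finite (1 / sqrt (eps_star h)).

Definition cond1 (h c : R) : Prop :=
  0 <= h <= / exp 1 /\ 2 <= c /\ Rbar_lt c (c_star h).
Definition cond2 (h c : R) : Prop :=
  / exp 1 < h <= h1 /\ 2 <= c /\ Rbar_le c (c_star h).

Definition eps (c : R) : R := / c ^ 2.

Definition lambda (c : R) : R := (1 - sqrt (1 - 4 * eps c)) / (2 * eps c).
Definition mu (c : R) : R := (1 + sqrt (1 - 4 * eps c)) / (2 * eps c).

Lemma lambda_mu_roots (c : R) : 2 <= c ->
  0 < lambda c <= mu c /\
  forall z, eps c * z ^ 2 - z + 1 = eps c * (z - lambda c) * (z - mu c).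
Proof.
move=> hc.
have e0 : 0 < eps c by apply: Rinv_0_lt_compat; nra.
have e1 : 4 * eps c <= 1.
  have : eps c * c ^ 2 = 1 by rewrite /eps; field; lra.
  have : 0 <= eps c * (c ^ 2 - 4) by apply: Rmult_le_pos; nra.
  lra.
have s0 := sqrt_pos (1 - 4 * eps c).
have s2 : sqrt (1 - 4 * eps c) * sqrt (1 - 4 * eps c) = 1 - 4 * eps c.
  by apply: sqrt_sqrt; lra.
rewrite /lambda /mu; move: (sqrt _) s0 s2 => s s0 s2.
split; first split.
- by apply: Rdiv_lt_0_compat; nra.
- apply: Rmult_le_compat_r; last by lra.
  by apply/Rlt_le/Rinv_0_lt_compat; lra.
- move=> z.
  have -> : eps c * (z - (1 - s) / (2 * eps c)) * (z - (1 + s) / (2 * eps c))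
          = eps c * z ^ 2 - z + (1 - s * s) / (4 * eps c) by field; lra.
  by rewrite s2; field; lra.
Qed.

Definition psi (h e z : R) : R := e * z ^ 2 - z - exp (- z * h).

(* l1 <= l2 are all the negative zeros of psi, counted with multiplicity. *)
Definition two_negative_zeros (h e l1 l2 : R) : Prop :=
  l1 <= l2 < 0 /\
  (forall z, z < 0 -> (psi h e z = 0 <-> z = l1 \/ z = l2)) /\
  (l1 = l2 <-> Derive (psi h e) l2 = 0).

Definition lambda2 (h c : R) : R :=
  iota (fun l2 : R =>
    (0 < h /\ exists l1, two_negative_zeros h (eps c) l1 l2) \/
    (h = 0 /\ l2 < 0 /\ forall z, z < 0 -> (psi h (eps c) z = 0 <-> z = l2))).

Definition opA (h c : R) (f : R -> R) : R -> R := fun t =>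
  1 / (eps c * (mu c - lambda c)) *
  RInt_gen (fun s => (exp (lambda c * (t - s)) - exp (mu c * (t - s)))
                     * f s * f (s - h))
    (at_point t) (Rbar_locally p_infty).

Definition opB (h : R) (f : R -> R) : R -> R := fun t =>
  4 * RInt_gen (fun s => (s - t) * exp (2 * (t - s)) * f s * f (s - h))
        (at_point t) (Rbar_locally p_infty).

Definition tau (h c : R) : R :=
  1 / lambda2 h c * ln (lambda c / (lambda c - lambda2 h c)).

Definition phi_minus (h c : R) : R -> R := fun t =>
  if Rle_dec t (tau h c)
  then - lambda2 h c / (lambda c - lambda2 h c) * exp (lambda c * (t - tau h c))
  else 1 - exp (lambda2 h c * t).

Definition tau_crit (h c A : R) : R :=
  iota (fun t : R => 0 < t /\ A * t + 1 = exp (- lambda2 h c * t)).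

Definition phi_minus_crit (h c A : R) : R -> R := fun t =>
  if Rle_dec t (tau_crit h c A)
  then 0
  else 1 - (A * t + 1) * exp (lambda2 h c * t).

Definition iterates_converge (T : (R -> R) -> R -> R) (f phi : R -> R) : Prop :=
  ((forall j t, Nat.iter j T f t <= Nat.iter j.+1 T f t) \/
   (forall j t, Nat.iter j.+1 T f t <= Nat.iter j T f t)) /\
  (forall e : R, 0 < e -> exists N : nat, forall j : nat, (N <= j)%nat ->
     forall t, Rabs (Nat.iter j T f t - phi t) < e).

(* phi is the rescaled profile s |-> varphi (c s) of a monotone wavefront
   varphi, and it is the limit of the iterations started at f. *)
Definition wavefront_from (m : nat) (h c : R) (f phi : R -> R) : Prop :=
  (forall nu : Rm m, enorm m nu = 1 ->
     monotone_wavefront m h c nu (fun s => phi (s / c))) /\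
  (2 < c -> iterates_converge (opA h c) f phi) /\
  (c = 2 -> iterates_converge (opB h) f phi).

Definition unique_profile (m : nat) (h c : R) (phi : R -> R) : Prop :=
  forall (nu : Rm m) (varphi : R -> R), monotone_wavefront m h c nu varphi ->
    exists s0, forall s, varphi (c * s) = phi (s + s0).

(* f(t) = 1 - e^{l t} (1 + o(1)) as t -> +oo. *)
Definition asymptotic_at_1 (l : R) (f : R -> R) : Prop :=
  exists r : R -> R, is_lim r p_infty 0 /\
    forall t, f t = 1 - exp (l * t) * (1 + r t).

(* Main.v *)
Set Warnings "-notation-overridden,-ambiguous-paths,-redundant-canonical-projection".
Require Import Defs.
From HB Require Import structures.
From mathcomp Require Import ssreflect ssrfun ssrbool eqtype ssrnat fintype bigop.
From Stdlib Require Import Reals Lra Psatz.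
From Coquelicot Require Import Coquelicot.
Open Scope R_scope.

(** The profile [phi (s) = varphi (c s)] of a wavefront solves
    [e phi'' - phi' + phi = phi (t) phi (t - h)] with [e = eps c]. For [c >= 2]
    the left-hand side factors as [e (D - l) (D - m)] with [0 < l <= m], and its
    inverse on bounded functions looks forward in time and has a positive kernel.
    Hence the bounded positive solutions are the fixed points of a monotone
    operator, which is [opA] or [opB] ([opA_solves], [opB_solves]). It is handled
    here through two first order equations ([solves]), for which every comparison
    comes down to one fact: a function with [d' >= a d] that grows more slowly
    than [exp (a t)] is nonpositive ([growth_comparison]).

    Existence. The explicit function [f] is a subsolution. At [+ oo] it equals
    [1 - exp (z t)], or [1 - (A t + 1) exp (z t)] if the zero [z = lambda2 h c] is
    double; these exponentials solve the equation linearized at [1], and the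
    neglected quadratic term has the good sign. As the constant [1] is a fixed
    point too, the increasing iterates must be kept away from it. This is done by a
    supersolution [1 - W], where [W] is the leading exponential corrected by a
    faster one and cut off where it becomes negative: the operator only looks
    forward, and [1] is a bound on the left of the cut
    ([subcritical_supersolution], [critical_supersolution]). The limit is then a
    fixed point different from [1], which forces the limit [0] at [- oo]
    ([fixed_point_profile], [iterates_converge_to_profile]).

    Necessity. At [- oo] the quotient [phi' / phi] solves a Riccati equation that
    blows up unless [e <= 1 / 4], that is [c >= 2] ([profile_speed]). At [+ oo]
    the decay rate of the defect [w = 1 - phi] is pushed upwards as long as [psi]
    is negative ([decay_rate]), although it cannot be infinite
    ([defect_not_superexponential]); so [psi] has a negative zero. In the variables
    [t = e / h], [x = - z h] such a zero is a solution of [hump t x = h], and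
    [hpar t] is the maximum of [hump t]: this is the parametrization of the
    critical curve ([conditions_iff]).

    Uniqueness. If [z] is a simple zero, the quantity [Q] conserved by the
    linearized equation is monotone along the nonlinear one, and shows that
    [exp (- z t) w] converges ([defect_asymptotic]). In terms of defects the fixed
    point equation is monotone and strictly sublinear, so two defects with the same
    asymptotics at [+ oo] coincide, by comparison at the point where their quotient
    is smallest ([defect_comparison]). *)

(** * Monotonicity and comparison *)

Lemma derivable_continuous (f : R -> R) (t l : R) :
  is_derive f t l -> continuous f t.
Proof. by move=> D; apply: ex_derive_continuous; exists l. Qed.

Lemma derivable_continuity_pt (f : R -> R) (t l : R) :
  is_derive f t l -> continuity_pt f t.
Proof. by move=> D; apply/continuity_pt_filterlim; apply: derivable_continuous D. Qed.

Lemma mean_value (f df : R -> R) (a b : R) :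
  a <= b -> (forall t, a <= t <= b -> is_derive f t (df t)) ->
  exists t, a <= t <= b /\ f b - f a = df t * (b - a).
Proof.
move=> ab D; have := MVT_gen f a b df; rewrite /= Rmin_left // Rmax_right //.
apply => x hx; first by apply: D; lra.
exact: derivable_continuity_pt (D x hx).
Qed.

Lemma nondecreasing_of_derive (f df : R -> R) (a b : R) :
  a <= b -> (forall t, a <= t <= b -> is_derive f t (df t)) ->
  (forall t, a <= t <= b -> 0 <= df t) -> f a <= f b.
Proof.
move=> ab D P; have [t [ht]] := mean_value f df a b ab D.
by have := P t ht; nra.
Qed.

Lemma derive_at_min (f : R -> R) (t l : R) :
  is_derive f t l -> (forall s, f t <= f s) -> l = 0.
Proof.
move=> D M; have pr : derivable_pt f t by exists l; apply/is_derive_Reals.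
have <- : derive_pt f t pr = l by apply/derive_pt_eq_0/is_derive_Reals.
by apply: (deriv_minimum f (t - 1) (t + 1) t pr); try lra; move=> *; apply: M.
Qed.

Lemma exp_nondecreasing (x y : R) : x <= y -> exp x <= exp y.
Proof. by case=> [/exp_increasing | ->]; lra. Qed.

Lemma exp_le_1 (x : R) : x <= 0 -> exp x <= 1.
Proof. by rewrite -exp_0; apply: exp_nondecreasing. Qed.

Lemma exp_eventually_small (k e : R) : 0 < k -> 0 < e ->
  Rbar_locally p_infty (fun t => exp (- (k * t)) < e).
Proof.
move=> k0 e0; exists (- ln e / k) => t ht.
rewrite -[X in _ < X](exp_ln e) //; apply: exp_increasing.
have : - ln e / k * k < t * k by apply: Rmult_lt_compat_r.
have -> : - ln e / k * k = - ln e by field; lra.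
by lra.
Qed.

(** Consider the last time at which [f] does not exceed its starting value:
    shortly after it [f] is still less than [b], hence cannot have increased. *)
Lemma barrier (f df : R -> R) (t0 b : R) :
  (forall t, t0 <= t -> is_derive f t (df t)) -> f t0 < b ->
  (forall t, t0 <= t -> f t < b -> df t <= 0) ->
  forall t, t0 <= t -> f t <= f t0.
Proof.
move=> D f0 dec t1 t01; apply: Rnot_lt_le => ft1.
pose E s := t0 <= s <= t1 /\ f s <= f t0.
have [s [ubs lubs]] : {s | is_lub E s}.
  apply: completeness; first by exists t1 => s [[_ ?] _].
  by exists t0; split; lra.
have s0 : t0 <= s by apply: ubs; split; lra.
have s1 : s <= t1 by apply: lubs => u [[_ ?] _].
have cs : continuity_pt f s by apply: derivable_continuity_pt (D s s0).
have near_s : forall e, 0 < e -> exists2 d, 0 < d &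
    forall u, Rabs (u - s) < d -> Rabs (f u - f s) < e.
  move=> e e0; have /continuity_pt_filterlim cs' := cs.
  have [d hd] := cs' _ (locally_ball (f s) (mkposreal e e0)).
  by exists d; [apply: cond_pos | move=> u hu; apply: hd].
have fs : f s <= f t0.
  apply: Rnot_lt_le => fs.
  have [|d d0 hd] := near_s (f s - f t0); first by lra.
  have : s <= s - d / 2.
    apply: lubs => u Eu; apply: Rnot_lt_le => hu.
    have us := ubs u Eu; case: Eu => _ fu.
    have : Rabs (u - s) < d by apply: Rabs_def1; lra.
    by move/hd => /Rabs_def2; lra.
  by lra.
have st1 : s < t1 by case: (Req_dec s t1) => [st|]; [rewrite st in fs|]; lra.
have [|d d0 hd] := near_s (b - f t0); first by lra.
pose u := Rmin (s + d / 2) t1.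
have [us ud] : s < u <= s + d / 2 /\ u <= t1.
  by rewrite /u; split; [split; [apply: Rmin_glb_lt | apply: Rmin_l] | apply: Rmin_r]; lra.
have fu : f u <= f s.
  have [x [hx]] : exists x, s <= x <= u /\ f u - f s = df x * (u - s).
    by apply: mean_value => [|x hx]; [|apply: D]; lra.
  have : Rabs (x - s) < d by apply: Rabs_def1; lra.
  move/hd => /Rabs_def2 fx; have := dec x ltac:(lra) ltac:(lra); nra.
have : u <= s by apply: ubs; split; lra.
by lra.
Qed.

(** The comparison principle behind everything: a function with [d' >= a d]
    grows like [exp (a t)] once it is positive, so a slower growth on a
    half-line forces it to be nonpositive there. *)
Lemma growth_comparison (a k K t0 : R) (d dd : R -> R) : k < a ->
  (forall t, t0 <= t -> is_derive d t (dd t)) ->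
  (forall t, t0 <= t -> a * d t <= dd t) ->
  (forall t, t0 <= t -> d t <= K * exp (k * t)) ->
  forall t, t0 <= t -> d t <= 0.
Proof.
move=> ka D ge le t1 t01; apply: Rnot_lt_le => d1.
have grow : forall t, t1 <= t -> d t1 * exp (- (a * t1)) <= d t * exp (- (a * t)).
  move=> t ht; apply: (nondecreasing_of_derive
    (fun t => d t * exp (- (a * t)))
    (fun t => (dd t - a * d t) * exp (- (a * t)))) => // s hs.
    have Ds := D s ltac:(lra); auto_derive; first by exists (dd s).
    by rewrite (is_derive_unique (fun x => d x) _ _ Ds); ring.
  by apply: Rmult_le_pos; [have := ge s ltac:(lra); lra | apply/Rlt_le/exp_pos].
have c0 : 0 < d t1 * exp (- (a * t1)) by apply: Rmult_lt_0_compat => //; apply: exp_pos.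
have K0 : 0 < K.
  apply: Rnot_le_lt => K0; have := le t1 t01; have := exp_pos (k * t1); nra.
have [T hT] := exp_eventually_small (a - k) (d t1 * exp (- (a * t1)) / K)
  ltac:(lra) ltac:(apply: Rdiv_lt_0_compat; lra).
pose t := Rmax t1 (T + 1).
have [ht1 hT1] : t1 <= t /\ T < t.
  by have := Rmax_l t1 (T + 1); have := Rmax_r t1 (T + 1); rewrite -/t; lra.
have := hT t hT1; have := grow t ht1; have := le t ltac:(lra).
move=> le1 grow1 small.
have : K * exp (- ((a - k) * t)) < d t1 * exp (- (a * t1)).
  have := Rmult_lt_compat_l K _ _ K0 small.
  have -> : K * (d t1 * exp (- (a * t1)) / K) = d t1 * exp (- (a * t1)) by field; lra.
  by [].
have -> : - ((a - k) * t) = k * t + - (a * t) by ring.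
rewrite exp_plus -Rmult_assoc.
by have := Rmult_le_compat_r _ _ _ (Rlt_le _ _ (exp_pos (- (a * t)))) le1; lra.
Qed.

Lemma bounded_comparison (a M t0 : R) (d dd : R -> R) : 0 < a ->
  (forall t, t0 <= t -> is_derive d t (dd t)) ->
  (forall t, t0 <= t -> a * d t <= dd t) ->
  (forall t, t0 <= t -> d t <= M) ->
  forall t, t0 <= t -> d t <= 0.
Proof.
move=> a0 D ge le; apply: (growth_comparison a 0 M t0 d dd) => // t ht.
by rewrite Rmult_0_l exp_0 Rmult_1_r; apply: le.
Qed.

(** The arctangent of a solution of [f' >= eta + f^2] would outgrow [PI / 2]. *)
Lemma riccati_blow_up (f df : R -> R) (eta : R) : 0 < eta ->
  (forall t, 0 <= t -> is_derive f t (df t)) ->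
  ~ (forall t, 0 <= t -> eta + f t ^ 2 <= df t).
Proof.
move=> e0 D ge; pose k := Rmin eta 1.
have k0 : 0 < k by apply: Rmin_glb_lt; lra.
pose T := (PI + 1) / k.
have T0 : 0 <= T.
  by apply/Rlt_le/Rdiv_lt_0_compat => //; have := PI_RGT_0; lra.
have [t [ht]] : exists t, 0 <= t <= T /\
    atan (f T) - atan (f 0) = df t / (1 + f t ^ 2) * (T - 0).
  apply: (mean_value (fun t => atan (f t))) => // t ht.
  have Dt := D t ltac:(lra); auto_derive; first by exists (df t).
  rewrite (is_derive_unique (fun x => f x) _ _ Dt) /Rsqr; field.
  by have := pow2_ge_0 (f t); lra.
have q0 : 0 < 1 + f t ^ 2 by have := pow2_ge_0 (f t); lra.
have : k <= df t / (1 + f t ^ 2).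
  apply/Rle_div_r => //; have := ge t ltac:(lra).
  have := Rmin_l eta 1; have := Rmin_r eta 1; rewrite -/k.
  by have := pow2_ge_0 (f t); nra.
have kT : k * T = PI + 1 by rewrite /T; field; lra.
have [] := atan_bound (f T); have [] := atan_bound (f 0); nra.
Qed.

(** * Bounded solutions of first order linear equations *)

(** The bounded solution of [y' = a y - g] is the integral of
    [exp (a (t - s)) g s] over [s >= t]; it is built here as
    [exp (a t) (L - F t)], where [F] is an antiderivative of
    [exp (- a s) g s] and [L] its limit. *)
Lemma bounded_solution (a M : R) (g : R -> R) : 0 < a ->
  (forall t, continuous g t) -> (forall t, 0 <= g t <= M) ->
  exists y : R -> R, (forall t, is_derive y t (a * y t - g t)) /\
    (forall t, 0 <= y t <= M / a).
Proof.
move=> a0 cg gM.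
pose k s := exp (- (a * s)) * g s.
have ck : forall t, continuous k t.
  move=> t; apply: (continuous_mult (fun s => exp (- (a * s))) g) => //.
  by apply: ex_derive_continuous; auto_derive.
pose F t := RInt k 0 t.
have DF : forall t, is_derive F t (k t).
  move=> t; apply: (is_derive_RInt k F 0 t) => //; apply: filter_forall => s.
  by apply: RInt_correct; apply: ex_RInt_continuous => *; apply: ck.
have Fup : forall s t, s <= t -> F s <= F t.
  move=> s t st; apply: (nondecreasing_of_derive F k) => // x hx.
  by apply: Rmult_le_pos; [apply/Rlt_le/exp_pos | have := gM x; lra].
have Fdown : forall s t, s <= t ->
    F t + M / a * exp (- (a * t)) <= F s + M / a * exp (- (a * s)).
  move=> s t st; apply: Ropp_le_cancel.
  apply: (nondecreasing_of_derive (fun t => - (F t + M / a * exp (- (a * t))))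
    (fun t => exp (- (a * t)) * (M - g t))) => // x hx.
    auto_derive; first by exists (k x); apply: DF.
    by rewrite (is_derive_unique (fun x => F x) _ _ (DF x)) /k; field; lra.
  by apply: Rmult_le_pos; [apply/Rlt_le/exp_pos | have := gM x; lra].
have Ma0 : 0 <= M / a by apply: Rdiv_le_0_compat => //; have := gM 0; lra.
pose E x := exists t, x = F t.
have up : forall s t, F t <= F s + M / a * exp (- (a * s)).
  move=> s t; have := exp_pos (- (a * s)) => ps.
  have pos : 0 <= M / a * exp (- (a * s)) by apply: Rmult_le_pos; lra.
  case: (Rle_lt_dec s t) => st; last by have := Fup t s ltac:(lra); lra.
  have := Fdown s t st; have : 0 <= M / a * exp (- (a * t)).
    by apply: Rmult_le_pos => //; apply/Rlt_le/exp_pos.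
  by lra.
have [L [ubL lubL]] : {L | is_lub E L}.
  apply: completeness; last by exists (F 0), 0.
  by exists (F 0 + M / a * exp (- (a * 0))) => _ [t ->]; apply: up.
exists (fun t => exp (a * t) * (L - F t)); split => t.
  auto_derive; first by exists (k t); apply: DF.
  rewrite (is_derive_unique (fun x => F x) _ _ (DF t)) /k exp_Ropp.
  by field; apply/Rgt_not_eq/exp_pos.
have FL : F t <= L by apply: ubL; exists t.
have LF : L <= F t + M / a * exp (- (a * t)) by apply: lubL => _ [s ->]; apply: up.
have := exp_pos (a * t) => pt; split; first by apply: Rmult_le_pos; lra.
apply: (Rle_trans _ (exp (a * t) * (M / a * exp (- (a * t))))).
  by apply: Rmult_le_compat_l; lra.
by rewrite exp_Ropp; apply: Req_le; field; lra.
Qed.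

(** For the derivability conditions that [auto_derive] leaves on abstract
    functions. *)
Ltac derivable :=
  repeat match goal with
  | |- _ /\ _ => split
  | |- True => exact I
  | H : is_derive ?f _ _ |- ex_derive ?f _ => eexists; exact: H
  | H : is_derive ?f _ _ |- ex_derive (fun x => ?f x) _ => eexists; exact: H
  | H : 0 < _ |- _ <> 0 => exact: (Rgt_not_eq _ _ H)
  end.

(** * The limiting operator as a system of two first order equations *)

(** The roots of [e z^2 - z + 1], through Vieta's relations. *)
Definition kpp_roots (e l m : R) : Prop :=
  0 < e /\ 0 < l <= m /\ e * (l + m) = 1 /\ e * (l * m) = 1.

(** [z] is the bounded solution of [e z'' - z' + z = g]: the differential
    operator is [e (D - l) (D - m)], and the auxiliary function is
    [(l - D) z]. *)
Definition solves (e l m : R) (g z : R -> R) : Prop :=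
  exists y : R -> R,
    (forall t, is_derive z t (l * z t - y t)) /\
    (forall t, is_derive y t (m * y t - g t / e)) /\
    (forall t, 0 <= z t <= 1 /\ 0 <= y t <= l).

Lemma solution_exists (e l m : R) (g : R -> R) : kpp_roots e l m ->
  (forall t, continuous g t) -> (forall t, 0 <= g t <= 1) ->
  exists z, solves e l m g z.
Proof.
move=> [e0 [[l0 lm] [_ elm]]] cg gb.
have [|t|t|y [Dy By]] := bounded_solution m (1 / e) (fun t => g t / e); first by lra.
- by apply: (continuous_mult g (fun _ => / e)) => //; apply: continuous_const.
- have ie : 0 < / e by apply: Rinv_0_lt_compat.
  by have := gb t; rewrite /Rdiv; nra.
have ml : 1 / e / m = l.
  have m0 : m <> 0 by lra.
  by apply: (Rmult_eq_reg_l (e * m)); [field_simplify; nra | nra].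
have [|t|t|z [Dz Bz]] := bounded_solution l l y; first by lra.
- exact: derivable_continuous (Dy t).
- by have := By t; rewrite ml.
exists z, y; split=> //; split=> // t; split; last by have := By t; rewrite ml.
by have := Bz t; rewrite /Rdiv Rinv_r //; lra.
Qed.

Lemma derive_shift (f : R -> R) (s t l : R) :
  is_derive f (t + s) l -> is_derive (fun u => f (u + s)) t l.
Proof.
move=> D; auto_derive; first by derivable.
by rewrite (is_derive_unique (fun x => f x) _ _ D) Rmult_1_l.
Qed.

Section Comparison.
Variables (e l m : R).
Hypothesis kr : kpp_roots e l m.

(** A subsolution [f] of [e f'' - f' + f = g] is compared with the solution in
    two steps, one for each factor: here for [x = l f - f'], then for [f] itself
    in [outer_factor]. Everything happens to the right of [t0]. *)
Lemma subsolution_factor (g x dx y : R -> R) (t0 X : R) :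
  (forall t, t0 <= t -> is_derive x t (dx t)) ->
  (forall t, t0 <= t -> m * x t - g t / e <= dx t) ->
  (forall t, t0 <= t -> x t <= X) ->
  (forall t, is_derive y t (m * y t - g t / e)) -> (forall t, 0 <= y t) ->
  forall t, t0 <= t -> x t <= y t.
Proof.
move: kr => [_ [[l0 lm] _]] Dx ge bx Dy y0 t ht; apply: Rminus_le.
apply: (bounded_comparison m X t0 (fun t => x t - y t)
  (fun t => dx t - (m * y t - g t / e))) => // [|s hs|s hs|s hs]; first by lra.
- by apply: (is_derive_minus x y); [apply: Dx | apply: Dy].
- by have := ge s hs; lra.
- by have := bx s hs; have := y0 s; lra.
Qed.

Lemma supersolution_factor (g x dx y : R -> R) (t0 X Y : R) :
  (forall t, t0 <= t -> is_derive x t (dx t)) ->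
  (forall t, t0 <= t -> dx t <= m * x t - g t / e) ->
  (forall t, t0 <= t -> X <= x t) ->
  (forall t, is_derive y t (m * y t - g t / e)) -> (forall t, y t <= Y) ->
  forall t, t0 <= t -> y t <= x t.
Proof.
move: kr => [_ [[l0 lm] _]] Dx le bx Dy y0 t ht; apply: Rminus_le.
apply: (bounded_comparison m (Y - X) t0 (fun t => y t - x t)
  (fun t => (m * y t - g t / e) - dx t)) => // [|s hs|s hs|s hs]; first by lra.
- by apply: (is_derive_minus y x); [apply: Dy | apply: Dx].
- by have := le s hs; lra.
- by have := bx s hs; have := y0 s; lra.
Qed.

Lemma outer_factor (x1 x2 z1 z2 : R -> R) (t0 Z : R) :
  (forall t, t0 <= t -> is_derive z1 t (l * z1 t - x1 t)) ->
  (forall t, t0 <= t -> is_derive z2 t (l * z2 t - x2 t)) ->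
  (forall t, t0 <= t -> x1 t <= x2 t) ->
  (forall t, t0 <= t -> z1 t - z2 t <= Z) ->
  forall t, t0 <= t -> z1 t <= z2 t.
Proof.
move: kr => [_ [[l0 lm] _]] D1 D2 le bd t ht; apply: Rminus_le.
apply: (bounded_comparison l Z t0 (fun t => z1 t - z2 t)
  (fun t => (l * z1 t - x1 t) - (l * z2 t - x2 t))) => // s hs.
- by apply: (is_derive_minus z1 z2); [apply: D1 | apply: D2].
- by have := le s hs; lra.
Qed.

(** Stability of the solution in the sup norm on a half-line; for [d = 0] this
    is monotonicity in the source. *)
Lemma solves_le (g1 g2 z1 z2 : R -> R) (t0 d : R) :
  solves e l m g1 z1 -> solves e l m g2 z2 ->
  (forall t, t0 <= t -> g1 t <= g2 t + d) ->
  forall t, t0 <= t -> z1 t <= z2 t + d.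
Proof.
move=> [y1 [D1 [E1 B1]]] [y2 [D2 [E2 B2]]] le t ht.
move: (kr) => [e0 [[l0 lm] [_ elm]]].
have xy : forall t, t0 <= t -> y1 t - l * d <= y2 t.
  apply: (subsolution_factor g2 (fun t => y1 t - l * d)
    (fun t => m * y1 t - g1 t / e) y2 t0 (l - l * d)) => // [s hs|s hs|s hs|s].
  - by have E := E1 s; auto_derive; [derivable|
      rewrite (is_derive_unique (fun x => y1 x) _ _ E); ring].
  - have -> : m * (y1 s - l * d) - g2 s / e = m * y1 s - (g2 s + d) / e.
      have ml : / e = m * l by apply: (Rmult_eq_reg_l e); [rewrite Rinv_r|]; lra.
      by rewrite /Rdiv ml; ring.
    have ie : 0 < / e by apply: Rinv_0_lt_compat.
    by have := le s hs; rewrite /Rdiv; nra.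
  - by have := B1 s; lra.
  - by have := B2 s; lra.
suff : z1 t - d <= z2 t by lra.
apply: (outer_factor (fun t => y1 t - l * d) y2 (fun t => z1 t - d) z2 t0 (1 - d))
  => // [s hs|s hs].
- by have E := D1 s; auto_derive; [derivable|
    rewrite (is_derive_unique (fun x => z1 x) _ _ E); ring].
- by have := B1 s; have := B2 s; lra.
Qed.

Lemma solves_shift (g z : R -> R) (s : R) : solves e l m g z ->
  solves e l m (fun t => g (t + s)) (fun t => z (t + s)).
Proof.
move=> [y [D [E B]]]; exists (fun t => y (t + s)).
split=> [t|]; first exact: derive_shift.
by split=> [t|t]; [apply: derive_shift | apply: B].
Qed.

Lemma solves_nondecreasing (g z : R -> R) : solves e l m g z ->
  (forall s t, s <= t -> g s <= g t) -> forall s t, s <= t -> z s <= z t.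
Proof.
move=> Sz ng s t st.
have := solves_le _ _ _ _ s 0 Sz (solves_shift _ _ (t - s) Sz) _ s (Rle_refl s).
rewrite (_ : s + (t - s) = t); last by ring.
rewrite Rplus_0_r; apply => u hu; rewrite Rplus_0_r; apply: ng; lra.
Qed.

Lemma solves_lipschitz (g z : R -> R) (s t : R) : solves e l m g z ->
  s <= t -> z t - z s <= l * (t - s).
Proof.
move=> [y [D [E B]]] st; have [u [hu ->]] := mean_value z _ s t st (fun t _ => D t).
move: (kr) => [_ [[l0 _] _]]; apply: Rmult_le_compat_r; first by lra.
by have := B u; nra.
Qed.

(** A zero would propagate to the right, [exp (- l t) z] being nonincreasing. *)
Lemma solves_positive (g z : R -> R) : solves e l m g z ->
  is_lim z p_infty 1 -> forall t, 0 < z t.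
Proof.
move=> [y [D [E B]]] z1 t; apply: Rnot_le_lt => zt.
have /is_lim_spec/(_ (mkposreal 1 Rlt_0_1)) /= [T hT] := z1.
pose s := Rmax t (T + 1).
have [ts Ts] : t <= s /\ T < s.
  by have := Rmax_l t (T + 1); have := Rmax_r t (T + 1); rewrite -/s; lra.
have : - (z t * exp (- (l * t))) <= - (z s * exp (- (l * s))).
  apply: (nondecreasing_of_derive (fun t => - (z t * exp (- (l * t))))
    (fun t => y t * exp (- (l * t)))) => // u hu.
    have Du := D u; auto_derive; first by derivable.
    by rewrite (is_derive_unique (fun x => z x) _ _ Du); ring.
  by apply: Rmult_le_pos; [have := B u; lra | apply/Rlt_le/exp_pos].
have := exp_pos (- (l * t)); have := exp_pos (- (l * s)).
by have /Rabs_def2 := hT s Ts; nra.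
Qed.

End Comparison.

(** * The integral operators *)

Lemma RInt_gen_antiderivative (F k : R -> R) (t a : R) :
  (forall s, is_derive F s (k s)) -> (forall s, continuous k s) ->
  is_lim F p_infty a ->
  RInt_gen k (at_point t) (Rbar_locally p_infty) = a - F t.
Proof.
move=> D C lim; apply is_RInt_gen_unique.
move=> P [d hP].
have /is_lim_spec/(_ d) [M hM] := lim.
exists (fun x => x = t) (fun x => M < x).
- by [].
- by exists M.
move=> _ s -> hs /=; exists (F s - F t); split.
  by apply: (is_RInt_derive F k) => x _; [apply: D | apply: C].
apply: hP; rewrite /ball /= /AbsRing_ball /= /abs /minus /plus /opp /=.
by have := hM s hs; rewrite (_ : F s - F t + - (a - F t) = F s - a) //; ring.
Qed.

Lemma bounded_decay (k M T : R) (b : R -> R) : 0 < k ->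
  (forall t, T <= t -> Rabs (b t) <= M) ->
  is_lim (fun t => exp (- (k * t)) * b t) p_infty 0.
Proof.
move=> k0 bM; apply/is_lim_spec => e /=.
have M0 : 0 <= M by apply: Rle_trans (bM T (Rle_refl T)); apply: Rabs_pos.
have e1 : 0 < e / (M + 1) by apply: Rdiv_lt_0_compat; [apply: cond_pos | lra].
have [S hS] := exp_eventually_small k _ k0 e1.
exists (Rmax S T) => t ht.
have [St Tt] : S < t /\ T <= t.
  by have := Rmax_l S T; have := Rmax_r S T; lra.
rewrite Rminus_0_r Rabs_mult Rabs_pos_eq; last exact/Rlt_le/exp_pos.
have p := exp_pos (- (k * t)); have q := Rabs_pos (b t).
have : exp (- (k * t)) * (M + 1) < e.
  have := Rmult_lt_compat_r (M + 1) _ _ ltac:(lra) (hS t St).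
  by rewrite (_ : e / (M + 1) * (M + 1) = e) //; field; lra.
by have := bM t Tt; nra.
Qed.

Lemma roots_spec (c : R) : 2 <= c -> kpp_roots (eps c) (lambda c) (mu c).
Proof.
move=> hc; have [ll vieta] := lambda_mu_roots c hc.
have e0 : 0 < eps c by apply: Rinv_0_lt_compat; nra.
split=> //; split=> //.
by have := vieta 0; have := vieta 1; have := vieta (-1); split; lra.
Qed.

Lemma roots_distinct (c : R) : 2 < c -> lambda c < mu c.
Proof.
move=> hc; have e0 : 0 < eps c by apply: Rinv_0_lt_compat; nra.
have ec : eps c * c ^ 2 = 1 by rewrite /eps; field; lra.
have s0 : 0 < sqrt (1 - 4 * eps c) by apply: sqrt_lt_R0; nra.
by apply: Rmult_lt_compat_r; [apply: Rinv_0_lt_compat|]; lra.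
Qed.

Definition admissible (f : R -> R) : Prop :=
  (forall t, continuous f t) /\ (forall t, 0 <= f t <= 1).

Lemma continuous_shift (f : R -> R) (a t : R) :
  (forall t, continuous f t) -> continuous (fun s => f (s - a)) t.
Proof.
move=> C; apply: (continuous_comp (fun s => s - a) f) => //.
by apply: ex_derive_continuous; auto_derive.
Qed.

(** The nonlinearity of the rescaled profile equation. *)
Definition source (h : R) (f : R -> R) : R -> R := fun t => f t * f (t - h).

Lemma source_admissible (h : R) (f : R -> R) :
  admissible f -> admissible (source h f).
Proof.
move=> [C B]; split=> t; last by have := B t; have := B (t - h); rewrite /source; nra.
by apply: (continuous_mult f (fun t => f (t - h))) => //; apply: continuous_shift.
Qed.

Lemma opA_solves (h c : R) (f : R -> R) : 2 < c -> admissible f ->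
  solves (eps c) (lambda c) (mu c) (source h f) (opA h c f).
Proof.
move=> hc Af; have kr := roots_spec c (Rlt_le _ _ hc).
have [Cg Bg] := source_admissible h f Af.
have [z Sz] := solution_exists _ _ _ _ kr Cg Bg.
have {kr} [e0 [[l0 _] [_ _]]] := kr; have lm := roots_distinct c hc.
suff opz : forall t, opA h c f t = z t.
  case: Sz => y [Dz [Dy B]]; exists y; split=> [t|].
    by rewrite opz; apply: is_derive_ext (Dz t) => s.
  by split=> // t; rewrite opz.
move=> t; case: Sz => y [Dz [Dy B]]; rewrite /opA.
(* Integration by parts, with [y] for the exponential of [mu] and with
   [(mu - lambda) z + y] for that of [lambda]. *)
pose F s := eps c * (- (mu c - lambda c) * exp (lambda c * (t - s)) * z s
  - exp (lambda c * (t - s)) * y s + exp (mu c * (t - s)) * y s).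
rewrite (RInt_gen_antiderivative F _ t 0).
- rewrite /F Rminus_diag !Rmult_0_r exp_0; field; lra.
- move=> s; rewrite /F; have Ds := Dz s; have Es := Dy s.
  auto_derive; first by derivable.
  rewrite (is_derive_unique (fun x => z x) _ _ Ds) (is_derive_unique (fun x => y x) _ _ Es).
  by rewrite /source /Rminus; field; lra.
- move=> s.
  apply: (continuous_ext (fun s => (exp (lambda c * (t - s)) - exp (mu c * (t - s)))
    * source h f s)); first by move=> x; rewrite /source -Rmult_assoc.
  apply: (continuous_mult (fun s => exp (lambda c * (t - s)) - exp (mu c * (t - s)))
    (source h f)) => //.
  by apply: ex_derive_continuous; auto_derive.
have absz : forall s, Rabs (z s) <= 1 by move=> s; have [? ?] := B s; rewrite Rabs_pos_eq; lra.
have absy : forall s, Rabs (y s) <= lambda c.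
  by move=> s; have [? ?] := B s; rewrite Rabs_pos_eq; lra.
apply: (is_lim_ext (fun s =>
  (- eps c * (mu c - lambda c) * exp (lambda c * t)) * (exp (- (lambda c * s)) * z s)
  + (- eps c * exp (lambda c * t)) * (exp (- (lambda c * s)) * y s)
  + (eps c * exp (mu c * t)) * (exp (- (mu c * s)) * y s))).
  move=> s; rewrite /F.
  have ex : forall a, exp (a * (t - s)) = exp (a * t) * exp (- (a * s)).
    by move=> a; rewrite -exp_plus; congr exp; ring.
  by rewrite !ex; ring.
have lim0 : forall K k M b, 0 < k -> (forall s, Rabs (b s) <= M) ->
    is_lim (fun s => K * (exp (- (k * s)) * b s)) p_infty 0.
  move=> K k M b k0 bM.
  have := is_lim_scal_l _ K _ _ (bounded_decay k M 0 b k0 (fun s _ => bM s)).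
  by rewrite /= Rmult_0_r.
rewrite -[X in is_lim _ _ (Finite X)](Rplus_0_r 0) -[X in Finite (X + _)](Rplus_0_r 0).
apply: is_lim_plus'; first apply: is_lim_plus'.
- exact: lim0 l0 absz.
- exact: lim0 l0 absy.
- by apply: lim0 absy; lra.
Qed.

Lemma double_root : eps 2 = / 4 /\ lambda 2 = 2 /\ mu 2 = 2.
Proof.
have e4 : eps 2 = / 4 by rewrite /eps; congr Rinv; ring.
rewrite /lambda /mu e4 (_ : 1 - 4 * / 4 = 0); last by field.
by rewrite sqrt_0; split=> //; split; field.
Qed.

Lemma opB_solves (h : R) (f : R -> R) : admissible f ->
  solves (eps 2) (lambda 2) (mu 2) (source h f) (opB h f).
Proof.
move=> Af; have kr := roots_spec 2 (Rle_refl 2).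
have [Cg Bg] := source_admissible h f Af.
have [z Sz] := solution_exists _ _ _ _ kr Cg Bg.
have [e4 [l2 m2]] := double_root.
suff opz : forall t, opB h f t = z t.
  case: Sz => y [Dz [Dy B]]; exists y; split=> [t|].
    by rewrite opz; apply: is_derive_ext (Dz t) => s.
  by split=> // t; rewrite opz.
move=> t; rewrite e4 l2 m2 in Sz; case: Sz => y [Dz [Dy B]]; rewrite /opB.
(* The same antiderivative in the confluent case: the factor [s - t] calls for
   [y], and what remains is the derivative of [exp (2 (t - s)) z]. *)
pose F s := / 4 * (- exp (2 * (t - s)) * z s - (s - t) * exp (2 * (t - s)) * y s).
rewrite (RInt_gen_antiderivative F _ t 0).
- by rewrite /F Rminus_diag !Rmult_0_r exp_0; field.
- move=> s; rewrite /F; have Ds := Dz s; have Es := Dy s.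
  auto_derive; first by derivable.
  rewrite (is_derive_unique (fun x => z x) _ _ Ds) (is_derive_unique (fun x => y x) _ _ Es).
  by rewrite /source /Rminus; field.
- move=> s.
  apply: (continuous_ext (fun s => (s - t) * exp (2 * (t - s)) * source h f s));
    first by move=> x; rewrite /source -Rmult_assoc.
  apply: (continuous_mult (fun s => (s - t) * exp (2 * (t - s))) (source h f)) => //.
  by apply: ex_derive_continuous; auto_derive.
apply: (is_lim_ext (fun s => (- / 4 * exp t) *
  (exp (- (1 * s)) * (exp (t - s) * z s + (s - t) * exp (t - s) * y s)))).
  move=> s; rewrite /F (_ : exp (2 * (t - s)) = exp t * exp (- (1 * s)) * exp (t - s)).
    by ring.
  by rewrite -!exp_plus; congr exp; ring.
have := is_lim_scal_l _ (- / 4 * exp t) p_infty 0; rewrite [Rbar_mult _ _]/= Rmult_0_r; apply.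
apply: (bounded_decay 1 3 t) => [|s ts]; first by lra.
have rexp : (s - t) * exp (t - s) <= 1.
  rewrite (_ : t - s = - (s - t)); last by ring.
  have := exp_ineq1_le (s - t); have := exp_pos (s - t) => p q.
  by rewrite exp_Ropp -/(Rdiv (s - t) _); apply/Rle_div_l; lra.
have exp1 : exp (t - s) <= 1 by rewrite -exp_0; apply: exp_nondecreasing; lra.
have [[z0 z1] [y0 y1]] := B s; have p := exp_pos (t - s).
have r0 : 0 <= (s - t) * exp (t - s) by apply: Rmult_le_pos; lra.
have za : 0 <= exp (t - s) * z s <= 1 by nra.
have yb : 0 <= (s - t) * exp (t - s) * y s <= 2 by nra.
by rewrite Rabs_pos_eq; lra.
Qed.

(** * Wave profiles as limits of monotone iterations *)

Definition nondecreasing (f : R -> R) : Prop := forall s t, s <= t -> f s <= f t.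

(** The equation [e phi'' - phi' + phi (1 - phi (t - h)) = 0] of a monotone
    wavefront in the rescaled variable, with [p = phi']. *)
Definition profile (h e : R) (phi p : R -> R) : Prop :=
  [/\ forall t, is_derive phi t (p t),
      forall t, is_derive p t ((p t - phi t * (1 - phi (t - h))) / e),
      forall t, 0 < phi t,
      nondecreasing phi &
      is_lim phi m_infty 0 /\ is_lim phi p_infty 1].

Lemma solves_admissible (e l m : R) (g z : R -> R) :
  solves e l m g z -> admissible z.
Proof.
by move=> [y [D [E B]]]; split=> t; [apply: derivable_continuous (D t) | have [] := B t].
Qed.

Lemma nondecreasing_lim_le (f : R -> R) (a : R) :
  nondecreasing f -> is_lim f p_infty a -> forall t, f t <= a.
Proof.
move=> nf /is_lim_spec lf t; apply: Rnot_lt_le => ft.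
have d0 : 0 < f t - a by lra.
have [T hT] := lf (mkposreal _ d0); pose s := Rmax t (T + 1).
have [ts Ts] : t <= s /\ T < s.
  by have := Rmax_l t (T + 1); have := Rmax_r t (T + 1); rewrite -/s; lra.
by have := nf t s ts; have /Rabs_def2 /= := hT s Ts; lra.
Qed.

Section Iteration.
Variables (h e l m : R) (T : (R -> R) -> R -> R).
Hypothesis h0 : 0 <= h.
Hypothesis kr : kpp_roots e l m.
Hypothesis TS : forall f, admissible f -> solves e l m (source h f) (T f).

Lemma source_le (f g : R -> R) (t d : R) : 0 <= d ->
  admissible f -> admissible g ->
  (forall s, t - h <= s -> f s <= g s + d) ->
  forall s, t <= s -> source h f s <= source h g s + 2 * d.
Proof.
move=> d0 [_ Bf] [_ Bg] le s ts; rewrite /source.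
have := le s ltac:(lra); have := le (s - h) ltac:(lra).
by have := Bf s; have := Bf (s - h); have := Bg s; have := Bg (s - h); nra.
Qed.

Lemma operator_monotone (f g : R -> R) : admissible f -> admissible g ->
  (forall t, f t <= g t) -> forall t, T f t <= T g t.
Proof.
move=> Af Ag le t.
have := solves_le e l m kr _ _ _ _ t 0 (TS f Af) (TS g Ag) _ t (Rle_refl t).
rewrite Rplus_0_r; apply => s ts.
have := source_le f g t 0 (Rle_refl 0) Af Ag _ s ts; rewrite Rmult_0_r; apply => u _.
by have := le u; lra.
Qed.

(** A positive lower bound of a fixed point makes [e p - phi] grow linearly
    towards [- oo], although [p] is bounded. *)
Lemma fixed_point_profile (phi : R -> R) :
  solves e l m (source h phi) phi -> nondecreasing phi -> is_lim phi p_infty 1 ->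
  (exists t, phi t < 1) -> exists p, profile h e phi p.
Proof.
move=> S np l1 [t0 phi1].
have pos := solves_positive e l m _ _ S l1.
case: (S) => y [D [E B]]; case: (kr) => [e0 [[l0 lm] [es ep]]].
pose p t := l * phi t - y t.
have Dp : forall t, is_derive p t ((p t - phi t * (1 - phi (t - h))) / e).
  move=> t; have Dt := D t; have Et := E t; rewrite /p; auto_derive; first by derivable.
  rewrite (is_derive_unique (fun x => phi x) _ _ Dt) (is_derive_unique (fun x => y x) _ _ Et).
  have ies : / e = l + m by apply: (Rmult_eq_reg_l e); [rewrite Rinv_r|]; lra.
  have iep : / e = l * m by apply: (Rmult_eq_reg_l e); [rewrite Rinv_r|]; lra.
  have := congr1 (Rmult (l * phi t - y t)) ies; have := congr1 (Rmult (phi t)) iep.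
  by rewrite /source /Rdiv; lra.
exists p; split=> //; split=> //; apply/is_lim_spec => d /=.
suff [t phit] : exists t, phi t < d.
  exists t => s st; have := np s t (Rlt_le _ _ st); have := pos s.
  by rewrite Rminus_0_r => *; rewrite Rabs_pos_eq; lra.
have [big|small] := Classical_Prop.classic (forall t, d <= phi t); last first.
  have [t ht] := Classical_Pred_Type.not_all_ex_not _ _ small.
  by exists t; lra.
exfalso; have d0 := cond_pos d.
pose k := d * (1 - phi t0); have k0 : 0 < k by apply: Rmult_lt_0_compat; lra.
pose H t := e * p t - phi t.
pose t := t0 - (e * l - H t0 + 1) / k.
have Hup : forall s, H s <= e * l.
  move=> s; rewrite /H; apply: (Rle_trans _ (e * p s)); first by have := pos s; lra.
  by apply: Rmult_le_compat_l; [lra | have := B s; rewrite /p; nra].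
have tt0 : t <= t0.
  suff : 0 <= (e * l - H t0 + 1) / k by rewrite /t; lra.
  by apply: Rdiv_le_0_compat => //; have := Hup t0; lra.
have [s [hs eqs]] : exists s, t <= s <= t0 /\
    H t0 - H t = - (phi s * (1 - phi (s - h))) * (t0 - t).
  apply: (mean_value H (fun s => - (phi s * (1 - phi (s - h))))) => // s hs.
  have Ds := Dp s; have Es := D s; rewrite /H; auto_derive; first by derivable.
  rewrite (is_derive_unique (fun x => p x) _ _ Ds) (is_derive_unique (fun x => phi x) _ _ Es).
  by rewrite /p; field; lra.
have kle : k <= phi s * (1 - phi (s - h)).
  rewrite /k; have := big s; have := np (s - h) t0 ltac:(lra); nra.
have kt : k * (t0 - t) = e * l - H t0 + 1 by rewrite /t; field; lra.
by have := Hup t; have := Rmult_le_compat_r (t0 - t) _ _ ltac:(lra) kle; lra.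
Qed.

Variables (f g : R -> R).
Hypothesis Af : admissible f.
Hypothesis nf : nondecreasing f.
Hypothesis f1 : is_lim f p_infty 1.
Hypothesis sub : forall t, f t <= T f t.
Hypothesis sup : forall k, admissible k ->
  (forall t, k t <= g t) -> forall t, T k t <= g t.
Hypothesis fg : forall t, f t <= g t.
Hypothesis g1 : exists t, g t < 1.

Let F j := Nat.iter j T f.

Let AF j : admissible (F j).
Proof. by elim: j => [|j A] //; apply: solves_admissible (TS _ A). Qed.

Let nF j : nondecreasing (F j).
Proof.
elim: j => [|j n] // s t st.
apply: (solves_nondecreasing e l m kr _ _ (TS _ (AF j)) _ s t st) => u v uv.
have [_ B] := AF j; rewrite /source.
apply: Rmult_le_compat; [by have := B u; lra | by have := B (u - h); lra | exact: n |].
by apply: n; lra.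
Qed.

Let F_incr j t : F j t <= F j.+1 t.
Proof.
elim: j t => [|j I] t; first exact: sub.
exact: (operator_monotone _ _ (AF j) (AF j.+1) I).
Qed.

Let F_mono i j t : (i <= j)%nat -> F i t <= F j t.
Proof.
elim: j => [|j I]; first by rewrite leqn0 => /eqP ->; apply: Rle_refl.
rewrite leq_eqVlt => /orP [/eqP -> | /I ij]; first exact: Rle_refl.
by apply: Rle_trans ij (F_incr j t).
Qed.

Let Fg j t : F j t <= g t.
Proof. by elim: j t => [|j I] t; [exact: fg | exact: sup (AF j) I t]. Qed.

(** The iterates increase, have a common Lipschitz constant, and are squeezed
    between [f] and [1]; hence they converge uniformly on half-lines
    [[a, +oo[], which is all that the operator sees of its argument. The
    uniformity near [- oo] follows once the limit is known to vanish there. *)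
Lemma iterates_converge_to_profile :
  exists phi p, [/\ profile h e phi p, iterates_converge T f phi &
    forall t, f t <= phi t <= g t].
Proof.
have [l0 _] : 0 < l /\ True by case: kr => _ [[? _] _].
pose phi t := real (Lim_seq (fun j => F j t)).
have lim : forall t, is_lim_seq (fun j => F j t) (phi t).
  move=> t; apply/Lim_seq_correct'/(ex_finite_lim_seq_incr _ 1) => j; first exact: F_incr.
  by have [_ /(_ t)] := AF j; lra.
have up : forall t b, (forall j, F j t <= b) -> phi t <= b.
  move=> t b Fb; exact: (is_lim_seq_le _ (fun _ => b) (phi t) b Fb (lim t) (is_lim_seq_const b)).
have below : forall j t, F j t <= phi t.
  move=> j t; apply: (is_lim_seq_incr_compare (fun j => F j t)) => // i; exact: F_incr.
have np : nondecreasing phi.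
  by move=> s t st; apply: up => j; apply: Rle_trans (below j t); apply: nF.
have lip : forall s t, s <= t -> phi t - phi s <= l * (t - s).
  move=> s t st; suff : phi t <= phi s + l * (t - s) by lra.
  apply: up => j; apply: Rle_trans (F_incr j t) _.
  have := solves_lipschitz e l m kr _ _ s t (TS _ (AF j)) st.
  by have := below j.+1 s; rewrite /= -/(F j); lra.
have phi_bounds : forall t, 0 <= phi t <= 1.
  move=> t; split; first by apply: Rle_trans (below O t); have [_ /(_ t)] := AF O; lra.
  by apply: up => j; have [_ /(_ t)] := AF j; lra.
have cphi : forall t, continuous phi t.
  move=> t; apply/filterlim_locally => d.
  have d0 : 0 < d / l by apply: Rdiv_lt_0_compat => //; apply: cond_pos.
  have ld : l * (d / l) = d by field; lra.
  exists (mkposreal _ d0) => s; rewrite /ball /= /AbsRing_ball /= /abs /minus /plus /opp /=.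
  move/Rabs_def2 => hs; apply: Rabs_def1; case: (Rle_lt_dec s t) => st.
  - by have := np s t st; have := cond_pos d; lra.
  - by have := lip t s; nra.
  - by have := lip s t st; nra.
  - by have := np t s; have := cond_pos d; lra.
have Aphi : admissible phi by [].
have unif : forall a d, 0 < d -> exists N, forall t, a <= t -> phi t <= F N t + d.
  move=> a d d0.
  have /is_lim_spec/(_ (mkposreal d d0)) /= [b hb] := f1.
  (* Past [b] both functions are within [d] of [1]; up to [b], convergence at the
     points of a grid is enough if the mesh [eta] keeps the oscillation below
     [d / 2]. *)
  pose eta := d / 2 / l; have eta0 : 0 < eta by do 2!apply: Rdiv_lt_0_compat => //; lra.
  have leta : l * eta = d / 2 by rewrite /eta; field; lra.
  suff grid : forall n : nat, exists N, forall t, a <= t <= a + INR n * eta -> phi t <= F N t + d.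
    have [n hn] := INR_unbounded ((b + 1 - a) / eta).
    have [N hN] := grid n; exists N => t ta0.
    case: (Rle_lt_dec t (a + INR n * eta)) => tn; first by apply: hN.
    have bt : b < t.
      have : (b + 1 - a) / eta * eta < INR n * eta by apply: Rmult_lt_compat_r.
      by rewrite (_ : (b + 1 - a) / eta * eta = b + 1 - a); [lra | field; lra].
    have /Rabs_def2 := hb t bt; have := F_mono O N t (leq0n N).
    by have := phi_bounds t; rewrite /F /=; lra.
  have grid_point : forall t, exists N, phi t <= F N t + d / 2.
    move=> t; have d20 : 0 < d / 2 by lra.
    have /is_lim_seq_spec/(_ (mkposreal _ d20)) /= [N hN] := lim t.
    by exists N; have /Rabs_def2 := hN N (Nat.le_refl N); lra.
  elim=> [|n [N hN]].
    have [N hN] := grid_point a; exists N => t; rewrite /= => ht.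
    by rewrite (_ : t = a); lra.
  have [M hM] := grid_point (a + INR n * eta); exists (maxn N M) => t.
  rewrite S_INR => ht; case: (Rle_lt_dec t (a + INR n * eta)) => tn.
    have := F_mono N (maxn N M) t (leq_maxl N M).
    by have := hN t ltac:(lra); lra.
  have := F_mono M (maxn N M) (a + INR n * eta) (leq_maxr N M).
  have := nF (maxn N M) (a + INR n * eta) t ltac:(lra).
  have := lip (a + INR n * eta) t ltac:(lra).
  have : l * (t - (a + INR n * eta)) <= l * eta by apply: Rmult_le_compat_l; lra.
  lra.
have fixed : forall t, T phi t = phi t.
  move=> t; apply: Rle_antisym.
    apply: le_epsilon => d d0.
    have [N hN] := unif (t - h) (d / 2) ltac:(lra).
    have := solves_le e l m kr _ _ _ _ t (2 * (d / 2)) (TS _ Aphi) (TS _ (AF N))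
      (source_le phi (F N) t (d / 2) ltac:(lra) Aphi (AF N) hN) t (Rle_refl t).
    by have := below N.+1 t; rewrite /= -/(F N); lra.
  apply: up => j; apply: Rle_trans (F_incr j t) _.
  exact: (operator_monotone _ _ (AF j) Aphi (below j) t).
have Sphi : solves e l m (source h phi) phi.
  by have := TS _ Aphi; rewrite (FunctionalExtensionality.functional_extensionality _ _ fixed).
have phi1 : is_lim phi p_infty 1.
  apply: (is_lim_le_le_loc f (fun _ => 1)) => //; last exact: is_lim_const.
  by exists 0 => t _; split; [apply: (below O) | have := phi_bounds t; lra].
have phig : forall t, phi t <= g t by move=> t; apply: up => j; apply: Fg.
have [p P] : exists p, profile h e phi p.
  apply: fixed_point_profile => //.
  by have [t gt] := g1; exists t; apply: Rle_lt_trans (phig t) gt.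
exists phi, p; split=> //; last by split; [apply: (below O) | apply: phig].
split; first by left=> j t; apply: F_incr.
move=> d d0; case: P => _ _ _ _ [phi0 _].
have /is_lim_spec/(_ (mkposreal d d0)) /= [a ha] := phi0.
have [N hN] := unif (a - 1) (d / 2) ltac:(lra).
exists N => j Nj t; rewrite -/(F j).
have := below j t; have [_ /(_ t) Bj] := AF j.
case: (Rle_lt_dec (a - 1) t) => ta.
  have := hN t ta; have := F_mono N j t Nj.
  by move=> *; apply: Rabs_def1; lra.
have /Rabs_def2 := ha t ltac:(lra).
by move=> *; apply: Rabs_def1; lra.
Qed.

End Iteration.

(** * The characteristic function and the critical curves *)

(** With [t = e / h] and [z = - x / h] the equation [psi h e z = 0] reads
    [hump t x = h]: delay and diffusion separate, and the existence of a
    negative zero becomes a comparison of [h] with the maximum of [hump t]. *)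
Definition hump (t x : R) : R := x * (1 + t * x) * exp (- x).

(** The positive root of [t x ^ 2 + (1 - 2 t) x - 1], which is up to sign the
    numerator of the logarithmic derivative of [hump t], in a form that covers
    [t = 0]. *)
Definition hump_top (t : R) : R := 1 + 2 * t / (1 + sqrt (4 * t ^ 2 + 1)).

Lemma hump_top_spec (t : R) : 0 <= t ->
  1 <= hump_top t /\ t * hump_top t ^ 2 + (1 - 2 * t) * hump_top t - 1 = 0 /\
  hump t (hump_top t) = hpar t.
Proof.
move=> t0; rewrite /hump /hpar /hump_top.
have s0 : 0 < sqrt (4 * t ^ 2 + 1) by apply: sqrt_lt_R0; nra.
have s2 : sqrt (4 * t ^ 2 + 1) * sqrt (4 * t ^ 2 + 1) = 4 * t ^ 2 + 1.
  by apply: sqrt_sqrt; nra.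
move: (sqrt _) s0 s2 => s s0 s2.
have X1 : 0 <= 2 * t / (1 + s) by apply: Rdiv_le_0_compat; lra.
have tX : t * (2 * t / (1 + s)) = (s - 1) / 2.
  by apply: (Rmult_eq_reg_r (1 + s)); [field_simplify; nra | lra].
split; first by lra.
have qs : 2 * t / (1 + s) * (1 + s) = 2 * t by field; lra.
move: (2 * t / (1 + s)) X1 tX qs => q q0 tq qs.
split; first by nra.
rewrite (_ : - (1 + q) = - 1 - q); last by ring.
by congr (_ * _); nra.
Qed.

Lemma hump_derive (t x : R) : 0 <= t ->
  is_derive (hump t) x
    ((hump_top t - x) * (t * x + / hump_top t) * exp (- x)).
Proof.
move=> t0; have [X1 [eX _]] := hump_top_spec t t0.
rewrite /hump; auto_derive => //.
have -> : / hump_top t = t * hump_top t + (1 - 2 * t).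
  by apply: (Rmult_eq_reg_r (hump_top t)); [rewrite Rinv_l|]; lra.
have -> : (hump_top t - x) * (t * x + (t * hump_top t + (1 - 2 * t))) =
  1 + 2 * t * x - x - t * x ^ 2 by lra.
by ring.
Qed.

Lemma hump_increasing (t x y : R) : 0 <= t -> 0 <= x -> x < y -> y <= hump_top t ->
  hump t x < hump t y.
Proof.
move=> t0 x0 xy yX; have [X1 _] := hump_top_spec t t0.
have iX : 0 < / hump_top t by apply: Rinv_0_lt_compat; lra.
pose z := (x + y) / 2.
have le : forall a b, x <= a -> a <= b -> b <= y -> hump t a <= hump t b.
  move=> a b xa ab yb; apply: (nondecreasing_of_derive (hump t) _ _ _ ab
    (fun s _ => hump_derive t s t0)) => s hs.
  by apply: Rmult_le_pos; [apply: Rmult_le_pos; nra | apply/Rlt_le/exp_pos].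
have [s [hs E]] := mean_value (hump t) _ x z ltac:(rewrite /z; lra)
  (fun s _ => hump_derive t s t0).
have : 0 < (hump_top t - s) * (t * s + / hump_top t) * exp (- s) * (z - x).
  have zy : z < y by rewrite /z; lra.
  apply: Rmult_lt_0_compat; last by rewrite /z; lra.
  by apply: Rmult_lt_0_compat; [apply: Rmult_lt_0_compat; nra | apply: exp_pos].
by have := le z y; rewrite /z in E *; lra.
Qed.

Lemma hump_decreasing (t x y : R) : 0 <= t -> hump_top t <= x -> x < y ->
  hump t y < hump t x.
Proof.
move=> t0 Xx xy; have [X1 _] := hump_top_spec t t0.
have iX : 0 < / hump_top t by apply: Rinv_0_lt_compat; lra.
pose z := (x + y) / 2.
have le : forall a b, x <= a -> a <= b -> b <= y -> - hump t a <= - hump t b.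
  move=> a b xa ab yb; apply: (nondecreasing_of_derive (fun s => - hump t s) _ _ _ ab
    (fun s _ => is_derive_opp (hump t) s _ (hump_derive t s t0))) => s hs.
  rewrite /opp /= Ropp_mult_distr_l; apply: Rmult_le_pos; last exact/Rlt_le/exp_pos.
  by rewrite Ropp_mult_distr_l; apply: Rmult_le_pos; nra.
have [s [hs E]] := mean_value (hump t) _ z y ltac:(rewrite /z; lra)
  (fun s _ => hump_derive t s t0).
have : 0 < (s - hump_top t) * (t * s + / hump_top t) * exp (- s) * (y - z).
  have zx : x < z by rewrite /z; lra.
  apply: Rmult_lt_0_compat; last by rewrite /z; lra.
  by apply: Rmult_lt_0_compat; [apply: Rmult_lt_0_compat; nra | apply: exp_pos].
by have := le x z; rewrite /z in E *; nra.
Qed.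

Lemma hump_le_hpar (t x : R) : 0 <= t -> 0 <= x ->
  hump t x <= hpar t /\ (x <> hump_top t -> hump t x < hpar t).
Proof.
move=> t0 x0; have [X1 [_ <-]] := hump_top_spec t t0.
case: (Rtotal_order x (hump_top t)) => [lt|[->|gt]]; first 1 last.
- by split; [apply: Rle_refl | ].
- by have := hump_decreasing t (hump_top t) x t0 (Rle_refl _) gt; lra.
- by have := hump_increasing t x (hump_top t) t0 x0 lt (Rle_refl _); lra.
Qed.

(** [hpar t] is the maximum of [hump t], and [hump] increases with [t]. *)
Lemma hpar_increasing (s t : R) : 0 <= s -> s < t -> hpar s < hpar t.
Proof.
move=> s0 st; have [X1 [_ <-]] := hump_top_spec s s0.
have [le _] := hump_le_hpar t (hump_top s) ltac:(lra) ltac:(lra).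
apply: Rlt_le_trans le; apply: Rmult_lt_compat_r; first exact: exp_pos.
by apply: Rmult_lt_compat_l; nra.
Qed.

Lemma hpar_0 : hpar 0 = / exp 1.
Proof.
rewrite /hpar (_ : 4 * 0 ^ 2 + 1 = 1); last by ring.
by rewrite sqrt_1 -exp_Ropp Rmult_0_r Rplus_0_l Rmult_1_l; congr exp; field.
Qed.

Lemma hpar_le_reg (s t : R) : 0 <= s -> 0 <= t -> hpar s <= hpar t -> s <= t.
Proof.
by move=> s0 t0 le; apply: Rnot_lt_le => ts; have := hpar_increasing t s t0 ts; lra.
Qed.

Lemma hpar_nondecreasing (s t : R) : 0 <= s -> s <= t -> hpar s <= hpar t.
Proof. by move=> s0 [/(hpar_increasing s t s0) | ->]; lra. Qed.

Lemma hpar_derivable (t : R) : ex_derive hpar t.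
Proof.
rewrite /hpar; auto_derive.
have s0 : 0 <= sqrt (4 * (t * (t * 1)) + 1) by apply: sqrt_pos.
by repeat split; nra.
Qed.

Lemma psi_hump (h e x : R) : 0 < h ->
  psi h e (- (x / h)) = exp x * (hump (e / h) x / h - 1).
Proof.
move=> h0; rewrite /psi /hump (_ : - - (x / h) * h = x); last by field; lra.
by have ex := exp_pos x; rewrite exp_Ropp; field; lra.
Qed.

Definition dpsi (h e z : R) : R := 2 * e * z - 1 + h * exp (- z * h).

Lemma psi_derive (h e z : R) : is_derive (psi h e) z (dpsi h e z).
Proof. by rewrite /psi /dpsi; auto_derive => //; ring. Qed.

Lemma dpsi_at_zero (h e x : R) : 0 < h -> 0 < e -> hump (e / h) x = h ->
  dpsi h e (- (x / h)) = (x - hump_top (e / h)) * (e / h * x + / hump_top (e / h)).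
Proof.
move=> h0 e0 hx; have t0 : 0 <= e / h by apply: Rdiv_le_0_compat; lra.
have [X1 [eX _]] := hump_top_spec _ t0.
have ex : h * exp x = x * (1 + e / h * x).
  by have p := exp_pos x; rewrite -{1}hx /hump exp_Ropp; field; lra.
rewrite /dpsi (_ : - - (x / h) * h = x); last by field; lra.
rewrite ex (_ : 2 * e * - (x / h) = - 2 * (e / h) * x); last by field; lra.
move: (e / h) (hump_top _) X1 eX => t X X1 eX.
have e2 : / X = t * X + (1 - 2 * t).
  by apply: (Rmult_eq_reg_r X); [rewrite Rinv_l|]; lra.
by rewrite e2; lra.
Qed.

Lemma hump_ivt (t a b y : R) : 0 <= t -> a <= b ->
  Rmin (hump t a) (hump t b) <= y <= Rmax (hump t a) (hump t b) ->
  exists x, a <= x <= b /\ hump t x = y.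
Proof.
move=> t0 ab hy; have [|x] := IVT_gen (hump t) a b y _ hy.
  by move=> x; apply: derivable_continuity_pt (hump_derive t x t0).
by rewrite Rmin_left // Rmax_right // => hx; exists x.
Qed.

(** The exponential beats the quadratic factor because
    [exp x = exp (x / 3) ^ 3 >= (x / 3) ^ 3]. *)
Lemma hump_small (t h : R) : 0 <= t -> 0 < h ->
  exists x, hump_top t < x /\ hump t x < h.
Proof.
move=> t0 h0; pose x := hump_top t + 27 * (1 + t) / h + 1; exists x.
have [X1 _] := hump_top_spec t t0.
have q0 : 0 < 27 * (1 + t) / h by apply: Rdiv_lt_0_compat; lra.
have hq : h * (27 * (1 + t) / h) = 27 * (1 + t) by field; lra.
have xlb : 1 <= x /\ 27 * (1 + t) / h < x by rewrite /x; lra.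
have [x1 xq] := xlb; split; first by rewrite /x; lra.
clearbody x.
have cube : x ^ 3 <= 27 * exp x.
  have -> : exp x = exp (x / 3) ^ 3.
    by rewrite {1}(_ : x = x / 3 + (x / 3 + x / 3)); [rewrite !exp_plus; ring | field].
  have : x / 3 <= exp (x / 3) by have := exp_ineq1_le (x / 3); lra.
  move=> le; have x30 : 0 <= x / 3 by lra.
  by have := pow_incr (x / 3) _ 3 (conj x30 le); lra.
have ex := exp_pos x; rewrite /hump exp_Ropp -/(Rdiv _ _).
apply/Rlt_div_l => //.
have : 27 * (1 + t) < h * x by have := Rmult_lt_compat_l h _ _ h0 xq; lra.
by nra.
Qed.

(** One solution on each side of the top; they merge exactly when the top has
    height [h]. The corresponding zeros of [psi] are [- (x1 / h)] and
    [- (x2 / h)]. *)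
Lemma negative_zeros (h e : R) : 0 < h -> 0 < e -> h <= hpar (e / h) ->
  exists x1 x2 : R, [/\ 0 < x2 <= hump_top (e / h), hump_top (e / h) <= x1,
    hump (e / h) x2 = h, hump (e / h) x1 = h &
    (x2 = hump_top (e / h) <-> h = hpar (e / h)) /\
    (x1 = x2 <-> h = hpar (e / h))].
Proof.
move=> h0 e0 hle; have t0 : 0 <= e / h by apply: Rdiv_le_0_compat; lra.
move: (e / h) t0 hle => t t0 hle.
have [X1 [_ top]] := hump_top_spec t t0.
have hump0 : hump t 0 = 0 by rewrite /hump; ring.
have [y [Xy hy]] := hump_small t h t0 h0.
have [x2 [b2 e2]] : exists x, 0 <= x <= hump_top t /\ hump t x = h.
  apply: hump_ivt => //; first by lra.
  by rewrite hump0 top Rmin_left ?Rmax_right; lra.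
have [x1 [b1 e1]] : exists x, hump_top t <= x <= y /\ hump t x = h.
  apply: hump_ivt => //; first by lra.
  by rewrite top Rmin_right ?Rmax_left; lra.
have x20 : 0 < x2 by case: (Req_dec x2 0) => [z|]; [rewrite z in e2|]; lra.
have max : forall x, 0 <= x -> hump t x = h -> h = hpar t -> x = hump_top t.
  move=> x x0 ex eh; have [//|ne] := Req_dec x (hump_top t).
  by have [_ /(_ ne)] := hump_le_hpar t x t0 x0; lra.
exists x1, x2; split=> //; first by lra.
- by lra.
- split; split=> [E|E].
  + by rewrite -e2 E top.
  + by apply: max => //; lra.
  + by rewrite -e2 -top; congr (hump t); lra.
  + by rewrite (max x1 ltac:(lra) e1 E) (max x2 ltac:(lra) e2 E).
Qed.

Lemma zeros_complete (h e x1 x2 z : R) : 0 < h -> 0 < e ->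
  0 < x2 <= hump_top (e / h) -> hump_top (e / h) <= x1 ->
  hump (e / h) x2 = h -> hump (e / h) x1 = h -> z < 0 ->
  [/\ psi h e z = 0 <-> z = - (x1 / h) \/ z = - (x2 / h),
      (- (x2 / h) < z -> psi h e z < 0) &
      (- (x1 / h) < z < - (x2 / h) -> 0 < psi h e z) /\
      (z < - (x1 / h) -> psi h e z < 0)].
Proof.
move=> h0 e0 b2 b1 e2 e1 z0; have t0 : 0 <= e / h by apply: Rdiv_le_0_compat; lra.
have ex : exists x, 0 < x /\ z = - (x / h).
  by exists (- z * h); split; [nra | field; lra].
case: ex => x [x0 ->] {z z0}; rewrite psi_hump //.
have cmp : forall a b, - (b / h) < - (a / h) -> a < b.
  move=> a b; have ih : 0 < / h by apply: Rinv_0_lt_compat.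
  by rewrite /Rdiv => ?; nra.
have inj : forall a b, - (a / h) = - (b / h) -> a = b.
  by move=> a b E; apply: (Rmult_eq_reg_r (/ h)); [rewrite /Rdiv in E; lra |
    apply/Rgt_not_eq/Rinv_0_lt_compat].
have pe := exp_pos x; have ih : 0 < / h by apply: Rinv_0_lt_compat.
have hh : h / h = 1 by field; lra.
have neg : hump (e / h) x < h -> exp x * (hump (e / h) x / h - 1) < 0.
  by move=> lt; have := Rmult_lt_compat_r _ _ _ ih lt; rewrite -/(Rdiv h h) hh /Rdiv; nra.
have pos : h < hump (e / h) x -> 0 < exp x * (hump (e / h) x / h - 1).
  by move=> lt; have := Rmult_lt_compat_r _ _ _ ih lt; rewrite -/(Rdiv h h) hh /Rdiv; nra.
have rising : x < x2 -> hump (e / h) x < h.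
  by move=> lt; rewrite -{2}e2; apply: hump_increasing => //; lra.
have falling : x1 < x -> hump (e / h) x < h.
  by move=> lt; rewrite -{2}e1; apply: hump_decreasing => //; lra.
have inside : x2 < x < x1 -> h < hump (e / h) x.
  move=> lt; case: (Rle_lt_dec x (hump_top (e / h))) => xX.
    by rewrite -{1}e2; apply: hump_increasing => //; lra.
  by rewrite -{1}e1; apply: hump_decreasing => //; lra.
split.
- split=> [E|[/inj -> | /inj ->]]; [| by rewrite e1 hh; ring | by rewrite e2 hh; ring].
  case: (Rtotal_order x x2) => [/rising/neg|[->|g2]]; [lra | by right |].
  by case: (Rtotal_order x x1) => [l1|[->|/falling/neg]];
    [have := pos (inside (conj g2 l1)); lra | left | lra].
- by move=> /cmp lt; apply/neg/rising.
- split=> [[/cmp l1 /cmp l2]|/cmp lt]; last exact/neg/falling.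
  by apply/pos/inside.
Qed.

Lemma psi_at_0 (h e : R) : psi h e 0 = - 1.
Proof. by rewrite /psi Ropp_0 Rmult_0_l exp_0; ring. Qed.

Lemma lambda2_unique (h c z : R) :
  (0 < h /\ exists l1, two_negative_zeros h (eps c) l1 z) \/
  (h = 0 /\ z < 0 /\ forall s, s < 0 -> (psi h (eps c) s = 0 <-> s = z)) ->
  lambda2 h c = z.
Proof.
move=> Pz; apply: iota_unique => // y Py.
case: Pz => [[h0 [l1 [lz [Z _]]]] | [h0 [z0 Z]]].
  case: Py => [[_ [k1 [lk [K _]]]] | [hE _]]; last by lra.
  have [] := proj1 (K z ltac:(lra)) (proj2 (Z z ltac:(lra)) (or_intror erefl));
  have [] := proj1 (Z y ltac:(lra)) (proj2 (K y ltac:(lra)) (or_intror erefl)); lra.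
case: Py => [[hE _] | [_ [y0 Y]]]; first by lra.
exact: (proj1 (Z y y0) (proj2 (Y y y0) erefl)).
Qed.

Lemma eps_pos (c : R) : 0 < c -> 0 < eps c.
Proof. by move=> c0; apply: Rinv_0_lt_compat; nra. Qed.

(** The case of simple zeros; without delay the only negative zero is simple. *)
Definition subcritical (h e : R) : Prop := h = 0 \/ 0 < h /\ h < hpar (e / h).

Definition critical (h e : R) : Prop := 0 < h /\ h = hpar (e / h).

Lemma lambda2_hump (h c : R) : 0 < h -> 0 < c -> h <= hpar (eps c / h) ->
  exists x1 x2 : R, [/\ 0 < x2 <= hump_top (eps c / h), hump_top (eps c / h) <= x1,
    hump (eps c / h) x2 = h, hump (eps c / h) x1 = h &
    lambda2 h c = - (x2 / h) /\ (x2 = hump_top (eps c / h) <-> h = hpar (eps c / h)) /\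
    (x1 = x2 <-> h = hpar (eps c / h))].
Proof.
move=> h0 c0 hle; have e0 := eps_pos c c0.
have [x1 [x2 [b2 b1 e2 e1 [iff1 iff2]]]] := negative_zeros h (eps c) h0 e0 hle.
exists x1, x2; split=> //; split=> //; apply: lambda2_unique; left; split=> //.
have ih : 0 < / h by apply: Rinv_0_lt_compat.
exists (- (x1 / h)); split; first by rewrite /Rdiv; nra.
split; first by move=> z z0; have [] := zeros_complete h (eps c) x1 x2 z h0 e0 b2 b1 e2 e1 z0.
rewrite (is_derive_unique _ _ _ (psi_derive h (eps c) _)) dpsi_at_zero //.
have t0 : 0 <= eps c / h by apply: Rdiv_le_0_compat; lra.
have [X1 _] := hump_top_spec _ t0.
have iX : 0 < / hump_top (eps c / h) by apply: Rinv_0_lt_compat; lra.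
split=> E.
  have /iff2/iff1 -> : x1 = x2.
    by apply: (Rmult_eq_reg_r (/ h)); rewrite /Rdiv in E; lra.
  by ring.
have /iff1/iff2 -> // : x2 = hump_top (eps c / h).
by case: (Rmult_integral _ _ E) => E'; nra.
Qed.

Lemma lambda2_subcritical (h c : R) : 0 < c -> subcritical h (eps c) ->
  let z := lambda2 h c in
  [/\ z < 0, psi h (eps c) z = 0, forall s, z < s <= 0 -> psi h (eps c) s < 0,
      dpsi h (eps c) z < 0 & exists d, 0 < d <= 1 /\ 0 < psi h (eps c) ((1 + d) * z)].
Proof.
move=> c0 sub z; have e0 := eps_pos c c0; rewrite /z; case: sub => [hE|[h0 hlt]] {z}.
  rewrite hE; have ps s : psi 0 (eps c) s = eps c * s ^ 2 - s - 1.
    by rewrite /psi Rmult_0_r exp_0.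
  pose r := sqrt (1 + 4 * eps c).
  have r2 : r * r = 1 + 4 * eps c by apply: sqrt_sqrt; lra.
  have r1 : 1 < r by rewrite /r -{1}sqrt_1; apply: sqrt_lt_1; lra.
  pose z := (1 - r) / (2 * eps c).
  have ez : eps c * z = (1 - r) / 2 by rewrite /z; field; lra.
  have zneg : z < 0 by nra.
  have pz : psi 0 (eps c) z = 0.
    rewrite ps (_ : _ * z ^ 2 = eps c * z * z); last by ring.
    rewrite ez; apply: (Rmult_eq_reg_l (eps c)); last by lra.
    by rewrite (_ : eps c * ((1 - r) / 2 * z - z - 1) =
      (eps c * z) * ((1 - r) / 2 - 1) - eps c); [rewrite ez; nra | ring].
  have neg : forall s, z < s <= 0 -> psi 0 (eps c) s < 0.
    move=> s hs; have -> : psi 0 (eps c) s = psi 0 (eps c) s - psi 0 (eps c) z by rewrite pz; ring.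
    rewrite !ps (_ : _ - (_ - _ - 1) = (s - z) * (eps c * s + (eps c * z - 1))); last by ring.
    rewrite ez.
    have : 0 < (s - z) * - (eps c * s + ((1 - r) / 2 - 1)) by apply: Rmult_lt_0_compat; nra.
    by lra.
  have -> : lambda2 0 c = z.
    apply: lambda2_unique; right; split=> //; split=> // s s0; split=> [E|->] //.
    have : psi 0 (eps c) s - psi 0 (eps c) z = 0 by rewrite pz; lra.
    rewrite !ps (_ : _ - (_ - _ - 1) = (s - z) * (eps c * s + (eps c * z - 1))); last by ring.
    by rewrite ez => /Rmult_integral [|]; nra.
  split=> //.
    by rewrite /dpsi; rewrite (_ : 2 * eps c * z = 2 * (eps c * z)); [rewrite ez|]; lra.
  exists 1; split; first by lra.
  by have := pz; rewrite !ps; nra.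
have [x1 [x2 [b2 b1 e2 e1 [-> [iff1 iff2]]]]] := lambda2_hump h c h0 c0 (Rlt_le _ _ hlt).
have x2X : x2 < hump_top (eps c / h).
  by case: b2 => _ [//|/iff1 E]; rewrite -E in hlt; lra.
have ih : 0 < / h by apply: Rinv_0_lt_compat.
have zneg : - (x2 / h) < 0 by rewrite /Rdiv; nra.
have iX : 0 < / hump_top (eps c / h) by apply: Rinv_0_lt_compat; lra.
have t0 : 0 < eps c / h by apply: Rdiv_lt_0_compat.
have spec s s0 := zeros_complete h (eps c) x1 x2 s h0 e0 b2 b1 e2 e1 s0.
split=> //.
- by have [[_ E] _ _] := spec _ zneg; apply: E; right.
- move=> s [zs [s0|->]]; last by rewrite psi_at_0; lra.
  by have [_ lt _] := spec s s0; apply: lt.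
- rewrite dpsi_at_zero //; suff : 0 < (hump_top (eps c / h) - x2) * (eps c / h * x2 + / hump_top (eps c / h)) by lra.
  by apply: Rmult_lt_0_compat; nra.
have dpos : 0 < (hump_top (eps c / h) - x2) / x2 by apply: Rdiv_lt_0_compat; lra.
pose d := Rmin 1 ((hump_top (eps c / h) - x2) / x2 / 2).
have d0 : 0 < d by apply: Rmin_glb_lt; lra.
exists d; split; first by split=> //; apply: Rmin_l.
have dx : d * x2 < hump_top (eps c / h) - x2.
  have : d <= (hump_top (eps c / h) - x2) / x2 / 2 by apply: Rmin_r.
  move=> /(Rmult_le_compat_r x2 _ _ ltac:(lra)).
  by rewrite (_ : _ / x2 / 2 * x2 = (hump_top (eps c / h) - x2) / 2); [lra | field; lra].
have sneg : (1 + d) * - (x2 / h) < 0 by nra.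
have [_ _ [lt _]] := spec _ sneg; apply: lt.
by rewrite /Rdiv; split; nra.
Qed.

Lemma lambda2_critical (h c : R) : 0 < c -> critical h (eps c) ->
  let z := lambda2 h c in
  [/\ z < 0, psi h (eps c) z = 0, dpsi h (eps c) z = 0 &
      forall s, s < 0 -> s <> z -> psi h (eps c) s < 0].
Proof.
move=> c0 [h0 hE] /=; have e0 := eps_pos c c0.
have [x1 [x2 [b2 b1 e2 e1 [-> [iff1 iff2]]]]] := lambda2_hump h c h0 c0 (Req_le _ _ hE).
have xX := proj2 iff1 hE; have x12 := proj2 iff2 hE.
have ih : 0 < / h by apply: Rinv_0_lt_compat.
have spec s s0 := zeros_complete h (eps c) x1 x2 s h0 e0 b2 b1 e2 e1 s0.
have zneg : - (x2 / h) < 0 by rewrite /Rdiv; nra.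
split=> //.
- by have [[_ E] _ _] := spec _ zneg; apply: E; right.
- by rewrite dpsi_at_zero // xX; ring.
move=> s s0 ne; have [_ lt [_ gt]] := spec s s0.
by case: (Rtotal_order s (- (x2 / h))) => [?|[//|?]]; [apply: gt; rewrite x12 | apply: lt].
Qed.

Lemma no_negative_zero (h e w : R) : 0 < h -> 0 < e -> hpar (e / h) < h -> 0 <= w ->
  e * w ^ 2 + w < exp (w * h).
Proof.
move=> h0 e0 lt w0; have t0 : 0 <= e / h by apply: Rdiv_le_0_compat; lra.
have [le _] := hump_le_hpar (e / h) (w * h) t0 ltac:(nra).
have ex := exp_pos (w * h); move: le; rewrite /hump exp_Ropp => le.
have : w * h * (1 + e / h * (w * h)) < h * exp (w * h).
  by apply/Rlt_div_l => //; rewrite /Rdiv; lra.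
rewrite (_ : w * h * (1 + e / h * (w * h)) = h * (e * w ^ 2 + w)); last by field; lra.
by move/(Rmult_lt_reg_l h _ _ h0).
Qed.

Lemma hpar_quarter (h : R) : 0 < h ->
  hpar (/ (4 * h)) = (1 + sqrt (1 + 4 * h ^ 2)) / (2 * h) *
    / exp (1 + sqrt (1 + 4 * h ^ 2) - 2 * h).
Proof.
move=> h0; have s0 := sqrt_pos (1 + 4 * h ^ 2).
have s2 : sqrt (1 + 4 * h ^ 2) * sqrt (1 + 4 * h ^ 2) = 1 + 4 * h ^ 2.
  by apply: sqrt_sqrt; nra.
have -> : hpar (/ (4 * h)) = (2 * / (4 * h) + sqrt (1 + 4 * h ^ 2) / (2 * h)) *
    exp (- 1 - 2 * / (4 * h) / (1 + sqrt (1 + 4 * h ^ 2) / (2 * h))).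
  rewrite /hpar (_ : sqrt (4 * _ + 1) = sqrt (1 + 4 * h ^ 2) / (2 * h)) //.
  apply: sqrt_lem_1.
  - by have := pow2_ge_0 (/ (4 * h)); lra.
  - by apply: Rdiv_le_0_compat; lra.
  rewrite (_ : _ / _ * (_ / _) = sqrt (1 + 4 * h ^ 2) * sqrt (1 + 4 * h ^ 2) / (4 * h ^ 2));
    last by field; lra.
  by rewrite s2; field; lra.
move: (sqrt _) s0 s2 => s s0 s2.
rewrite (_ : 2 * / (4 * h) / (1 + s / (2 * h)) = / (2 * h + s)); last by field; lra.
have -> : / (2 * h + s) = s - 2 * h.
  by apply: (Rmult_eq_reg_r (2 * h + s)); [rewrite Rinv_l; nra | lra].
rewrite -exp_Ropp (_ : - 1 - (s - 2 * h) = - (1 + s - 2 * h)); last by ring.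
by congr (_ * _); field; lra.
Qed.

(** The equation of [h1] says that the point [t = 1 / (4 h)], at which
    [t h = 1 / 4], lies on the parametrized curve. *)
Lemma h1_equation (h : R) : 0 < h ->
  (2 * h ^ 2 * exp (1 + sqrt (1 + 4 * h ^ 2) - 2 * h) = 1 + sqrt (1 + 4 * h ^ 2) <->
   hpar (/ (4 * h)) = h).
Proof.
move=> h0; rewrite hpar_quarter //.
have E := exp_pos (1 + sqrt (1 + 4 * h ^ 2) - 2 * h).
move: (exp _) E => E E0; split=> [<- | e]; first by field; lra.
have : 2 * h * h * E = (1 + sqrt (1 + 4 * h ^ 2)) / (2 * h) * / E * (2 * h) * E by rewrite e; ring.
by rewrite (_ : _ / _ * / E * _ * E = 1 + sqrt (1 + 4 * h ^ 2)); [lra | field; lra].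
Qed.

Lemma hpar_pos (t : R) : 0 <= t -> 0 < hpar t.
Proof.
move=> t0; have := hpar_nondecreasing 0 t (Rle_refl 0) t0; rewrite hpar_0.
by have := Rinv_0_lt_compat _ (exp_pos 1); lra.
Qed.

Lemma h1_spec : 0 < h1 /\ hpar (/ (4 * h1)) = h1.
Proof.
have [t [ht et]] : exists t, 0 <= t <= 1 /\ t * hpar t = / 4.
  have cont : continuity (fun t => t * hpar t).
    move=> t; apply: (derivable_continuity_pt _ t (Derive (fun t => t * hpar t) t)).
    by apply: Derive_correct; have D := hpar_derivable t; auto_derive.
  have [|t] := IVT_gen (fun t => t * hpar t) 0 1 (/ 4) cont.
    have : / 3 <= hpar 1.
      apply: Rle_trans (hpar_nondecreasing 0 1 (Rle_refl 0) Rle_0_1).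
      by rewrite hpar_0; apply: Rinv_le_contravar exp_le_3; apply: exp_pos.
    by move=> ?; rewrite Rmin_left ?Rmax_right; lra.
  by rewrite Rmin_left ?Rmax_right; try lra; exists t.
have t0 : 0 < t by case: (Req_dec t 0) => [E|]; [rewrite E in et|]; lra.
have p0 := hpar_pos t ltac:(lra).
have tq : / (4 * hpar t) = t.
  by apply: (Rmult_eq_reg_r (4 * hpar t)); [rewrite Rinv_l; lra | lra].
have ex : 0 < hpar t /\ hpar (/ (4 * hpar t)) = hpar t by rewrite tq.
have -> : h1 = hpar t; last by [].
apply: iota_unique => [y [y0 /(proj1 (h1_equation y y0)) ey] |]; last first.
  by split=> //; apply: (proj2 (h1_equation _ p0)); rewrite tq.
have dec : forall a b, 0 < a -> a < b -> hpar (/ (4 * b)) < hpar (/ (4 * a)).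
  move=> a b a0 ab; apply: hpar_increasing.
    by apply/Rlt_le/Rinv_0_lt_compat; lra.
  by apply: Rinv_lt_contravar; nra.
case: (Rtotal_order y (hpar t)) => [lt|[//|gt]].
  by have := dec _ _ y0 lt; lra.
by have := dec _ _ p0 gt; lra.
Qed.

Lemma t1_eq : t1 = / (4 * h1).
Proof.
have [p e] := h1_spec; apply: iota_unique => [y [ey E]|].
  by rewrite ey in E; apply: (Rmult_eq_reg_r (4 * h1)); [rewrite Rinv_l; lra | lra].
by rewrite e; split=> //; field; lra.
Qed.

Lemma eps_star_hpar (t : R) : 0 <= t <= t1 -> eps_star (hpar t) = t * hpar t.
Proof.
move=> ht; apply: iota_unique => [y [s [hs [es ->]]]|]; last by exists t.
have := hpar_le_reg s t; have := hpar_le_reg t s; rewrite es => a b.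
by rewrite (_ : s = t) //; lra.
Qed.

Lemma eps_star_spec (h : R) : / exp 1 < h <= h1 ->
  exists t, [/\ 0 < t, hpar t = h & eps_star h = t * h].
Proof.
move=> hh; have [p e] := h1_spec; have t1E := t1_eq.
have t10 : 0 < t1 by rewrite t1E; apply: Rinv_0_lt_compat; lra.
have [||t] := IVT_gen hpar 0 t1 h.
- move=> t; apply: (derivable_continuity_pt _ t (Derive hpar t)).
  by apply: Derive_correct; apply: hpar_derivable.
- have -> : hpar t1 = h1 by rewrite t1E.
  by rewrite hpar_0 Rmin_left ?Rmax_right; lra.
rewrite Rmin_left ?Rmax_right; try lra; move=> [ht et]; exists t; split=> //.
- by case: (Req_dec t 0) => [E|]; [rewrite E hpar_0 in et|]; lra.
- by rewrite -{1}et eps_star_hpar // et.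
Qed.

Lemma le_inv_sqrt (c a : R) : 0 < c -> 0 < a ->
  (c < 1 / sqrt a <-> a < eps c) /\ (c = 1 / sqrt a <-> a = eps c).
Proof.
move=> c0 a0; have s0 := sqrt_lt_R0 a a0; have s2 := sqrt_sqrt a (Rlt_le _ _ a0).
have ec : eps c * (c * c) = 1 by rewrite /eps; field; lra.
have e0 := eps_pos c c0.
move: (sqrt a) s0 s2 => s s0 s2; move: a0; rewrite -s2 => {a s2} _.
have cs0 : 0 < c * s by apply: Rmult_lt_0_compat.
split; split.
- move/Rlt_div_r => /(_ s0) lt; apply: (Rmult_lt_reg_r (c * c)); first by nra.
  have : 0 < (1 - c * s) * (1 + c * s) by apply: Rmult_lt_0_compat; lra.
  by rewrite ec; lra.
- move=> lt; apply/Rlt_div_r => //; apply: Rnot_le_lt => le.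
  have : s * s * (c * c) < 1 by rewrite -ec; apply: Rmult_lt_compat_r; nra.
  have : 0 <= (c * s - 1) * (c * s + 1) by apply: Rmult_le_pos; lra.
  by lra.
- by move=> ->; rewrite /eps; field; lra.
- move=> E; rewrite -E in ec; apply: (Rmult_eq_reg_r s); last by lra.
  rewrite /Rdiv Rmult_1_l Rinv_l; last by lra.
  have : (c * s - 1) * (c * s + 1) = 0 by lra.
  by case/Rmult_integral; nra.
Qed.

(** If [h = hpar t] then [eps_star h = t h], so that [eps_star h < eps c] says
    [t < eps c / h], that is [h < hpar (eps c / h)]. The bound [h <= h1] comes
    from [eps c <= 1 / 4], since [h1] is the value at which [eps_star] reaches
    [1 / 4]. *)
Lemma conditions_iff (h c : R) : 0 <= h -> 0 < c ->
  [/\ cond1 h c \/ cond2 h c <-> 2 <= c /\ (subcritical h (eps c) \/ critical h (eps c)),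
      (cond1 h c \/ cond2 h c -> Rbar_lt c (c_star h) -> subcritical h (eps c)) &
      (cond1 h c \/ cond2 h c -> Finite c = c_star h -> critical h (eps c))].
Proof.
move=> h0 c0; have e0 := eps_pos c c0; rewrite /cond1 /cond2 /c_star.
case: (Rle_dec h (/ exp 1)) => he /=.
  have sub : subcritical h (eps c).
    case: h0 => [h0|<-]; [right; split=> // | by left].
    have := hpar_increasing 0 (eps c / h) (Rle_refl 0) (Rdiv_lt_0_compat _ _ e0 h0).
    by rewrite hpar_0; lra.
  split=> //.
  split=> [[[_ [c2 _]]|[]]|[c2 _]]; [by split=> //; left | by lra | by left].
have hpos : 0 < h by have := Rinv_0_lt_compat _ (exp_pos 1); lra.
have t0 := Rdiv_lt_0_compat _ _ e0 hpos.
have small : 2 <= c -> subcritical h (eps c) \/ critical h (eps c) -> h <= h1.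
  move=> c2 sc; apply: Rnot_lt_le => gt.
  have hle : h <= hpar (eps c / h) by case: sc => [[|[]]|[]]; lra.
  have [p e] := h1_spec.
  have e4 : eps c <= / 4 by apply: Rinv_le_contravar; nra.
  have : eps c / h <= / (4 * h1).
    rewrite Rinv_mult /Rdiv; apply: Rmult_le_compat => //; try lra.
      by apply/Rlt_le/Rinv_0_lt_compat.
    by apply: Rinv_le_contravar; lra.
  by move/(hpar_nondecreasing _ _ (Rlt_le _ _ t0)); lra.
have key : h <= h1 ->
    (c < 1 / sqrt (eps_star h) <-> subcritical h (eps c)) /\
    (c = 1 / sqrt (eps_star h) <-> critical h (eps c)).
  move=> hh1; have [t [tpos et ->]] := eps_star_spec h (conj (Rnot_le_lt _ _ he) hh1).
  have [lt eq] := le_inv_sqrt c (t * h) c0 ltac:(nra).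
  have eh : eps c / h * h = eps c by field; lra.
  split.
  - rewrite lt; split=> [l|[|[_ l]]]; [right; split=> // | lra |].
      by rewrite -{1}et; apply: hpar_increasing; nra.
    have : t < eps c / h.
      apply: Rnot_le_lt => le; rewrite -{1}et in l.
      by have := hpar_nondecreasing _ _ (Rlt_le _ _ t0) le; lra.
    by move/(Rmult_lt_compat_r h _ _ hpos); rewrite eh.
  - rewrite eq; split=> [E|[_ E]].
      by split=> //; rewrite -E (_ : t * h / h = t) //; field; lra.
    rewrite (_ : t = eps c / h) //.
    by apply: Rle_antisym; apply: hpar_le_reg; lra.
split.
- split=> [[[hh _]|[[_ hh1] [c2 le]]] | [c2 sc]].
    by lra.
    split=> //; have [k1 k2] := key hh1.
    by case: le => [/k1|/k2]; [left|right].
  right; have hh1 := small c2 sc; have [k1 k2] := key hh1; split; first by lra.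
  by split=> //; case: sc => [/k1|/k2]; lra.
- move=> [[? _]|[[_ hh1] _]]; first by lra.
  by have [k1 _] := key hh1; move/k1.
- move=> [[? _]|[[_ hh1] _]]; first by lra.
  by have [_ k2] := key hh1; case=> /k2.
Qed.

(** * Sub- and supersolutions *)

Definition glue (t0 : R) (f1 f2 : R -> R) : R -> R :=
  fun t => if Rle_dec t t0 then f1 t else f2 t.

Lemma glue_le (t0 : R) (f1 f2 : R -> R) (t : R) : t <= t0 -> glue t0 f1 f2 t = f1 t.
Proof. by rewrite /glue; case: Rle_dec. Qed.

Lemma glue_ge (t0 : R) (f1 f2 : R -> R) (t : R) :
  f1 t0 = f2 t0 -> t0 <= t -> glue t0 f1 f2 t = f2 t.
Proof.
by move=> E; rewrite /glue; case: Rle_dec => //= tt0 t0t; rewrite (Rle_antisym t t0).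
Qed.

Lemma locally_lt (a t : R) : t < a -> locally t (fun s => s < a).
Proof. exact: open_lt. Qed.

Lemma locally_gt (a t : R) : a < t -> locally t (fun s => a < s).
Proof. exact: open_gt. Qed.

Lemma glue_continuous (t0 : R) (f1 f2 : R -> R) : f1 t0 = f2 t0 ->
  (forall t, continuous f1 t) -> (forall t, continuous f2 t) ->
  forall t, continuous (glue t0 f1 f2) t.
Proof.
move=> E C1 C2 t; case: (Rtotal_order t t0) => [lt|[->|gt]].
- apply: continuous_ext_loc (C1 t).
  by apply: filter_imp (locally_lt _ _ lt) => s hs; rewrite glue_le //; lra.
- move=> P; rewrite glue_le => [HP|]; last exact: Rle_refl.
  have N1 : locally t0 (fun s => P (f1 s)) := C1 t0 P HP.
  have N2 : locally t0 (fun s => P (f2 s)) by apply: (C2 t0 P); rewrite -E.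
  by apply: filter_imp (filter_and _ _ N1 N2) => s [P1 P2]; rewrite /glue; case: Rle_dec.
- apply: continuous_ext_loc (C2 t).
  by apply: filter_imp (locally_gt _ _ gt) => s hs; rewrite glue_ge //; lra.
Qed.

Lemma glue_derive (t0 : R) (f1 f2 d1 d2 : R -> R) : f1 t0 = f2 t0 -> d1 t0 = d2 t0 ->
  (forall t, is_derive f1 t (d1 t)) -> (forall t, is_derive f2 t (d2 t)) ->
  forall t, is_derive (glue t0 f1 f2) t (glue t0 d1 d2 t).
Proof.
move=> E dE D1 D2 t; case: (Rtotal_order t t0) => [lt|[->|gt]].
- rewrite glue_le; last by lra.
  apply: is_derive_ext_loc (D1 t).
  by apply: filter_imp (locally_lt _ _ lt) => s hs; rewrite glue_le //; lra.
- rewrite glue_le; last exact: Rle_refl.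
  apply/is_derive_Reals => d d0.
  have [a1 H1] := proj1 (is_derive_Reals f1 t0 (d1 t0)) (D1 t0) d d0.
  have [a2 H2] := proj1 (is_derive_Reals f2 t0 (d2 t0)) (D2 t0) d d0.
  have a0 : 0 < Rmin a1 a2 by apply: Rmin_glb_lt; apply: cond_pos.
  exists (mkposreal _ a0); move=> s s0 hs; rewrite /= in hs.
  have := Rmin_l a1 a2; have := Rmin_r a1 a2 => m2 m1.
  rewrite (glue_le _ _ _ t0); last exact: Rle_refl.
  rewrite /glue; case: Rle_dec => /= _; first by apply: H1; lra.
  by rewrite E dE; apply: H2; lra.
- rewrite glue_ge //; last by lra.
  apply: is_derive_ext_loc (D2 t).
  by apply: filter_imp (locally_gt _ _ gt) => s hs; rewrite glue_ge //; lra.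
Qed.

Lemma nondecreasing_everywhere (f df : R -> R) :
  (forall t, is_derive f t (df t)) -> (forall t, 0 <= df t) -> nondecreasing f.
Proof. by move=> D P s t st; apply: (nondecreasing_of_derive f df). Qed.

(** A shape that solves the differential inequality to the right of [t0] may be
    replaced by anything admissible to the left of it: the operator only looks
    forward. *)
Lemma right_subsolution (h e l m : R) (f F dF ddF y : R -> R) (t0 X : R) :
  kpp_roots e l m ->
  (forall t, t0 <= t -> f t = F t) ->
  (forall t, is_derive F t (dF t)) -> (forall t, is_derive dF t (ddF t)) ->
  (forall t, t0 <= t -> l * F t - dF t <= X) ->
  (forall t, t0 <= t -> e * ddF t - dF t + F t <= F t * f (t - h)) ->
  (forall t, is_derive y t (m * y t - source h f t / e)) -> (forall t, 0 <= y t) ->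
  forall t, t0 <= t -> l * F t - dF t <= y t.
Proof.
move=> kr fF D DD bX ineq Dy y0.
apply: (subsolution_factor e l m kr (source h f) (fun t => l * F t - dF t)
  (fun t => l * dF t - ddF t) y t0 X) => // t ht.
  have Dt := D t; have DDt := DD t; auto_derive; first by derivable.
  rewrite (is_derive_unique (fun x => F x) _ _ Dt) (is_derive_unique (fun x => dF x) _ _ DDt).
  by ring.
case: kr => e0 [_ [es ep]]; have := ineq t ht; rewrite /source (fF t ht) => le.
apply: (Rmult_le_reg_l e) => //.
rewrite (_ : e * (m * _ - _ / e) = e * (l * m) * F t - e * m * dF t - F t * f (t - h));
  last by field; lra.
rewrite (_ : e * (l * dF t - ddF t) = (e * (l + m)) * dF t - e * m * dF t - e * ddF t);
  last by ring.
by rewrite ep es; lra.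
Qed.

Definition from_point (t0 : R) (W : R -> R) : R -> R :=
  fun t => if Rlt_dec t t0 then 0 else W t.

Lemma from_point_lt (t0 : R) (W : R -> R) (t : R) : t < t0 -> from_point t0 W t = 0.
Proof. by rewrite /from_point; case: Rlt_dec. Qed.

Lemma from_point_ge (t0 : R) (W : R -> R) (t : R) : t0 <= t -> from_point t0 W t = W t.
Proof. by rewrite /from_point; case: Rlt_dec => // ? ?; lra. Qed.

(** Supersolutions are described by the defect [W = 1 - phi], cut off to the
    left of [t0], where [1] is a trivial upper bound. *)
Lemma defect_supersolution (h e l m : R) (T : (R -> R) -> R -> R)
    (W dW ddW : R -> R) (t0 B : R) :
  kpp_roots e l m ->
  (forall f, admissible f -> solves e l m (source h f) (T f)) ->
  (forall t, is_derive W t (dW t)) -> (forall t, is_derive dW t (ddW t)) ->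
  (forall t, t0 <= t -> 0 <= W t <= 1 /\ B <= dW t) ->
  (forall t, t0 <= t ->
     e * ddW t - dW t <= from_point t0 W (t - h) * (1 - W t)) ->
  forall k, admissible k -> (forall t, k t <= 1 - from_point t0 W t) ->
  forall t, T k t <= 1 - from_point t0 W t.
Proof.
move=> kr TS D DD bW ineq k Ak kW.
have [y [Dz [Dy By]]] := TS k Ak.
move=> t; case: (Rlt_le_dec t t0) => ht.
  by rewrite from_point_lt //; have := By t; lra.
rewrite from_point_ge //; move: t ht; apply: (outer_factor e l m kr y
  (fun t => l * (1 - W t) + dW t) (T k) (fun t => 1 - W t) t0 1) => t ht; last 1 first.
- by have := By t; have := bW t ht; lra.
- exact: Dz.
- have Dt := D t; auto_derive; first by derivable.
  by rewrite (is_derive_unique (fun x => W x) _ _ Dt); ring.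
move: t ht; apply: (supersolution_factor e l m kr (source h k) _
  (fun t => - l * dW t + ddW t) y t0 B l) => // [t ht|t ht|t ht|t]; last by have := By t; lra.
- have Dt := D t; have DDt := DD t; auto_derive; first by derivable.
  rewrite (is_derive_unique (fun x => W x) _ _ Dt) (is_derive_unique (fun x => dW x) _ _ DDt).
  by ring.
- case: (kr) => e0 [_ [es ep]].
  have kk : source h k t <= (1 - W t) * (1 - from_point t0 W (t - h)).
    have := kW t; rewrite from_point_ge // => k1; have [_ B'] := Ak.
    by rewrite /source; apply: Rmult_le_compat => //; [have := B' t | have := B' (t - h)]; lra.
  apply: (Rmult_le_reg_l e) => //.
  rewrite (_ : e * (m * _ - _ / e) =
    e * (l * m) * (1 - W t) + e * m * dW t - source h k t); last by field; lra.
  rewrite (_ : e * (- l * dW t + ddW t) =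
    - (e * (l + m)) * dW t + e * m * dW t + e * ddW t); last by ring.
  by rewrite ep es; have := ineq t ht; lra.
- have := bW t ht; case: kr => _ [[l0 _] _]; nra.
Qed.

Lemma exp_mul_eventually_small (k e : R) : 0 < k -> 0 < e ->
  Rbar_locally p_infty (fun t => t * exp (- (k * t)) < e).
Proof.
move=> k0 e0; have ke0 : 0 < e * k / 2 by nra.
have [T hT] := exp_eventually_small (k / 2) _ ltac:(lra) ke0.
exists T => t ht; have := hT t ht.
have -> : exp (- (k * t)) = exp (- (k / 2 * t)) * exp (- (k / 2 * t)).
  by rewrite -exp_plus; congr exp; field.
have p := exp_pos (- (k / 2 * t)).
have : exp (- (k / 2 * t)) * (k / 2 * t) <= 1.
  rewrite exp_Ropp Rmult_comm -/(Rdiv _ _); apply/Rle_div_l; first exact: exp_pos.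
  by have := exp_ineq1_le (k / 2 * t); lra.
by move=> le small; apply: (Rmult_lt_reg_l (k / 2)); nra.
Qed.

Lemma asymptotic_of_bounds (z d K : R) (f : R -> R) : z < 0 -> 0 < d ->
  Rbar_locally p_infty (fun t =>
    exp (z * t) - K * exp ((1 + d) * z * t) <= 1 - f t <= exp (z * t)) ->
  asymptotic_at_1 z f.
Proof.
move=> z0 d0 ev; exists (fun t => (1 - f t) / exp (z * t) - 1); split; last first.
  by move=> t; field; apply/Rgt_not_eq/exp_pos.
apply: (is_lim_le_le_loc (fun t => - K * (exp (- ((- (d * z)) * t)) * 1)) (fun _ => 0)).
- apply: filter_imp ev => t; have p := exp_pos (z * t).
  have -> : exp ((1 + d) * z * t) = exp (z * t) * exp (- (- (d * z) * t)).
    by rewrite -exp_plus; congr exp; ring.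
  move=> [lo up]; split.
    apply: (Rmult_le_reg_l (exp (z * t))) => //.
    by rewrite (_ : exp (z * t) * (_ / _ - 1) = 1 - f t - exp (z * t)); [lra | field; lra].
  apply: (Rmult_le_reg_l (exp (z * t))) => //.
  by rewrite (_ : exp (z * t) * (_ / _ - 1) = 1 - f t - exp (z * t)); [lra | field; lra].
- have := is_lim_scal_l _ (- K) _ _ (bounded_decay (- (d * z)) 1 0 (fun _ => 1) ltac:(nra) _).
  rewrite /= Rmult_0_r; apply => t _; rewrite Rabs_R1; exact: Rle_refl.
- exact: is_lim_const.
Qed.

Lemma psi_exp (h e z : R) : e * z ^ 2 - z = psi h e z + exp (- z * h).
Proof. by rewrite /psi; ring. Qed.

(** Here [1 - exp (z t)] solves the differential inequality to the right of the
    gluing point because [z] is a zero of [psi], and the solution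
    [exp (l t)] of the linear equation at [0] is tangent to it from above. *)
Section Subcritical.
Variables (h e l m z : R) (T : (R -> R) -> R -> R).
Hypothesis kr : kpp_roots e l m.
Hypothesis TS : forall f, admissible f -> solves e l m (source h f) (T f).
Hypothesis z0 : z < 0.
Hypothesis pz : psi h e z = 0.

Let t0 := 1 / z * ln (l / (l - z)).
Let f1 t := - z / (l - z) * exp (l * (t - t0)).
Let f2 t := 1 - exp (z * t).
Let f := glue t0 f1 f2.

Let l0 : 0 < l. Proof. by case: kr => _ [[]]. Qed.

Let exp_t0 : exp (z * t0) = l / (l - z).
Proof.
rewrite (_ : z * t0 = ln (l / (l - z))); last by rewrite /t0; field; lra.
by rewrite exp_ln //; apply: Rdiv_lt_0_compat; lra.
Qed.

Let t0_pos : 0 < t0.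
Proof.
apply: Rnot_le_lt => le.
have : 1 <= exp (z * t0) by rewrite -exp_0; apply: exp_nondecreasing; nra.
by rewrite exp_t0 => /Rle_div_r; lra.
Qed.

Let f12 : f1 t0 = f2 t0.
Proof. by rewrite /f1 /f2 exp_t0 Rminus_diag Rmult_0_r exp_0; field; lra. Qed.

Let df12 : l * f1 t0 = - z * exp (z * t0).
Proof. by rewrite f12 /f2 exp_t0; field; lra. Qed.

Let Df t : is_derive f t (glue t0 (fun t => l * f1 t) (fun t => - z * exp (z * t)) t).
Proof.
apply: glue_derive => // s; rewrite /f1 /f2; auto_derive => //.
  by rewrite /Rminus; ring.
by ring.
Qed.

Lemma phi_minus_ge t : 1 - exp (z * t) <= f t.
Proof.
case: (Rle_lt_dec t t0) => ht; last by rewrite /f glue_ge //; rewrite /f2; lra.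
rewrite /f glue_le // /f1.
rewrite (_ : z * t = z * t0 + z * (t - t0)); last by ring.
rewrite exp_plus exp_t0.
have a := exp_ineq1_le (l * (t - t0)); have b := exp_ineq1_le (z * (t - t0)).
have k1 : 0 < - z / (l - z) by apply: Rdiv_lt_0_compat; lra.
have k2 : 0 < l / (l - z) by apply: Rdiv_lt_0_compat; lra.
have k12 : - z / (l - z) = 1 - l / (l - z) by field; lra.
have lk : l * (- z / (l - z)) = - z * (l / (l - z)) by field; lra.
have := Rmult_le_compat_l _ _ _ (Rlt_le _ _ k1) a.
have := Rmult_le_compat_l _ _ _ (Rlt_le _ _ k2) b.
have := congr1 (Rmult (t - t0)) lk; rewrite k12; lra.
Qed.

Lemma phi_minus_nondecreasing : nondecreasing f.
Proof.
apply: (nondecreasing_everywhere f _ Df) => t; rewrite /glue.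
have k1 : 0 < - z / (l - z) by apply: Rdiv_lt_0_compat; lra.
case: Rle_dec => /= _; last by have := exp_pos (z * t); nra.
by apply: Rmult_le_pos; [lra | rewrite /f1; have := exp_pos (l * (t - t0)); nra].
Qed.

Lemma phi_minus_admissible : admissible f.
Proof.
split=> t; first exact: derivable_continuous (Df t).
have k1 : 0 < - z / (l - z) by apply: Rdiv_lt_0_compat; lra.
split.
  case: (Rle_lt_dec t t0) => ht.
    by rewrite /f glue_le // /f1; have := exp_pos (l * (t - t0)); nra.
  apply: Rle_trans (phi_minus_ge t); have := exp_le_1 (z * t) ltac:(nra); lra.
have le1 : forall s, t0 <= s -> f s <= 1.
  by move=> s hs; rewrite /f glue_ge // /f2; have := exp_pos (z * s); lra.
case: (Rle_lt_dec t t0) => ht; last by apply: le1; lra.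
exact: Rle_trans (phi_minus_nondecreasing t t0 ht) (le1 t0 (Rle_refl t0)).
Qed.

(** To the left of the gluing point [l f - f'] vanishes, so that the comparison
    for the inner factor is needed on the right only. *)
Lemma phi_minus_subsolution t : f t <= T f t.
Proof.
have [y [Dz [Dy By]]] := TS f phi_minus_admissible.
have Dexp : forall t, is_derive f2 t (- z * exp (z * t)).
  by move=> s; rewrite /f2; auto_derive => //; ring.
have DDexp : forall t, is_derive (fun t => - z * exp (z * t)) t (- z * (z * exp (z * t))).
  by move=> s; auto_derive => //; ring.
have right : forall s, t0 <= s -> l * f2 s - - z * exp (z * s) <= y s.
  apply: (right_subsolution h e l m f f2 _ _ y t0 l kr _ Dexp DDexp _ _ Dy).
  - by move=> s hs; rewrite /f glue_ge.
  - by move=> s hs; rewrite /f2; have := exp_pos (z * s); nra.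
  - move=> s hs; have := phi_minus_ge (s - h).
    have -> : exp (z * (s - h)) = exp (z * s) * exp (- z * h).
      by rewrite -exp_plus; congr exp; ring.
    have := psi_exp h e z; rewrite pz Rplus_0_l => <-.
    have f20 : 0 <= f2 s.
      by rewrite /f2; have := exp_le_1 (z * s) ltac:(nra); lra.
    move/(Rmult_le_compat_l _ _ _ f20); rewrite /f2.
    have q : 0 <= exp (z * s) * (exp (z * s) * (e * z ^ 2 - z)).
      rewrite (psi_exp h) pz Rplus_0_l; have := exp_pos (z * s); have := exp_pos (- z * h).
      by move=> a b; apply: Rmult_le_pos; [|apply: Rmult_le_pos]; lra.
    by lra.
  - by move=> s; have := By s; lra.
apply: (outer_factor e l m kr (fun s => l * f s -
  glue t0 (fun t => l * f1 t) (fun t => - z * exp (z * t)) s) y f (T f) t 1) => // [s hs|s hs|s hs|].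
- by rewrite (_ : l * f s - _ = glue t0 (fun t => l * f1 t) (fun t => - z * exp (z * t)) s);
    [apply: Df | ring].
- case: (Rle_lt_dec s t0) => st; last first.
    by rewrite /f !glue_ge //; try lra; apply: right; lra.
  by rewrite /f !glue_le //; have := By s; lra.
- by have := proj2 phi_minus_admissible s; have := By s; lra.
- exact: Rle_refl.
Qed.

Lemma phi_minus_limit : is_lim f p_infty 1.
Proof.
apply/is_lim_spec => d /=.
have [S hS] := exp_eventually_small (- z) d ltac:(lra) (cond_pos d).
exists (Rmax S t0) => t ht; have := Rmax_l S t0; have := Rmax_r S t0 => a b.
have := hS t ltac:(lra); rewrite (_ : - (- z * t) = z * t); last by ring.
have p := exp_pos (z * t); rewrite /f glue_ge // /f2; last by lra.
by move=> *; apply: Rabs_def1; lra.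
Qed.

Lemma phi_minus_asymptotic : asymptotic_at_1 z f.
Proof.
apply: (asymptotic_of_bounds z 1 0) => //; first by lra.
exists t0 => t ht; rewrite /f glue_ge // /f2; last by lra.
by rewrite Rmult_0_l; lra.
Qed.

(** The defect [exp (z t) - K exp ((1 + d) z t)]: the correction makes the
    linear part strictly favourable, which pays for the quadratic term. *)
Lemma subcritical_supersolution (d : R) : 0 < d <= 1 -> 0 < psi h e ((1 + d) * z) ->
  exists g, [/\ forall k, admissible k -> (forall t, k t <= g t) -> forall t, T k t <= g t,
    forall t, f t <= g t, exists t, g t < 1 &
    exists K, Rbar_locally p_infty (fun t =>
      g t = 1 - (exp (z * t) - K * exp ((1 + d) * z * t)))].
Proof.
move=> hd P0; set P := psi h e ((1 + d) * z) in P0.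
have q0 := exp_pos (- z * h).
have Pq : 0 < P / exp (- z * h) by apply: Rdiv_lt_0_compat.
have [S hS] := exp_eventually_small (- (d * z)) _ ltac:(nra) Pq.
(* Putting the zero [ts] of the defect far to the right makes the constant [K]
   large, and makes the supersolution equal to [1] left of the gluing point. *)
pose ts := Rmax (S + 1) t0.
have tsS : S < ts by have := Rmax_l (S + 1) t0; rewrite -/ts; lra.
have ts0 : t0 <= ts by apply: Rmax_r.
clearbody ts; have dz0 : d * z < 0 by nra.
pose K := exp (- (d * z) * ts).
have K0 : 0 < K by apply: exp_pos.
have KP : exp (- z * h) <= K * P.
  have := hS ts tsS; rewrite exp_Ropp -/K => lt.
  have := Rmult_lt_compat_r _ _ _ (Rmult_lt_0_compat _ _ K0 q0) lt.
  rewrite (_ : / K * _ = exp (- z * h)); last by field; lra.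
  by rewrite (_ : P / _ * _ = K * P); [lra | field; lra].
pose W t := exp (z * t) - K * exp ((1 + d) * z * t).
pose dW t := z * exp (z * t) - K * ((1 + d) * z) * exp ((1 + d) * z * t).
pose ddW t := z ^ 2 * exp (z * t) - K * ((1 + d) * z) ^ 2 * exp ((1 + d) * z * t).
have split_exp : forall t, exp ((1 + d) * z * t) = exp (z * t) * exp (d * z * t).
  by move=> t; rewrite -exp_plus; congr exp; ring.
have WE : forall t, W t = exp (z * t) * (1 - exp (d * z * (t - ts))).
  move=> t; rewrite /W split_exp (_ : exp (d * z * (t - ts)) = K * exp (d * z * t)); first by ring.
  by rewrite -exp_plus; congr exp; ring.
have W_pos : forall t, ts <= t -> 0 <= W t.
  move=> t ht; rewrite WE; apply: Rmult_le_pos; first exact/Rlt_le/exp_pos.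
  by have := exp_le_1 (d * z * (t - ts)) ltac:(nra); lra.
have W_neg : forall t, t < ts -> W t <= 0.
  move=> t ht; rewrite WE; have := exp_pos (z * t).
  have : 1 <= exp (d * z * (t - ts)).
    by rewrite -exp_0; apply: exp_nondecreasing; nra.
  by nra.
have W_exp : forall t, W t <= exp (z * t).
  move=> t; have := Rmult_lt_0_compat _ _ K0 (exp_pos ((1 + d) * z * t)).
  by rewrite /W; lra.
have exp1 : forall t, ts <= t -> exp (z * t) <= 1.
  by move=> t ht; apply: exp_le_1; nra.
exists (fun t => 1 - from_point ts W t); split.
- apply: (defect_supersolution h e l m T W dW ddW ts z kr TS).
  + by move=> t; rewrite /W /dW; auto_derive => //; ring.
  + by move=> t; rewrite /dW /ddW; auto_derive => //; ring.
  + move=> t ht; split; first by have := W_pos t ht; have := W_exp t; have := exp1 t ht; lra.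
    have := exp1 t ht; have := exp_pos (z * t); have := exp_pos ((1 + d) * z * t) => a b c.
    have : 0 <= K * ((1 + d) * - z) * exp ((1 + d) * z * t).
      by apply: Rmult_le_pos; [apply: Rmult_le_pos; nra | lra].
    by rewrite /dW; nra.
  move=> t ht.
  have -> : e * ddW t - dW t = W (t - h) - K * P * exp ((1 + d) * z * t).
    rewrite /ddW /dW /W.
    rewrite (_ : e * _ - _ = (e * z ^ 2 - z) * exp (z * t) -
      K * (e * ((1 + d) * z) ^ 2 - (1 + d) * z) * exp ((1 + d) * z * t)); last by ring.
    rewrite !(psi_exp h) pz -/P.
    have ex : forall a, exp (a * (t - h)) = exp (- a * h) * exp (a * t).
      by move=> a; rewrite -exp_plus; congr exp; ring.
    by rewrite !ex; ring.
  pose M := from_point ts W (t - h).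
  have WM : W (t - h) <= M.
    rewrite /M; case: (Rlt_le_dec (t - h) ts) => th; last by rewrite from_point_ge //; lra.
    by rewrite from_point_lt //; apply: W_neg.
  have M_exp : 0 <= M <= exp (z * t) * exp (- z * h).
    have -> : exp (z * t) * exp (- z * h) = exp (z * (t - h)) by rewrite -exp_plus; congr exp; ring.
    rewrite /M; case: (Rlt_le_dec (t - h) ts) => th.
      by rewrite from_point_lt //; have := exp_pos (z * (t - h)); lra.
    by rewrite from_point_ge //; split; [apply: W_pos | apply: W_exp].
  suff : W t * M <= K * P * exp ((1 + d) * z * t) by rewrite -/M; lra.
  apply: (Rle_trans _ (exp (z * t) * (exp (z * t) * exp (- z * h)))).
    by apply: Rmult_le_compat; [apply: W_pos | lra | apply: W_exp | lra].
  rewrite split_exp.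
  have dle : exp (z * t) <= exp (d * z * t).
    have zt : z * t <= 0 by nra.
    by apply: exp_nondecreasing; rewrite Rmult_assoc; nra.
  have p := exp_pos (z * t).
  have : exp (z * t) * exp (- z * h) <= exp (d * z * t) * (K * P).
    by apply: Rmult_le_compat; lra.
  by move/(Rmult_le_compat_l _ _ _ (Rlt_le _ _ p)); lra.
- move=> t; case: (Rlt_le_dec t ts) => ht.
    by rewrite from_point_lt //; have := proj2 phi_minus_admissible t; lra.
  rewrite from_point_ge // /f glue_ge //; last by lra.
  by rewrite /f2; have := W_exp t; lra.
- exists (ts + 1); rewrite from_point_ge; last by lra.
  suff : 0 < W (ts + 1) by lra.
  rewrite WE; apply: Rmult_lt_0_compat; first exact: exp_pos.
  by have := exp_increasing (d * z * (ts + 1 - ts)) 0 ltac:(nra); rewrite exp_0; lra.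
exists K, ts => t ht; rewrite from_point_ge //; lra.
Qed.

End Subcritical.

(** A chord of the exponential lies above its graph: combine the tangent
    inequalities at [s] with weights [u - s] and [s]. *)
Lemma chord_above_exp (k A s u : R) : 0 < k -> 0 < s < u ->
  A * u + 1 = exp (k * u) -> exp (k * s) < A * s + 1.
Proof.
move=> k0 [s0 su] Eu; have p := exp_pos (k * s).
have t1 := exp_ineq1 (- (k * s)) ltac:(nra).
have t2 := exp_ineq1_le (k * u - k * s).
have e1 : exp (k * s) * exp (- (k * s)) = 1 by rewrite -exp_plus Rplus_opp_r exp_0.
have e2 : exp (k * s) * exp (k * u - k * s) = A * u + 1.
  by rewrite Eu -exp_plus; congr exp; ring.
have {}t1 := Rmult_lt_compat_l _ _ _ p t1; rewrite e1 in t1.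
have {}t2 := Rmult_le_compat_l _ _ _ (Rlt_le _ _ p) t2; rewrite e2 in t2.
have us : 0 < u - s by lra.
have {}t1 := Rmult_lt_compat_l _ _ _ us t1.
have {}t2 := Rmult_le_compat_l _ _ _ (Rlt_le _ _ s0) t2.
by apply: (Rmult_lt_reg_l u); lra.
Qed.

(** The hypothesis on [A] puts the chord above the exponential at [h], so the
    second intersection lies beyond [h]; it is unique by convexity. *)
Lemma tau_crit_spec (h c A : R) : 0 < h -> lambda2 h c < 0 ->
  (exp (- lambda2 h c * h) - 1) / h < A ->
  [/\ h <= tau_crit h c A, 0 < tau_crit h c A &
    A * tau_crit h c A + 1 = exp (- lambda2 h c * tau_crit h c A)].
Proof.
move=> h0 z0 /Rlt_div_l => /(_ h0); rewrite /tau_crit.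
move: (lambda2 h c) z0 => z z0 hA; pose k := - z; have k0 : 0 < k by rewrite /k; lra.
have A0 : 0 < A by have := exp_ineq1 (- z * h) ltac:(nra); nra.
pose u := 4 * (A + 1) / k ^ 2 + 1 + h.
have q0 : 0 < 4 * (A + 1) / k ^ 2 by apply: Rdiv_lt_0_compat; nra.
have kq : k ^ 2 * (4 * (A + 1) / k ^ 2) = 4 * (A + 1) by field; lra.
have above : A * u + 1 < exp (k * u).
  have : (k * u) ^ 2 <= 4 * exp (k * u).
    have -> : exp (k * u) = exp (k * u / 2) ^ 2.
      by rewrite /= Rmult_1_r -exp_plus; congr exp; field.
    have := exp_ineq1_le (k * u / 2) => le.
    have {}le : k * u / 2 <= exp (k * u / 2) by lra.
    have p : 0 <= k * u / 2 by rewrite /u; nra.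
    by have := pow_incr (k * u / 2) _ 2 (conj p le); lra.
  have : k ^ 2 * u = 4 * (A + 1) + k ^ 2 * (1 + h) by rewrite -kq /u; ring.
  move/(congr1 (Rmult u)) => ku2; have u1 : 1 < u by rewrite /u; lra.
  have : 0 < u * (k ^ 2 * (1 + h)) by apply: Rmult_lt_0_compat; nra.
  by lra.
have cont : continuity (fun t => exp (k * t) - (A * t + 1)).
  move=> t; apply: (derivable_continuity_pt _ t (k * exp (k * t) - A)).
  by auto_derive => //; ring.
have hu : h < u by rewrite /u; lra.
have [|t] := IVT_gen _ h u 0 cont.
  have lo : exp (k * h) < A * h + 1 by rewrite /k; lra.
  by rewrite Rmin_left ?Rmax_right; lra.
rewrite Rmin_left ?Rmax_right; try lra; move=> [ht et].
have -> : iota (fun t => 0 < t /\ A * t + 1 = exp (- z * t)) = t.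
  apply: iota_unique => [y [y0 ey]|]; last by split; rewrite ?/k in et *; lra.
  have eqt : A * t + 1 = exp (k * t) by lra.
  case: (Rtotal_order y t) => [lt|[//|gt]].
    by have := chord_above_exp k A y t k0 (conj y0 lt) eqt; rewrite /k; lra.
  have t0 : 0 < t by lra.
  by have := chord_above_exp k A t y k0 (conj t0 gt) ey; lra.
by split; rewrite /k in et; lra.
Qed.

(** At a double zero [z], both [exp (z t)] and [t exp (z t)] solve the linear
    equation at [1]. *)
Section Critical.
Variables (h e l m z A t0 : R) (T : (R -> R) -> R -> R).
Hypothesis h0 : 0 < h.
Hypothesis kr : kpp_roots e l m.
Hypothesis TS : forall f, admissible f -> solves e l m (source h f) (T f).
Hypothesis z0 : z < 0.
Hypothesis pz : psi h e z = 0.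
Hypothesis dpz : dpsi h e z = 0.
Hypothesis A0 : 1 < A.
Hypothesis ht0 : h <= t0.
Hypothesis et0 : A * t0 + 1 = exp (- z * t0).

Let w t := (A * t + 1) * exp (z * t).
Let F t := 1 - w t.
Let f := glue t0 (fun _ => 0) F.

Let wt0 : w t0 = 1.
Proof. by rewrite /w et0 -exp_plus (_ : _ + _ = 0) ?exp_0 //; ring. Qed.

Let E0 : (fun _ : R => 0) t0 = F t0.
Proof. by rewrite /F wt0; ring. Qed.

Let slope t : t0 <= t -> A <= - z * (A * t + 1).
Proof.
move=> ht; have u0 : 0 < t0 by lra.
suff : A <= - z * (A * t0 + 1).
  have : - z * (A * t0 + 1) <= - z * (A * t + 1) by apply: Rmult_le_compat_l; nra.
  by lra.
have := exp_ineq1_le (z * t0) => t1.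
have e1 : exp (- z * t0) * exp (z * t0) = 1.
  by rewrite -exp_plus (_ : _ + _ = 0) ?exp_0 //; ring.
rewrite -et0 in e1; have p : 0 < A * t0 + 1 by nra.
have := Rmult_le_compat_l _ _ _ (Rlt_le _ _ p) t1; rewrite e1 => le.
by apply: (Rmult_le_reg_l t0) => //; lra.
Qed.

Let Dw t : is_derive w t ((A + z * (A * t + 1)) * exp (z * t)).
Proof. by rewrite /w; auto_derive => //; ring. Qed.

Let w_le1 t : t0 <= t -> 0 <= w t <= 1.
Proof.
move=> ht; split.
  by apply: Rmult_le_pos; [nra | apply/Rlt_le/exp_pos].
have : - w t0 <= - w t.
  apply: (nondecreasing_of_derive (fun t => - w t)
    (fun t => - ((A + z * (A * t + 1)) * exp (z * t)))) => // s hs.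
    exact: (is_derive_opp w s _ (Dw s)).
  have := slope s ltac:(lra); have := exp_pos (z * s); nra.
by rewrite wt0; lra.
Qed.

Let f_ge t : 0 <= t -> 1 - w t <= f t.
Proof.
move=> tp; case: (Rle_lt_dec t0 t) => ht; first by rewrite /f glue_ge //; rewrite /F; lra.
rewrite /f glue_le; last by lra.
suff : 1 <= w t by lra.
case: (Req_dec t 0) => [->|t1]; first by rewrite /w !Rmult_0_r exp_0; lra.
have tt : 0 < t < t0 by lra.
have := chord_above_exp (- z) A t t0 ltac:(lra) tt et0 => lt.
have e1 : exp (- z * t) * exp (z * t) = 1.
  by rewrite -exp_plus (_ : _ + _ = 0) ?exp_0 //; ring.
by rewrite /w -e1; apply: Rmult_le_compat_r; [apply/Rlt_le/exp_pos | lra].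
Qed.

Lemma phi_crit_nondecreasing : nondecreasing f.
Proof.
move=> s t st; case: (Rle_lt_dec t t0) => tt; first by rewrite /f !glue_le; lra.
have ft : f t = F t by rewrite /f glue_ge //; lra.
case: (Rle_lt_dec s t0) => ss.
  by rewrite ft /f glue_le // /F; have := w_le1 t ltac:(lra); lra.
rewrite ft /f glue_ge //; last by lra.
apply: (nondecreasing_of_derive F
  (fun t => - ((A + z * (A * t + 1)) * exp (z * t)))) => // u hu.
  have := is_derive_minus (fun _ => 1) w u _ _ (is_derive_const 1 u) (Dw u).
  by rewrite /minus plus_zero_l.
have := slope u ltac:(lra); have := exp_pos (z * u); nra.
Qed.

Lemma phi_crit_admissible : admissible f.
Proof.
split=> t.
  apply: glue_continuous => // s; first exact: continuous_const.
  apply: (continuous_minus (fun _ => 1) w); first exact: continuous_const.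
  exact: derivable_continuous (Dw s).
case: (Rle_lt_dec t t0) => tt; first by rewrite /f glue_le; lra.
rewrite /f glue_ge // /F; last by lra.
by have := w_le1 t ltac:(lra); lra.
Qed.

Let q := exp (- z * h).

Let double_zero : e * z ^ 2 - z = q /\ 2 * e * z - 1 = - h * q.
Proof. by move: pz dpz; rewrite /psi /dpsi -/q; lra. Qed.

Let exp_h t : exp (z * (t - h)) = q * exp (z * t).
Proof. by rewrite /q -exp_plus; congr exp; ring. Qed.

(** To the left of [t0] the function is zero. On the right, [h <= t0] keeps the
    delayed argument where [f] is at least [1 - w]. *)
Lemma phi_crit_subsolution t : f t <= T f t.
Proof.
have [y [Dz [Dy By]]] := TS f phi_crit_admissible.
case: (Rle_lt_dec t t0) => tt; first by rewrite {1}/f glue_le //; have := By t; lra.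
have ht : t0 <= t by lra.
pose dw t := (A + z * (A * t + 1)) * exp (z * t).
have DF s : is_derive F s (- dw s).
  have := is_derive_minus (fun _ => 1) w s _ _ (is_derive_const 1 s) (Dw s).
  by rewrite /minus plus_zero_l.
have DDF s : is_derive (fun t => - dw t) s (- ((2 * z * A + z ^ 2 * (A * s + 1)) * exp (z * s))).
  by rewrite /dw; auto_derive => //; ring.
have right : forall s, t0 <= s -> l * F s - - dw s <= y s.
  apply: (right_subsolution h e l m f F _ _ y t0 l kr _ DF DDF _ _ Dy).
  - by move=> s hs; rewrite /f glue_ge.
  - move=> s hs; have := w_le1 s hs; have := slope s hs; have := exp_pos (z * s) => p sl W.
    have dw0 : dw s <= 0 by rewrite /dw; nra.
    by rewrite /F; case: kr => _ [[l0 _] _]; nra.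
  - move=> s hs.
    have lin : e * - ((2 * z * A + z ^ 2 * (A * s + 1)) * exp (z * s)) - - dw s
        = - w (s - h).
      rewrite /w exp_h /dw; have [d1 d2] := double_zero.
      rewrite (_ : e * _ - _ = - (((2 * e * z - 1) * A + (e * z ^ 2 - z) * (A * s + 1)) * exp (z * s)));
        last by ring.
      by rewrite d1 d2; ring.
    rewrite lin; have [W0 W1] := w_le1 s hs.
    have wh : 0 <= w (s - h).
      by apply: Rmult_le_pos; [nra | apply/Rlt_le/exp_pos].
    have F0 : 0 <= F s by rewrite /F; lra.
    have := Rmult_le_compat_l _ _ _ F0 (f_ge (s - h) ltac:(lra)).
    have := Rmult_le_pos _ _ W0 wh; rewrite /F; lra.
  - by move=> s; have := By s; lra.
rewrite {1}/f glue_ge //; apply: (outer_factor e l m kr (fun s => l * F s - - dw s) y F (T f) t0 1)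
  => // s hs.
- by rewrite (_ : l * F s - _ = - dw s); [apply: DF | ring].
- by have := w_le1 s hs; have := By s; rewrite /F; lra.
Qed.

Lemma phi_crit_limit : is_lim f p_infty 1.
Proof.
apply/is_lim_spec => d /=; have d0 := cond_pos d.
have d3 : 0 < d / (2 * A) by apply: Rdiv_lt_0_compat; lra.
have [S hS] := exp_mul_eventually_small (- z) _ ltac:(lra) d3.
have [S' hS'] := exp_eventually_small (- z) (d / 2) ltac:(lra) ltac:(lra).
exists (Rmax (Rmax S S') t0) => t ht.
have := Rmax_l (Rmax S S') t0; have := Rmax_r (Rmax S S') t0.
have := Rmax_l S S'; have := Rmax_r S S' => a1 a2 a3 a4.
have := hS t ltac:(lra); have := hS' t ltac:(lra).
rewrite (_ : - (- z * t) = z * t); last by ring.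
rewrite /f glue_ge //; last by lra.
move=> b1 b2; have := Rmult_lt_compat_l A _ _ ltac:(lra) b2.
rewrite (_ : A * (d / (2 * A)) = d / 2); last by field; lra.
have := w_le1 t ltac:(lra); rewrite /F /w => *; apply: Rabs_def1; lra.
Qed.

(** The defect [(t - B + exp (- d t)) exp (z t)]: the exponential correction
    contributes the negative term [psi (z - d) exp ((z - d) t)]. *)
Lemma critical_supersolution : (forall s, s < 0 -> s <> z -> psi h e s < 0) ->
  exists g, [/\ forall k, admissible k -> (forall t, k t <= g t) -> forall t, T k t <= g t,
    forall t, f t <= g t & exists t, g t < 1].
Proof.
move=> neg; pose d := - z / 2; have d0 : 0 < d by rewrite /d; lra.
pose kp := - psi h e (z - d).
have kp0 : 0 < kp by have := neg (z - d); rewrite /kp; lra.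
have q0 : 0 < q by apply: exp_pos.
pose eta := Rmin 1 (kp / q).
have kq : 0 < kp / q by apply: Rdiv_lt_0_compat.
have eta0 : 0 < eta by apply: Rmin_glb_lt; lra.
have eta_q : eta * eta * q <= kp.
  have := Rmin_l 1 (kp / q); have := Rmin_r 1 (kp / q); rewrite -/eta => a b.
  have := Rmult_le_compat_r q _ _ (Rlt_le _ _ q0) a.
  rewrite (_ : kp / q * q = kp); last by field; lra.
  by have : eta * eta <= eta * 1; nra.
have [S1 H1] := exp_mul_eventually_small (- z / 4) eta ltac:(lra) eta0.
have [S2 H2] := exp_eventually_small d (/ d) d0 (Rinv_0_lt_compat _ d0).
pose S := Rmax (Rmax S1 S2) h.
have [SS1 [SS2 Sh]] : S1 <= S /\ S2 <= S /\ h <= S.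
  have := Rmax_l (Rmax S1 S2) h; have := Rmax_r (Rmax S1 S2) h; rewrite -/S.
  by have := Rmax_l S1 S2; have := Rmax_r S1 S2; lra.
(* With [B] large, all smallness conditions hold to the right of [ts - h], where
   [ts] is the zero of [p]. *)
clearbody S; pose B := S + h + 2.
pose D t := exp (- (d * t)); have Dpos t : 0 < D t by apply: exp_pos.
pose p t := t - B + D t.
have Dp t : is_derive p t (1 - d * D t) by rewrite /p /D; auto_derive => //; ring.
have dD t : S < t -> 0 <= 1 - d * D t.
  move=> ht; have := Rmult_lt_compat_l d _ _ d0 (H2 t ltac:(lra)).
  by rewrite Rinv_r /D; lra.
have pn : forall s t, S < s -> s <= t -> p s <= p t.
  move=> s t Ss st; apply: (nondecreasing_of_derive p _ _ _ st (fun u _ => Dp u)) => u hu.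
  by apply: dD; lra.
have D1 t : 0 <= t -> D t <= 1 by move=> ht; apply: exp_le_1; nra.
have D1' t : 0 < t -> D t < 1.
  by move=> ht; rewrite /D -exp_0; apply: exp_increasing; nra.
have [ts [hts pts]] : exists ts, B - 1 <= ts <= B /\ p ts = 0.
  have [|t] := IVT_gen p (B - 1) B 0 (fun t => derivable_continuity_pt _ _ _ (Dp t)).
    have -> : p B = D B by rewrite /p; ring.
    have -> : p (B - 1) = D (B - 1) - 1 by rewrite /p; ring.
    have := D1 (B - 1); have := Dpos B; rewrite /B.
    by move=> *; rewrite Rmin_left ?Rmax_right; lra.
  by rewrite Rmin_left ?Rmax_right; try lra; exists t.
have tsS : S < ts - h by rewrite /B in hts; lra.
pose W t := p t * exp (z * t).
pose dW t := (1 - d * D t + z * p t) * exp (z * t).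
pose ddW t := (d ^ 2 * D t + 2 * z * (1 - d * D t) + z ^ 2 * p t) * exp (z * t).
have p0 t : ts <= t -> 0 <= p t by move=> ht; rewrite -pts; apply: pn; lra.
have pt t : ts <= t -> p t <= t.
  by move=> ht; have := D1 t; rewrite /p /B; lra.
have half t : exp (z * t) = D t * D t.
  by rewrite /D -exp_plus; congr exp; rewrite /d; field.
have small t : ts <= t -> t * exp (- (- z / 4 * t)) < eta by move=> ht; apply: H1; lra.
have quarter t : D t = exp (- (- z / 4 * t)) * exp (- (- z / 4 * t)).
  by rewrite /D -exp_plus; congr exp; rewrite /d; field.
have eta1 : eta <= 1 by apply: Rmin_l.
have tE t : ts <= t -> 0 <= t * exp (z * t) <= 1.
  move=> ht; have tp : 0 <= t by lra.
  have pe := exp_pos (- (- z / 4 * t)); have E1 := D1 t tp.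
  have sm := small t ht.
  have r1 : exp (- (- z / 4 * t)) <= 1 by apply: exp_le_1; nra.
  split; first by apply: Rmult_le_pos => //; apply/Rlt_le/exp_pos.
  rewrite half quarter; move: (exp _) pe sm r1 => r r0 rt r1.
  have : t * r * (r * (r * r)) <= 1 * 1.
    apply: Rmult_le_compat; try nra.
  by lra.
have WtE t : ts <= t -> 0 <= W t <= t * exp (z * t).
  move=> ht; have E := exp_pos (z * t); rewrite /W.
  by split; [apply: Rmult_le_pos | apply: Rmult_le_compat_r]; try lra; [apply: p0 | apply: pt].
exists (fun t => 1 - from_point ts W t); split.
- apply: (defect_supersolution h e l m T W dW ddW ts z kr TS).
  + move=> t; have Dt := Dp t; rewrite /W /dW; auto_derive; first by derivable.
    by rewrite (is_derive_unique (fun x => p x) _ _ Dt); ring.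
  + move=> t; have Dt := Dp t; rewrite /dW /ddW /D; auto_derive; first by derivable.
    by rewrite (is_derive_unique (fun x => p x) _ _ Dt) /D; ring.
  + move=> t ht; split; first by have := WtE t ht; have := tE t ht; lra.
    have a := dD t ltac:(lra); have b := exp_pos (z * t); have [_ c] := WtE t ht.
    have [_ c'] := tE t ht.
    have -> : dW t = (1 - d * D t) * exp (z * t) + z * W t by rewrite /dW /W; ring.
    by nra.
  move=> t ht; have [d1 d2] := double_zero.
  have -> : e * ddW t - dW t = W (t - h) - kp * D t * exp (z * t).
    have -> : W (t - h) = (t - h - B + D t * exp (d * h)) * (q * exp (z * t)).
      rewrite /W exp_h /p (_ : D (t - h) = D t * exp (d * h)) //.
      by rewrite /D -exp_plus; congr exp; ring.
    have -> : kp = q * exp (d * h) - (q + d * h * q + e * d ^ 2).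
      rewrite /kp /psi (_ : exp (- (z - d) * h) = q * exp (d * h)).
        rewrite (_ : e * (z - d) ^ 2 - (z - d) =
          (e * z ^ 2 - z) - d * (2 * e * z - 1) + e * d ^ 2); last by ring.
        by rewrite d1 d2; ring.
      by rewrite /q -exp_plus; congr exp; ring.
    rewrite /ddW /dW (_ : e * _ - _ = (e * d ^ 2 * D t + (2 * e * z - 1) * (1 - d * D t) +
      (e * z ^ 2 - z) * p t) * exp (z * t)); last by ring.
    by rewrite d1 d2 /p; ring.
  pose M := from_point ts W (t - h).
  have WM : W (t - h) <= M.
    rewrite /M; case: (Rlt_le_dec (t - h) ts) => th; last by rewrite from_point_ge //; lra.
    rewrite from_point_lt //; have : p (t - h) <= p ts by apply: pn; lra.
    by rewrite pts /W; have := exp_pos (z * (t - h)); nra.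
  have E := exp_pos (z * t).
  have M_le : 0 <= M <= t * (q * exp (z * t)).
    have tq : 0 <= t * (q * exp (z * t)).
      by apply: Rmult_le_pos; [lra | apply/Rlt_le/Rmult_lt_0_compat].
    rewrite /M; case: (Rlt_le_dec (t - h) ts) => th; first by rewrite from_point_lt //; lra.
    rewrite from_point_ge //; have [a b] := WtE (t - h) th; split=> //.
    apply: Rle_trans b _; rewrite exp_h; apply: Rmult_le_compat_r; last by lra.
    by apply/Rlt_le/Rmult_lt_0_compat.
  suff : W t * M <= kp * D t * exp (z * t) by rewrite -/M; lra.
  apply: (Rle_trans _ (t * exp (z * t) * (t * (q * exp (z * t))))).
    by have := WtE t ht => W2; apply: Rmult_le_compat; lra.
  have sm := small t ht; have r0 := exp_pos (- (- z / 4 * t)).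
  have dt := quarter t; have tp : 0 <= t by lra.
  have : t * exp (- (- z / 4 * t)) * (t * exp (- (- z / 4 * t))) * q <= kp.
    have s0 : 0 <= t * exp (- (- z / 4 * t)) by apply: Rmult_le_pos; lra.
    apply: Rle_trans eta_q; apply: Rmult_le_compat_r; first by lra.
    by apply: Rmult_le_compat; lra.
  rewrite (_ : _ * q = t * t * q * D t); last by rewrite dt; ring.
  have DE : 0 <= D t * exp (z * t) by apply/Rlt_le/Rmult_lt_0_compat.
  move/(Rmult_le_compat_r _ _ _ DE).
  rewrite (_ : t * exp (z * t) * _ = t * t * q * D t * (D t * exp (z * t))); first by lra.
  by rewrite (half t); ring.
- move=> t; case: (Rlt_le_dec t ts) => ht.
    by rewrite from_point_lt //; have := proj2 phi_crit_admissible t; lra.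
  rewrite from_point_ge //; have := WtE t ht; have := tE t ht => a b.
  case: (Rle_lt_dec t t0) => tt; first by rewrite /f glue_le //; lra.
  rewrite /f glue_ge // /F; last by lra.
  suff : W t <= w t by lra.
  rewrite /W /w; apply: Rmult_le_compat_r; first exact/Rlt_le/exp_pos.
  by have := pt t ht; nra.
exists B; rewrite from_point_ge; last by lra.
suff : 0 < W B by lra.
rewrite /W /p (_ : B - B + D B = D B); last by ring.
by apply: Rmult_lt_0_compat => //; apply: exp_pos.
Qed.

End Critical.

(** * A priori properties of profiles *)

Lemma derive_of_nondecreasing (f df : R -> R) :
  (forall t, is_derive f t (df t)) -> nondecreasing f -> forall t, 0 <= df t.
Proof.
move=> D n t; have pr : derivable f.
  by move=> s; exists (df s); apply/is_derive_Reals.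
have <- : derive_pt f t (pr t) = df t by apply/derive_pt_eq_0/is_derive_Reals.
by apply: nonneg_derivative_0 => x y; apply: n.
Qed.

Section Profile.
Variables (h e : R) (phi p : R -> R).
Hypothesis h0 : 0 <= h.
Hypothesis e0 : 0 < e.
Hypothesis P : profile h e phi p.

Let D : forall t, is_derive phi t (p t). Proof. by case: P. Qed.
Let DD : forall t, is_derive p t ((p t - phi t * (1 - phi (t - h))) / e).
Proof. by case: P. Qed.
Let pos : forall t, 0 < phi t. Proof. by case: P. Qed.
Let nd : nondecreasing phi. Proof. by case: P. Qed.

Lemma profile_derive_ge0 t : 0 <= p t.
Proof. exact: derive_of_nondecreasing D nd t. Qed.

Lemma profile_le1 t : phi t <= 1.
Proof. by case: P => _ _ _ _ [_ l1]; apply: nondecreasing_lim_le nd l1 t. Qed.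

Lemma profile_small (d : R) : 0 < d -> exists T, forall t, t <= T -> phi t < d.
Proof.
move=> d0; case: P => _ _ _ _ [/is_lim_spec/(_ (mkposreal d d0)) [M hM] _].
exists (M - 1) => t ht; have := hM t ltac:(lra); rewrite /= Rminus_0_r.
by move/Rabs_def2; lra.
Qed.

Lemma defect_small (d : R) : 0 < d -> Rbar_locally p_infty (fun t => 1 - phi t < d).
Proof.
move=> d0; case: P => _ _ _ _ [_ /is_lim_spec/(_ (mkposreal d d0)) [M hM]].
by exists M => t ht; have /Rabs_def2 /= := hM t ht; lra.
Qed.

(** If [phi] reached [1], both [1 - phi] and [phi'] would be at a minimum, and
    the equation would carry the value [1] back by the delay; without delay,
    the Cauchy problem has no other solution than the constant one. *)
Lemma profile_lt1 t : phi t < 1.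
Proof.
apply: Rnot_le_lt => ge1.
have back : forall s, phi s = 1 -> p s = 0 /\ phi (s - h) = 1.
  move=> s s1; have ps : p s = 0.
    suff : - p s = 0 by lra.
    apply: (derive_at_min (fun t => 1 - phi t) s) => [|u].
      have := is_derive_minus (fun _ => 1) phi s _ _ (is_derive_const 1 s) (D s).
      by rewrite /minus plus_zero_l.
    by have := profile_le1 u; lra.
  have /derive_at_min := DD s => /(_ ltac:(by move=> u; rewrite ps; apply: profile_derive_ge0)).
  rewrite ps s1 => E; split=> //; suff : - (1 * (1 - phi (s - h))) = 0 by lra.
  by apply: (Rmult_eq_reg_r (/ e)); [rewrite /Rdiv in E; lra | apply/Rgt_not_eq/Rinv_0_lt_compat].
have phi1 : phi t = 1 by have := profile_le1 t; lra.
have [T hT] := profile_small (1 / 2) ltac:(lra).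
case: (Rle_lt_or_eq_dec 0 h h0) => [hp|hz].
  have iter : forall n : nat, phi (t - INR n * h) = 1.
    elim=> [|n IH]; first by rewrite /= Rmult_0_l Rminus_0_r.
    have [_ E] := back _ IH; rewrite S_INR.
    by rewrite (_ : t - (INR n + 1) * h = t - INR n * h - h) //; ring.
  have [n hn] := INR_unbounded ((t - T) / h).
  have := hT (t - INR n * h); rewrite iter.
  have := Rmult_lt_compat_r h _ _ hp hn.
  by rewrite (_ : (t - T) / h * h = t - T); [lra | field; lra].
pose w s := 1 - phi s; pose C := 1 / e + 1.
have ie : 0 < 1 / e by apply: Rdiv_lt_0_compat; lra.
pose s := Rmin t T.
have [st sT] : s <= t /\ s <= T by split; [apply: Rmin_l | apply: Rmin_r].
have mono : (p s ^ 2 + w s ^ 2) * exp (C * s) <= (p t ^ 2 + w t ^ 2) * exp (C * t).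
  apply: (nondecreasing_of_derive (fun u => (p u ^ 2 + w u ^ 2) * exp (C * u))
    (fun u => (2 * p u * ((p u - phi u * w u) / e) - 2 * w u * p u +
      C * (p u ^ 2 + w u ^ 2)) * exp (C * u))) => // u hu.
    have Du := D u; have DDu := DD u; rewrite /w; auto_derive; first by derivable.
    rewrite (is_derive_unique (fun x => phi x) _ _ Du) (is_derive_unique (fun x => p x) _ _ DDu).
    by rewrite -hz Rminus_0_r; field; lra.
  apply: Rmult_le_pos; last exact/Rlt_le/exp_pos.
  have w0 : 0 <= w u by rewrite /w; have := profile_le1 u; lra.
  have wp : 0 <= w u * p u by apply: Rmult_le_pos => //; apply: profile_derive_ge0.
  have sq : 2 * (w u * p u) <= p u ^ 2 + w u ^ 2 by have := pow2_ge_0 (p u - w u); lra.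
  have phiw : phi u * (w u * p u) <= w u * p u by have := profile_le1 u; nra.
  rewrite (_ : 2 * p u * (_ / e) = 1 / e * (2 * p u ^ 2 - 2 * (phi u * (w u * p u))));
    last by field; lra.
  have : 0 <= 1 / e * (2 * p u ^ 2 - 2 * (phi u * (w u * p u)) + (p u ^ 2 + w u ^ 2)).
    by apply: Rmult_le_pos; [lra | have := pow2_ge_0 (p u); lra].
  by rewrite /C; lra.
move: mono; have [-> _] := back t phi1; rewrite /w phi1.
have := hT s sT; have := exp_pos (C * s); have := pow2_ge_0 (p s).
by nra.
Qed.

(** Once [p] exceeds [1] the equation makes it increase, and [phi] would be
    unbounded. *)
Lemma profile_derive_le1 t : p t <= 1.
Proof.
apply: Rnot_lt_le => gt.
have low : forall s, t <= s -> 1 <= p s.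
  move=> s ts; suff : - p s <= - p t by lra.
  apply: (barrier (fun s => - p s) (fun s => - ((p s - phi s * (1 - phi (s - h))) / e)) t (- 1))
    => // [u hu|| u hu lt].
  - exact: (is_derive_opp p u _ (DD u)).
  - by lra.
  have : phi u * (1 - phi (u - h)) <= 1.
    have := pos (u - h); have := pos u; have := profile_le1 u; have := profile_le1 (u - h); nra.
  move=> le; have : 0 <= (p u - phi u * (1 - phi (u - h))) / e.
    by apply: Rdiv_le_0_compat; lra.
  by lra.
have [s [hs E]] := mean_value phi p t (t + 2) ltac:(lra) (fun s _ => D s).
by have := low s ltac:(lra); have := profile_lt1 (t + 2); have := pos t; lra.
Qed.

(** Near [- oo] the quotient [phi' / phi] solves a Riccati equation whose
    quadratic has no real root when [e > 1 / 4]. *)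
Lemma profile_speed : e <= 1 / 4.
Proof.
apply: Rnot_lt_le => big.
pose eta := (1 / e - 1 / (4 * e ^ 2)) / 2.
have eta_e : 2 * e * eta = 1 - 1 / (4 * e) by rewrite /eta; field; lra.
have lt1 : 1 / (4 * e) < 1 by apply/Rlt_div_l; lra.
have eta0 : 0 < eta by nra.
have [T hT] := profile_small (e * eta) ltac:(nra).
pose v s := p s / phi s - 1 / (2 * e).
apply: (riccati_blow_up (fun s => v (T - s))
  (fun s => - (((p (T - s) - phi (T - s) * (1 - phi (T - s - h))) / e) / phi (T - s) -
    (p (T - s) / phi (T - s)) ^ 2)) eta eta0) => s hs.
  have Ds := D (T - s); have DDs := DD (T - s); rewrite /v.
  have ps := pos (T - s).
  auto_derive; first by derivable.
  rewrite (is_derive_unique (fun x => phi x) _ _ Ds) (is_derive_unique (fun x => p x) _ _ DDs).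
  by rewrite /Rminus in ps *; field; lra.
have ph := hT (T - s - h) ltac:(lra).
have ps := pos (T - s); rewrite /v.
rewrite (_ : - (_ / phi (T - s) - _) = (p (T - s) / phi (T - s) - 1 / (2 * e)) ^ 2 +
  (1 - phi (T - s - h)) / e - 1 / (4 * e ^ 2)); last by field; lra.
have : (1 - phi (T - s - h)) / e - 1 / (4 * e ^ 2) = 2 * eta - phi (T - s - h) / e.
  by rewrite /eta; field; lra.
have : phi (T - s - h) / e <= eta by apply/Rle_div_l; lra.
by lra.
Qed.

Let w t := 1 - phi t.

Let w_pos t : 0 < w t. Proof. by rewrite /w; have := profile_lt1 t; lra. Qed.

Let w_decr s t : s <= t -> w t <= w s. Proof. by rewrite /w => /nd; lra. Qed.

Lemma defect_decay (z T s t : R) : (forall t, T <= t -> z * w t <= p t) ->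
  T <= s -> s <= t -> w t * exp (z * t) <= w s * exp (z * s).
Proof.
move=> zp Ts st; apply: Ropp_le_cancel.
apply: (nondecreasing_of_derive (fun t => - (w t * exp (z * t)))
  (fun t => (p t - z * w t) * exp (z * t))) => // u hu.
  have Du := D u; rewrite /w; auto_derive; first by derivable.
  by rewrite (is_derive_unique (fun x => phi x) _ _ Du); ring.
by apply: Rmult_le_pos; [have := zp u; lra | apply/Rlt_le/exp_pos].
Qed.

(** The logarithmic decay rate [v = p / w] of the defect satisfies
    [e v' <= e v^2 + v - exp (z h) + o(1)] once [v >= z]; where the
    right-hand side is negative, a value of [v] less than [z + eta] would drive
    [v] below zero later on. *)
Lemma decay_rate_step (z eta g : R) : 0 <= z -> 0 < g ->
  e * (z + eta) ^ 2 + (z + eta) + g <= exp (z * h) -> 0 < eta ->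
  Rbar_locally p_infty (fun t => z * w t <= p t) ->
  Rbar_locally p_infty (fun t => (z + eta) * w t <= p t).
Proof.
move=> z0 g0 gap eta0 [T hT].
have ezh := exp_pos (z * h).
have [S hS] := defect_small (g / 2 / exp (z * h)) ltac:(apply: Rdiv_lt_0_compat; lra).
exists (Rmax S (T + 1 + h)) => t0 ht0.
have [t0S t0T] : S < t0 /\ T + 1 + h < t0.
  by have := Rmax_l S (T + 1 + h); have := Rmax_r S (T + 1 + h); lra.
pose v t := p t / w t.
have v0 t : 0 <= v t by apply: Rdiv_le_0_compat; [apply: profile_derive_ge0 | apply: w_pos].
pose dv t := (v t - phi t * w (t - h) / w t) / e + v t ^ 2.
have Dv t : is_derive v t (dv t).
  have Dt := D t; have DDt := DD t; have wt := w_pos t; rewrite /v /dv /w in wt *.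
  auto_derive; first by derivable.
  rewrite (is_derive_unique (fun x => phi x) _ _ Dt) (is_derive_unique (fun x => p x) _ _ DDt).
  by rewrite /v /w; field; lra.
have dec t : t0 <= t -> v t < z + eta -> dv t <= - (g / 2 / e).
  move=> ht lt; have wt := w_pos t.
  have delay : exp (z * h) * w t <= w (t - h).
    have := defect_decay z (T + 1) (t - h) t (fun s hs => hT s ltac:(lra)) ltac:(lra) ltac:(lra).
    rewrite (_ : z * t = z * h + z * (t - h)); last by ring.
    rewrite exp_plus => le; apply: (Rmult_le_reg_r (exp (z * (t - h)))); first exact: exp_pos.
    by lra.
  have ratio : exp (z * h) - g / 2 <= phi t * w (t - h) / w t.
    apply/Rle_div_r => //; apply: (Rle_trans _ (phi t * (exp (z * h) * w t))); last first.
      by rewrite /Rdiv; apply: Rmult_le_compat_l => //; apply/Rlt_le.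
    have small := Rmult_lt_compat_r _ _ _ ezh (hS t ltac:(lra)).
    rewrite (_ : g / 2 / _ * _ = g / 2) in small; last by field; lra.
    by rewrite -Rmult_assoc; apply: Rmult_le_compat_r; lra.
  apply: (Rmult_le_reg_l e) => //; rewrite /dv.
  rewrite (_ : e * (_ / e + _) = v t - phi t * w (t - h) / w t + e * v t ^ 2); last by field; lra.
  rewrite (_ : e * - (g / 2 / e) = - (g / 2)); last by field; lra.
  have : e * v t ^ 2 <= e * (z + eta) ^ 2.
    by apply: Rmult_le_compat_l; [lra | apply: pow_incr; have := v0 t; lra].
  by lra.
suff : z + eta <= v t0.
  by move/(Rmult_le_compat_r (w t0) _ _ (Rlt_le _ _ (w_pos t0))); rewrite /v /Rdiv
    Rmult_assoc Rinv_l; [lra | apply/Rgt_not_eq].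
apply: Rnot_lt_le => lt.
have ge0 : 0 < g / 2 / e by apply: Rdiv_lt_0_compat; lra.
have stay : forall t, t0 <= t -> v t <= v t0.
  apply: (barrier v dv t0 (z + eta)) => // t ht vt.
  by have := dec t ht vt; lra.
pose X := (v t0 + 1) / (g / 2 / e).
have X0 : 0 <= X by apply: Rdiv_le_0_compat => //; have := v0 t0; lra.
have [s [hs E]] := mean_value v dv t0 (t0 + X) ltac:(lra) (fun t _ => Dv t).
have := dec s ltac:(lra) ltac:(have := stay s ltac:(lra); lra).
have XE : X * (g / 2 / e) = v t0 + 1 by rewrite /X; field; lra.
by have := v0 (t0 + X); nra.
Qed.

(** Finitely many steps of a fixed size lead from [0] to [Z]. *)
Lemma decay_rate (Z : R) : 0 <= Z ->
  (forall z, 0 <= z <= Z -> e * z ^ 2 + z < exp (z * h)) ->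
  Rbar_locally p_infty (fun t => Z * w t <= p t).
Proof.
move=> Z0 gap.
pose g z := exp (z * h) - e * z ^ 2 - z.
have [|z1 [min hz1]] := continuity_ab_min g 0 Z Z0.
  move=> z _; apply: (derivable_continuity_pt _ z (h * exp (z * h) - 2 * e * z - 1)).
  by rewrite /g; auto_derive => //; ring.
have g0 : 0 < g z1 by have := gap z1 hz1; rewrite /g; lra.
pose L := e * (2 * Z + 1) + 1; have L0 : 0 < L by rewrite /L; nra.
pose eta := Rmin 1 (g z1 / 2 / L).
have q0 : 0 < g z1 / 2 / L by apply: Rdiv_lt_0_compat; lra.
have eta0 : 0 < eta by apply: Rmin_glb_lt; lra.
have eta1 : eta <= 1 by apply: Rmin_l.
have etaL : L * eta <= g z1 / 2.
  have := Rmult_le_compat_l L _ _ (Rlt_le _ _ L0) (Rmin_r 1 (g z1 / 2 / L)).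
  by rewrite -/eta (_ : L * (_ / L) = g z1 / 2) //; field; lra.
(* The increment [eta] uses at most half of the minimal gap, uniformly in [z]. *)
have step : forall z, 0 <= z <= Z ->
    Rbar_locally p_infty (fun t => z * w t <= p t) ->
    Rbar_locally p_infty (fun t => (z + eta) * w t <= p t).
  move=> z hz; apply: (decay_rate_step z eta (g z1 / 2)) => //; first by lra.
    by lra.
  have := min z hz; rewrite {2}/g => gz.
  have : e * (z + eta) ^ 2 + (z + eta) = e * z ^ 2 + z + (e * (2 * z + eta) + 1) * eta by ring.
  have : (e * (2 * z + eta) + 1) * eta <= L * eta.
    by apply: Rmult_le_compat_r; [lra | rewrite /L; nra].
  by lra.
have all : forall (n : nat) z, 0 <= z <= Z -> z <= INR n * eta ->
    Rbar_locally p_infty (fun t => z * w t <= p t).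
  elim=> [|n IH] z hz.
    rewrite /= Rmult_0_l => z0; exists 0 => t _.
    by rewrite (_ : z = 0) ?Rmult_0_l; [apply: profile_derive_ge0 | lra].
  rewrite S_INR => zn; case: (Rle_lt_dec z eta) => ze.
    have := step 0 ltac:(lra) _; rewrite Rplus_0_l => H.
    have := H ltac:(exists 0 => t _; rewrite Rmult_0_l; exact: profile_derive_ge0).
    by apply: filter_imp => t; have := w_pos t; nra.
  have := step (z - eta) ltac:(lra) (IH (z - eta) ltac:(lra) ltac:(lra)).
  by rewrite (_ : z - eta + eta = z) //; ring.
have [n hn] := INR_unbounded (Z / eta).
apply: (all n Z); first by lra.
have := Rmult_lt_compat_r eta _ _ eta0 hn.
by rewrite (_ : Z / eta * eta = Z); [lra | field; lra].
Qed.

(** Two mean value arguments for the decreasing quantity [e p + w] bound the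
    defect at [t - h / 4] by the defect at [t]. *)
Lemma defect_not_superexponential : 0 < h ->
  exists C, 0 < C /\ Rbar_locally p_infty (fun t => w (t - h / 4) <= C * w t).
Proof.
move=> hp; exists (4 / h * (4 * e / h + 1)); split.
  have a : 0 < 4 / h by apply: Rdiv_lt_0_compat; lra.
  have b : 0 < 4 * e / h by apply: Rdiv_lt_0_compat; lra.
  by nra.
have [S hS] := defect_small (1 / 2) ltac:(lra).
pose Zf t := e * p t + w t.
have DZ t : is_derive Zf t (- (phi t * w (t - h))).
  have Dt := D t; have DDt := DD t; rewrite /Zf /w; auto_derive; first by derivable.
  rewrite (is_derive_unique (fun x => phi x) _ _ Dt) (is_derive_unique (fun x => p x) _ _ DDt).
  by field; lra.
have Zlow t : S < t -> h / 4 * w (t - h / 2) <= Zf t.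
  move=> St.
  have [s [hs E]] := mean_value Zf _ t (t + h / 2) ltac:(lra) (fun s _ => DZ s).
  have Z0 : 0 <= Zf (t + h / 2).
    rewrite /Zf; have := w_pos (t + h / 2); have := profile_derive_ge0 (t + h / 2); nra.
  have ph : 1 / 2 <= phi s by have := hS s ltac:(lra); lra.
  have wd : w (t - h / 2) <= w (s - h) by apply: w_decr; lra.
  have : 1 / 2 * w (t - h / 2) <= phi s * w (s - h).
    by apply: Rmult_le_compat; try lra; apply/Rlt_le.
  move/(Rmult_le_compat_r (h / 2) _ _ ltac:(lra)); lra.
exists S => t St.
have [s [hs E]] : exists s, t <= s <= t + h / 4 /\ w (t + h / 4) - w t = - p s * (t + h / 4 - t).
  apply: (mean_value w (fun s => - p s)); first by lra.
  move=> s _; have := is_derive_minus (fun _ => 1) phi s _ _ (is_derive_const 1 s) (D s).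
  by rewrite /minus plus_zero_l.
have wt := w_pos (t + h / 4).
have ps : p s * (h / 4) <= w t by lra.
have low := Zlow s ltac:(lra).
have ws : w s <= w t by apply: w_decr; lra.
have wd : w (t - h / 4) <= w (s - h / 2) by apply: w_decr; lra.
have ep : e * p s <= 4 * e / h * w t.
  rewrite (_ : e * p s = 4 * e / h * (p s * (h / 4))); last by field; lra.
  by apply: Rmult_le_compat_l => //; apply/Rlt_le/Rdiv_lt_0_compat; lra.
apply: (Rmult_le_reg_l (h / 4)); first by lra.
rewrite (_ : h / 4 * (4 / h * _ * _) = (4 * e / h + 1) * w t); last by field; lra.
by rewrite /Zf in low; nra.
Qed.

(** Were there no negative zero, the decay rate would exceed every bound. *)
Lemma profile_delay : 0 < h -> h <= hpar (e / h).
Proof.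
move=> hp; apply: Rnot_lt_le => lt.
have [C [C0 ev]] := defect_not_superexponential hp.
have Z0 : 0 <= 4 * C / h by apply: Rdiv_le_0_compat; lra.
have rate := decay_rate (4 * C / h) Z0
  (fun z hz => no_negative_zero h e z hp e0 lt (proj1 hz)).
have [T hT] := filter_and _ _ ev rate.
pose t := T + 1 + h; have [le _] := hT t ltac:(rewrite /t; lra).
have := defect_decay (4 * C / h) (T + 1) (t - h / 4) t
  (fun s hs => proj2 (hT s ltac:(lra))) ltac:(rewrite /t; lra) ltac:(lra).
rewrite (_ : 4 * C / h * t = C + 4 * C / h * (t - h / 4)); last by field; lra.
rewrite exp_plus -Rmult_assoc => /(Rmult_le_reg_r _ _ _ (exp_pos _)) big.
have := exp_ineq1_le C; have := w_pos t => a b.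
have : w t * (1 + C) <= w t * exp C by apply: Rmult_le_compat_l; lra.
by lra.
Qed.

(** * Exact decay of the defect *)

Lemma monotone_limit (f : R -> R) (T B : R) :
  (forall s t, T <= s -> s <= t -> f t <= f s) -> (forall t, T <= t -> B <= f t) ->
  exists a, forall d, 0 < d -> exists S, T <= S /\ forall t, S <= t -> a <= f t <= a + d.
Proof.
move=> dec low; pose E x := exists t, T <= t /\ x = - f t.
have [b [ub lub]] : {b | is_lub E b}.
  apply: completeness; last by exists (- f T), T; split; first exact: Rle_refl.
  by exists (- B) => _ [t [ht ->]]; have := low t ht; lra.
exists (- b) => d d0.
have [[S [hS small]] | none] :=
    Classical_Prop.classic (exists S, T <= S /\ f S < - b + d).
  exists S; split=> // t ht; split.
    suff : - f t <= b by lra.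
    by apply: ub; exists t; split=> //; lra.
  by have := dec S t hS ht; lra.
have : b <= b - d.
  apply: lub => _ [t [ht ->]]; apply: Rnot_lt_le => lt.
  by apply: none; exists t; split=> //; lra.
by lra.
Qed.

Variable z : R.
Hypothesis z0 : z < 0.
Hypothesis pz : psi h e z = 0.
Hypothesis dpz : dpsi h e z < 0.
Hypothesis zmax : forall s, z < s <= 0 -> psi h e s < 0.

Let q := exp (- z * h).
Let al := 1 - 2 * e * z.
Let u t := exp (- z * t) * w t.
Let du t := - z * u t - exp (- z * t) * p t.

Let q_pos : 0 < q. Proof. exact: exp_pos. Qed.
Let al_pos : 0 < al. Proof. by rewrite /al; nra. Qed.
Let al_gt : q * h < al. Proof. by rewrite /q /al; move: dpz; rewrite /dpsi; lra. Qed.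
Let zz : e * z ^ 2 - z = q. Proof. by rewrite (psi_exp h) pz /q; ring. Qed.

Let Du t : is_derive u t (du t).
Proof.
have Dt := D t; rewrite /u /du /w; auto_derive; first by derivable.
by rewrite (is_derive_unique (fun x => phi x) _ _ Dt) /u /w; ring.
Qed.

Let U t := RInt u 0 t.

Let DU t : is_derive U t (u t).
Proof.
apply: (is_derive_RInt u U 0 t); last exact: derivable_continuous (Du t).
apply: filter_forall => s; apply: RInt_correct; apply: ex_RInt_continuous => x _.
exact: derivable_continuous (Du x).
Qed.

(** The conserved quantity of the linearized equation attached to the zero [z];
    along the nonlinear equation it decreases. *)
Let Q t := e * du t - al * u t + q * (U t - U (t - h)).

Let DQ t : is_derive Q t (- (u t * w (t - h))).
Proof.
have ext s : exp (- z * s) * (- e * p s + (e * z - 1) * w s) +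
  q * (U s - U (s - h)) = Q s by rewrite /Q /du /u /al; ring.
apply: (is_derive_ext _ _ _ _ ext).
have Dt := D t; have DDt := DD t; have DUt := DU t; have DUh := DU (t - h).
rewrite /w; auto_derive; first by derivable.
rewrite (is_derive_unique (fun x => phi x) _ _ Dt) (is_derive_unique (fun x => p x) _ _ DDt).
rewrite (is_derive_unique (fun x => U x) _ _ DUt).
rewrite (_ : Derive [eta U] (t + - h) = u (t - h)); last exact: is_derive_unique DUh.
have shift : q * exp (- z * (t - h)) = exp (- z * t).
  by rewrite /q -exp_plus; congr exp; ring.
have := congr1 (Rmult (w (t - h))) shift.
have := congr1 (Rmult (exp (- z * t) * w t)) zz.
have ee : e * ((p t - phi t * (1 - phi (t - h))) / e) = p t - phi t * (1 - phi (t - h)).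
  by field; lra.
have := congr1 (Rmult (exp (- z * t))) ee.
by rewrite /u /w; lra.
Qed.

Let u_pos t : 0 < u t.
Proof. by apply: Rmult_lt_0_compat => //; apply: exp_pos. Qed.

Let edu t : e * du t = Q t + al * u t - q * (U t - U (t - h)).
Proof. by rewrite /Q; ring. Qed.

Let U_mean t : exists s, t - h <= s <= t /\ U t - U (t - h) = h * u s.
Proof.
have [s [hs E]] := mean_value U u (t - h) t ltac:(lra) (fun s _ => DU s).
by exists s; split=> //; rewrite E; ring.
Qed.

(** [psi] being negative on [(z, 0]], the defect decays almost like [exp (z t)]
    by [decay_rate]. *)
Let growth (k : R) : 0 < k <= - z -> exists C T, 0 < C /\ 0 <= T /\
  forall t, T <= t -> w t <= C * exp ((z + k) * t) /\ u t <= C * exp (k * t).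
Proof.
move=> hk; have Z0 : 0 <= - (z + k) by lra.
have [|T hT] := decay_rate (- (z + k)) Z0.
  move=> s hs; have := zmax (- s) ltac:(lra).
  by rewrite /psi (_ : - - s * h = s * h); lra || ring.
pose T' := Rmax (T + 1) 0.
have [TT T0] : T < T' /\ 0 <= T'.
  by have := Rmax_l (T + 1) 0; have := Rmax_r (T + 1) 0; rewrite -/T'; lra.
exists (w T' * exp (- (z + k) * T')), T'; split.
  by apply: Rmult_lt_0_compat => //; apply: exp_pos.
split=> // t ht.
have wt : w t <= w T' * exp (- (z + k) * T') * exp ((z + k) * t).
  have := defect_decay (- (z + k)) T' T' t (fun s hs => hT s ltac:(lra)) (Rle_refl _) ht.
  move/(Rmult_le_compat_r _ _ _ (Rlt_le _ _ (exp_pos ((z + k) * t)))).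
  rewrite Rmult_assoc -exp_plus (_ : - (z + k) * t + (z + k) * t = 0); last by ring.
  by rewrite exp_0 Rmult_1_r.
split=> //; rewrite /u.
have := Rmult_le_compat_l _ _ _ (Rlt_le _ _ (exp_pos (- z * t))) wt.
rewrite (_ : k * t = - z * t + (z + k) * t); last by ring.
by rewrite (exp_plus (- z * t)); lra.
Qed.

Let Q_limit : exists a, forall d, 0 < d ->
  exists S, forall t, S <= t -> a <= Q t <= a + d.
Proof.
pose k := - z / 4; have [C [T [C0 [T0 hT]]]] := growth k ltac:(rewrite /k; lra).
pose s := - (z + k + k); have s0 : 0 < s by rewrite /s /k; lra.
pose K := C * C * exp (- (z + k) * h).
have K0 : 0 < K by apply: Rmult_lt_0_compat; [nra | apply: exp_pos].
have dQ t : T + h <= t -> u t * w (t - h) <= K * exp (- s * t).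
  move=> ht; have [_ ut] := hT t ltac:(lra); have [wt _] := hT (t - h) ltac:(lra).
  apply: Rle_trans (Rmult_le_compat _ _ _ _ (Rlt_le _ _ (u_pos t)) (Rlt_le _ _ (w_pos (t - h))) ut wt) _.
  apply: Req_le; rewrite /K.
  rewrite (_ : - s * t = k * t + ((z + k) * (t - h) + (z + k) * h)); last by rewrite /s; ring.
  rewrite !exp_plus (_ : - (z + k) * h = - ((z + k) * h)) ?exp_Ropp; last by ring.
  by field; apply/Rgt_not_eq/exp_pos.
have dec : forall x t, T + h <= x -> x <= t -> Q t <= Q x.
  move=> x t hx xt; apply: Ropp_le_cancel.
  apply: (nondecreasing_of_derive (fun t => - Q t) (fun t => - - (u t * w (t - h)))) => // y hy.
    exact: (is_derive_opp Q y _ (DQ y)).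
  by rewrite Ropp_involutive; apply: Rmult_le_pos; apply/Rlt_le.
have low : forall t, T + h <= t -> Q (T + h) - K / s <= Q t.
  move=> t ht.
  have : Q (T + h) - K / s * exp (- s * (T + h)) <= Q t - K / s * exp (- s * t).
    apply: (nondecreasing_of_derive (fun t => Q t - K / s * exp (- s * t))
      (fun t => - (u t * w (t - h)) + K * exp (- s * t))) => // y hy.
      have Qy := DQ y; auto_derive; first by derivable.
      by rewrite (is_derive_unique (fun x => Q x) _ _ Qy); field; lra.
    by have := dQ y ltac:(lra); lra.
  have Ks : 0 < K / s by apply: Rdiv_lt_0_compat.
  have : exp (- s * (T + h)) <= 1 by apply: exp_le_1; nra.
  by have := exp_pos (- s * t); nra.
have [a ha] := monotone_limit Q (T + h) _ dec low.
by exists a => d d0; have [S [_ hS]] := ha d d0; exists S.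
Qed.

(** Since [al > q h] the equation [e u' = al u - q (U - U_h) + Q] is unstable:
    an a priori bound with a slowly growing weight improves itself. *)
Let u_bounded : exists M T, forall t, T <= t -> u t <= M.
Proof.
have [a ha] := Q_limit; have [S hS] := ha 1 Rlt_0_1.
(* The weight [exp (k t)] is slow enough for [th] below to be less than [1]. *)
pose k := Rmin (- z) ((al - q * h) / (2 * e)).
have k1 : 0 < (al - q * h) / (2 * e) by apply: Rdiv_lt_0_compat; lra.
have k0 : 0 < k by apply: Rmin_glb_lt; lra.
have kz : k <= - z by apply: Rmin_l.
have ke : e * k <= (al - q * h) / 2.
  have := Rmult_le_compat_l e _ _ (Rlt_le _ _ e0) (Rmin_r (- z) ((al - q * h) / (2 * e))).
  by rewrite -/k (_ : e * (_ / _) = (al - q * h) / 2) //; field; lra.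
have [C [T1 [C0 [T10 hT1]]]] := growth k (conj k0 kz).
pose T := Rmax S T1.
have [TS T1T] : S <= T /\ T1 <= T by split; [apply: Rmax_l | apply: Rmax_r].
have [|tm [hm _]] := continuity_ab_maj u T (T + h) ltac:(lra).
  by move=> t _; apply: derivable_continuity_pt (Du t).
pose M := Rmax (u tm) (- a / (al - q * h)).
have M1 : u tm <= M by apply: Rmax_l.
have M0 : 0 < M by have := u_pos tm; lra.
have M2 : - a <= (al - q * h) * M.
  have := Rmult_le_compat_l (al - q * h) _ _ ltac:(lra) (Rmax_r (u tm) (- a / (al - q * h))).
  by rewrite -/M (_ : (al - q * h) * (_ / _) = - a) //; field; lra.
have qh0 : 0 <= q * h by apply: Rmult_le_pos; lra.
pose th := q * h / (al - e * k).
have thE : th * (al - e * k) = q * h by rewrite /th; field; lra.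
have th0 : 0 <= th by apply: Rdiv_le_0_compat; lra.
have th1 : th < 1 by apply/Rlt_div_l; lra.
have improve N : 0 <= N -> (forall t, T <= t -> u t <= M + N * exp (k * t)) ->
    forall t, T <= t -> u t <= M + th * N * exp (k * t).
  move=> N0 HN t ht; case: (Rle_lt_dec t (T + h)) => tT.
    have := hm t (conj ht tT); have : 0 <= th * N * exp (k * t).
      by apply: Rmult_le_pos; [apply: Rmult_le_pos | apply/Rlt_le/exp_pos].
    by lra.
  apply: Rminus_le.
  apply: (growth_comparison (al / e) k (M + N) (T + h)
    (fun t => u t - (M + th * N * exp (k * t)))
    (fun t => du t - th * N * (k * exp (k * t)))) => [|s hs|s hs|s hs|]; last by lra.
  - by apply/Rlt_div_r; lra.
  - have Ds := Du s; auto_derive; first by derivable.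
    by rewrite (is_derive_unique (fun x => u x) _ _ Ds); ring.
  - apply: (Rmult_le_reg_l e) => //.
    rewrite (_ : e * (al / e * _) = al * u s - al * M - al * th * N * exp (k * s)); last by field; lra.
    rewrite Rmult_minus_distr_l edu.
    have [x [hx ->]] := U_mean s.
    have ux := HN x ltac:(lra).
    have ex : exp (k * x) <= exp (k * s) by apply: exp_nondecreasing; nra.
    have ux' : u x <= M + N * exp (k * s) by nra.
    have := Rmult_le_compat_l _ _ _ qh0 ux'.
    have := hS s ltac:(lra).
    have : th * N * exp (k * s) * (al - e * k) = q * h * (N * exp (k * s)) by rewrite -thE; ring.
    by lra.
  - have := HN s ltac:(lra).
    have : 1 <= exp (k * s) by rewrite -exp_0; apply: exp_nondecreasing; nra.
    have : 0 <= th * N * exp (k * s).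
      by apply: Rmult_le_pos; [apply: Rmult_le_pos | apply/Rlt_le/exp_pos].
    by nra.
have iter (n : nat) : forall t, T <= t -> u t <= M + th ^ n * C * exp (k * t).
  elim: n => [|n IH] t ht.
    by have [_] := hT1 t ltac:(lra); rewrite /= Rmult_1_l; lra.
  rewrite (_ : th ^ n.+1 * C = th * (th ^ n * C)); last by rewrite /=; ring.
  by apply: improve => //; apply: Rmult_le_pos; [apply: pow_le | lra].
exists M, T => t ht; apply: le_epsilon => d d0.
have K0 : 0 < C * exp (k * t) by apply: Rmult_lt_0_compat => //; apply: exp_pos.
have [n hn] := pow_lt_1_zero th ltac:(rewrite Rabs_pos_eq; lra)
  (d / (C * exp (k * t))) ltac:(apply: Rdiv_lt_0_compat; lra).
have /Rabs_def2 [lt _] := hn n (Nat.le_refl n).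
have ek := exp_pos (k * t); have := Rmult_lt_compat_r _ _ _ K0 lt.
rewrite (_ : d / _ * _ = d); last by field; lra.
by have := iter n t ht; lra.
Qed.

(** By the same instability, a bounded [u] must converge: the distance to the
    value balanced by the limit of [Q] contracts by the factor [q h / al]. *)
Lemma defect_asymptotic : exists L, 0 <= L /\
  is_lim (fun t => exp (- z * t) * (1 - phi t)) p_infty L.
Proof.
have [a ha] := Q_limit; have [M [T hM]] := u_bounded.
have qh0 : 0 <= q * h by apply: Rmult_le_pos; lra.
pose L := - a / (al - q * h).
have aL : a = - ((al - q * h) * L) by rewrite /L; field; lra.
pose th := q * h / al; have thE : th * al = q * h by rewrite /th; field; lra.
have th0 : 0 <= th by apply: Rdiv_le_0_compat; lra.
have th1 : th < 1 by apply/Rlt_div_l; lra.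
pose near d := exists S, forall t, S <= t -> Rabs (u t - L) <= d.
have contract d r : 0 < r -> near d -> near (th * d + r).
  move=> r0 [S1 h1]; have [S2 h2] := ha (al * r) ltac:(nra).
  pose S := Rmax (Rmax S1 S2) T + h.
  have [SS1 [SS2 ST]] : S1 <= S - h /\ S2 <= S /\ T <= S.
    have := Rmax_l (Rmax S1 S2) T; have := Rmax_r (Rmax S1 S2) T.
    by have := Rmax_l S1 S2; have := Rmax_r S1 S2; rewrite /S; lra.
  have mean t : S <= t -> q * h * (L - d) <= q * (U t - U (t - h)) <= q * h * (L + d).
    move=> ht; have [s [hs ->]] := U_mean t.
    have /Rabs_le_between' us := h1 s ltac:(lra).
    by rewrite -Rmult_assoc; split; apply: Rmult_le_compat_l; lra.
  exists S => t ht; apply/Rabs_le_between'; split.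
    suff : L - (th * d + r) - u t <= 0 by lra.
    apply: (bounded_comparison (al / e) (L - (th * d + r)) S
      (fun t => L - (th * d + r) - u t) (fun t => - du t)) => // [|s hs|s hs|s hs].
    - exact: Rdiv_lt_0_compat.
    - have := is_derive_minus (fun _ => L - (th * d + r)) u s _ _ (is_derive_const _ s) (Du s).
      by rewrite /minus plus_zero_l.
    - apply: (Rmult_le_reg_l e) => //.
      rewrite (_ : e * (al / e * _) = al * L - th * al * d - al * r - al * u s); last by field; lra.
      rewrite -Ropp_mult_distr_r edu.
      by have := mean s hs; have := h2 s ltac:(lra); rewrite thE; lra.
    - by have := u_pos s; lra.
  suff : u t - (L + (th * d + r)) <= 0 by lra.
  apply: (bounded_comparison (al / e) (M - (L + (th * d + r))) S
    (fun t => u t - (L + (th * d + r))) du) => // [|s hs|s hs|s hs].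
  - exact: Rdiv_lt_0_compat.
  - have := is_derive_minus u (fun _ => L + (th * d + r)) s _ _ (Du s) (is_derive_const _ s).
    by rewrite /minus opp_zero plus_zero_r.
  - apply: (Rmult_le_reg_l e) => //.
    rewrite (_ : e * (al / e * _) = al * u s - al * L - th * al * d - al * r); last by field; lra.
    by rewrite edu; have := mean s hs; have := h2 s ltac:(lra); rewrite thE; nra.
  - by have := hM s ltac:(lra); lra.
have near0 : near (M + Rabs L).
  exists T => t ht; apply: Rle_trans (Rabs_triang (u t) (- L)) _.
  rewrite Rabs_Ropp Rabs_pos_eq; last exact/Rlt_le.
  by have := hM t ht; lra.
have lim : is_lim u p_infty L.
  apply/is_lim_spec => d /=; have d0 := cond_pos d.
  have iter (n : nat) : near (d / 2 + th ^ n * (M + Rabs L)).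
    elim: n => [|n IH].
      have [S hS] := near0; exists S => t ht; rewrite /= Rmult_1_l.
      by have := hS t ht; lra.
    have := contract _ ((1 - th) * (d / 2)) ltac:(apply: Rmult_lt_0_compat; lra) IH.
    by rewrite (_ : th * _ + _ = d / 2 + th ^ n.+1 * (M + Rabs L)) //= ; ring.
  have K0 : 0 < M + Rabs L.
    by have := hM T (Rle_refl T); have := u_pos T; have := Rabs_pos L; lra.
  have [n hn] := pow_lt_1_zero th ltac:(rewrite Rabs_pos_eq; lra)
    (d / 2 / (M + Rabs L)) ltac:(apply: Rdiv_lt_0_compat; lra).
  have /Rabs_def2 [lt _] := hn n (Nat.le_refl n).
  have := Rmult_lt_compat_r _ _ _ K0 lt.
  rewrite (_ : d / 2 / _ * _ = d / 2); last by field; lra.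
  have [S hS] := iter n; exists S => t ht.
  by have := hS t ltac:(lra); lra.
exists L; split=> //.
have := is_lim_le_loc (fun _ => 0) u p_infty 0 L _ (is_lim_const 0 p_infty) lim.
by apply; exists 0 => t _; apply/Rlt_le.
Qed.

End Profile.

(** * Uniqueness up to translation *)

(** The defects are fixed points of a monotone, strictly sublinear operator:
    replacing [w] by [k w] with [0 < k < 1] leaves a strict surplus
    [k (1 - k) w (w_h)]. At a point where the quotient of two defects is minimal
    and less than [1], this surplus contradicts the positivity of the Green
    function. *)
Lemma defect_comparison (h e l m : R) (phi1 p1 phi2 p2 : R -> R) :
  0 <= h -> kpp_roots e l m ->
  profile h e phi1 p1 -> profile h e phi2 p2 ->
  (forall k, k < 1 ->
     Rbar_locally p_infty (fun t => k * (1 - phi2 t) <= 1 - phi1 t)) ->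
  forall t, phi1 t <= phi2 t.
Proof.
move=> h0 kr P1 P2 asym t1; apply: Rnot_lt_le => lt.
have e0 : 0 < e by case: kr.
pose w1 t := 1 - phi1 t; pose w2 t := 1 - phi2 t.
have w1p t : 0 < w1 t by have := profile_lt1 h e phi1 p1 h0 e0 P1 t; rewrite /w1; lra.
have w2p t : 0 < w2 t by have := profile_lt1 h e phi2 p2 h0 e0 P2 t; rewrite /w2; lra.
case: (P1) => D1 DD1 pos1 _ _; case: (P2) => D2 DD2 pos2 _ _.
pose r t := w1 t / w2 t.
have rE t : r t * w2 t = w1 t by rewrite /r; field; have := w2p t; lra.
have rt1 : r t1 < 1 by apply/Rlt_div_l; [apply: w2p | rewrite /w1 /w2; lra].
have r0 t : 0 < r t by apply: Rdiv_lt_0_compat.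
pose k' := (1 + r t1) / 2.
have [T2 hT2] := asym k' ltac:(rewrite /k'; lra).
have [T1 hT1] := profile_small h e phi1 p1 P1 (1 - k') ltac:(rewrite /k'; lra).
pose a := Rmin T1 t1; pose b := Rmax (T2 + 1) t1.
have [aT1 at1] : a <= T1 /\ a <= t1 by split; [apply: Rmin_l | apply: Rmin_r].
have [bT2 bt1] : T2 + 1 <= b /\ t1 <= b by split; [apply: Rmax_l | apply: Rmax_r].
have [|t0 [min ht0]] := continuity_ab_min r a b ltac:(lra).
  move=> t _; have Dt1 := D1 t; have Dt2 := D2 t; have p := w2p t; rewrite /w2 in p.
  apply: (derivable_continuity_pt _ t (Derive r t)); apply: Derive_correct.
  by rewrite /r /w1 /w2; auto_derive; derivable.
pose k := r t0; have k1 : k <= r t1 by apply: min; lra.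
have kk' : k < k' by rewrite /k'; lra.
have k0 : 0 < k by apply: r0.
have klt : k < 1 by lra.
have above t : k * w2 t <= w1 t.
  have w2t := w2p t; case: (Rle_lt_dec t a) => ta.
    have := hT1 t ltac:(lra); have := pos2 t; rewrite /w1 /w2 => x y.
    have : k' * (1 - phi2 t) <= k' * 1 by apply: Rmult_le_compat_l; rewrite /k'; lra.
    by rewrite /w2 in w2t; nra.
  case: (Rle_lt_dec t b) => tb.
    rewrite -(rE t); apply: Rmult_le_compat_r; first by lra.
    by apply: min; lra.
  have := hT2 t ltac:(lra); rewrite -/(w1 t) -/(w2 t).
  by have : k * w2 t <= k' * w2 t; [apply: Rmult_le_compat_r; lra | lra].
pose d t := w1 t - k * w2 t; pose dd t := - p1 t + k * p2 t.
have d_t0 : d t0 = 0 by rewrite /d -rE /k; ring.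
have dd_t0 : dd t0 = 0.
  apply: (derive_at_min d t0) => [|t]; last by rewrite d_t0 /d; have := above t; lra.
  have Dt1 := D1 t0; have Dt2 := D2 t0; rewrite /d /w1 /w2; auto_derive; first by derivable.
  rewrite (is_derive_unique (fun x => phi1 x) _ _ Dt1) (is_derive_unique (fun x => phi2 x) _ _ Dt2).
  by rewrite /dd; ring.
pose G t := (1 - phi1 t * phi1 (t - h)) - k * (1 - phi2 t * phi2 (t - h)).
have Gpos t : 0 < G t.
  have a1 := above t; have a2 := above (t - h).
  have b1 := pos1 t; have b2 := pos1 (t - h).
  have prod : phi1 t * phi1 (t - h) <= (1 - k * w2 t) * (1 - k * w2 (t - h)).
    by rewrite /w1 in a1 a2; apply: Rmult_le_compat; lra.
  have : 0 < k * (1 - k) * (w2 t * w2 (t - h)).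
    by apply: Rmult_lt_0_compat; apply: Rmult_lt_0_compat => //; lra.
  have : (1 - (1 - k * w2 t) * (1 - k * w2 (t - h))) - k * (1 - phi2 t * phi2 (t - h))
      = k * (1 - k) * (w2 t * w2 (t - h)) by rewrite /w2; ring.
  by rewrite /G; lra.
pose Y t := l * d t - dd t.
have DY t : is_derive Y t (m * Y t - G t / e).
  have Dt1 := D1 t; have Dt2 := D2 t; have DDt1 := DD1 t; have DDt2 := DD2 t.
  rewrite /Y /d /dd /w1 /w2; auto_derive; first by derivable.
  rewrite (is_derive_unique (fun x => phi1 x) _ _ Dt1) (is_derive_unique (fun x => phi2 x) _ _ Dt2).
  rewrite (is_derive_unique (fun x => p1 x) _ _ DDt1) (is_derive_unique (fun x => p2 x) _ _ DDt2).
  case: kr => _ [_ [es ep]].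
  have ies : / e = l + m by apply: (Rmult_eq_reg_l e); [rewrite Rinv_r|]; lra.
  have iep : / e = l * m by apply: (Rmult_eq_reg_l e); [rewrite Rinv_r|]; lra.
  have := congr1 (Rmult (- p1 t + k * p2 t)) ies; have := congr1 (Rmult (1 - phi1 t - k * (1 - phi2 t))) iep.
  by rewrite /G /Rdiv; lra.
have Y0 t : 0 <= Y t.
  suff : - Y t <= 0 by lra.
  have [_ [[l0 lm] _]] := kr.
  apply: (bounded_comparison m 1 t (fun t => - Y t) (fun t => - (m * Y t - G t / e)))
    => // [|s hs|s hs|s hs|]; last exact: Rle_refl.
  - by lra.
  - exact: (is_derive_opp Y s _ (DY s)).
  - have : 0 < G s / e by apply: Rdiv_lt_0_compat.
    by lra.
  have d0 : 0 <= d s by rewrite /d; have := above s; lra.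
  have ld : 0 <= l * d s by apply: Rmult_le_pos; lra.
  have q1 := profile_derive_ge0 h e phi1 p1 P1 s.
  have q2 := profile_derive_le1 h e phi2 p2 h0 e0 P2 s.
  have q3 := profile_derive_ge0 h e phi2 p2 P2 s.
  by rewrite /Y /dd; nra.
have Yt0 : Y t0 = 0 by rewrite /Y d_t0 dd_t0; ring.
have := derive_at_min Y t0 _ (DY t0) (fun s => ltac:(rewrite Yt0; exact: Y0)).
have : 0 < G t0 / e by apply: Rdiv_lt_0_compat.
by rewrite Yt0; lra.
Qed.

Lemma is_lim_shift (f : R -> R) (a s : R) :
  is_lim f p_infty a -> is_lim (fun t => f (t + s)) p_infty a.
Proof.
move=> /is_lim_spec lf; apply/is_lim_spec => d; have [M hM] := lf d.
by exists (M - s) => t ht; apply: hM; lra.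
Qed.

Lemma is_lim_shift_m (f : R -> R) (a s : R) :
  is_lim f m_infty a -> is_lim (fun t => f (t + s)) m_infty a.
Proof.
move=> /is_lim_spec lf; apply/is_lim_spec => d; have [M hM] := lf d.
by exists (M - s) => t ht; apply: hM; lra.
Qed.

Lemma profile_shift (h e s : R) (phi p : R -> R) : profile h e phi p ->
  profile h e (fun t => phi (t + s)) (fun t => p (t + s)).
Proof.
move=> [D DD pos nd [l0 l1]]; split=> [t|t|t|t u tu|] //.
- exact: derive_shift.
- rewrite (_ : t - h + s = t + s - h); last by ring.
  exact: (derive_shift p s t _ (DD (t + s))).
- by apply: nd; lra.
- by split; [apply: is_lim_shift_m | apply: is_lim_shift].
Qed.

Lemma limit_ratio (f g : R -> R) (a b k : R) : k * b < a -> 0 <= k ->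
  is_lim f p_infty a -> is_lim g p_infty b ->
  Rbar_locally p_infty (fun t => k * g t <= f t).
Proof.
move=> kb k0 /is_lim_spec lf /is_lim_spec lg.
pose d := (a - k * b) / (k + 1).
have d0 : 0 < d by apply: Rdiv_lt_0_compat; lra.
have dE : (k + 1) * d = a - k * b by rewrite /d; field; lra.
apply: filter_imp (filter_and _ _ (lf (mkposreal d d0)) (lg (mkposreal d d0))) => t /=.
by move=> [/Rabs_def2 hf /Rabs_def2 hg]; nra.
Qed.

(** If the defect of [chi] behaves like [L exp (z t)] with [L > 0], a translation
    equalizes the asymptotics and the comparison applies in both directions. If
    [L = 0], every translate of [phi] lies below [chi], which is absurd. *)
Lemma profile_unique (h e l m z : R) (phi p chi r : R -> R) :
  0 <= h -> kpp_roots e l m -> z < 0 -> psi h e z = 0 -> dpsi h e z < 0 ->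
  (forall s, z < s <= 0 -> psi h e s < 0) ->
  profile h e phi p -> profile h e chi r ->
  asymptotic_at_1 z phi -> exists s0, forall t, chi t = phi (t + s0).
Proof.
move=> h0 kr z0 pz dpz zmax P1 P2 [o [lo asym]].
have e0 : 0 < e by case: kr.
have [L [L0 lim2]] := defect_asymptotic h e chi r h0 e0 P2 z z0 pz dpz zmax.
have lim1 s : is_lim (fun t => exp (- z * t) * (1 - phi (t + s))) p_infty (exp (z * s)).
  apply: (is_lim_ext (fun t => exp (z * s) * (1 + o (t + s)))).
    move=> t; rewrite asym (_ : z * (t + s) = z * s + - (- z * t)); last by ring.
    by rewrite exp_plus exp_Ropp; field; apply/Rgt_not_eq/exp_pos.
  rewrite -[X in is_lim _ _ (Finite X)](Rmult_1_r (exp (z * s))).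
  apply: (is_lim_scal_l _ (exp (z * s)) p_infty 1).
  rewrite -[X in is_lim _ _ (Finite X)](Rplus_0_r 1).
  by apply: is_lim_plus'; [apply: is_lim_const | apply: is_lim_shift].
have strip f g k : Rbar_locally p_infty (fun t =>
    k * (exp (- z * t) * f t) <= exp (- z * t) * g t) ->
    Rbar_locally p_infty (fun t => k * f t <= g t).
  apply: filter_imp => t le; apply: (Rmult_le_reg_l (exp (- z * t))); first exact: exp_pos.
  by lra.
have asym_le (a : R) f g (b : R) : is_lim (fun t => exp (- z * t) * f t) p_infty a ->
    is_lim (fun t => exp (- z * t) * g t) p_infty b -> a <= b -> 0 < b ->
    (forall t, 0 < f t) -> (forall t, 0 < g t) ->
    forall k, k < 1 -> Rbar_locally p_infty (fun t => k * f t <= g t).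
  move=> la lb ab b0 f0 g0 k k1; case: (Rle_lt_dec 0 k) => kp.
    by apply: strip; apply: (limit_ratio _ _ b a k _ kp lb la); nra.
  by exists 0 => t _; have := f0 t; have := g0 t; nra.
have w1p s t : 0 < 1 - phi (t + s).
  by have := profile_lt1 h e phi p h0 e0 P1 (t + s); lra.
have w2p t : 0 < 1 - chi t by have := profile_lt1 h e chi r h0 e0 P2 t; lra.
have le_shift s : L <= exp (z * s) -> forall t, phi (t + s) <= chi t.
  move=> Ls; apply: (defect_comparison h e l m _ _ chi r h0 kr (profile_shift h e s phi p P1) P2).
  by apply: asym_le lim2 (lim1 s) Ls (exp_pos _) w2p (w1p s).
case: (Rle_lt_or_eq_dec 0 L L0) => [Lp|LE].
  exists (ln L / z) => t; have EL : exp (z * (ln L / z)) = L.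
    by rewrite (_ : z * (ln L / z) = ln L) ?exp_ln //; field; lra.
  apply: Rle_antisym; last by apply: le_shift; rewrite EL; apply: Rle_refl.
  apply: (defect_comparison h e l m chi r _ _ h0 kr P2 (profile_shift h e (ln L / z) phi p P1)).
  apply: asym_le (lim1 (ln L / z)) lim2 _ Lp (w1p _) w2p.
  by rewrite EL; apply: Rle_refl.
exfalso.
have [S hS] := defect_small h e phi p P1 (1 - chi 0) (w2p 0).
have := le_shift (S + 1) ltac:(rewrite -LE; exact/Rlt_le/exp_pos) 0.
by have := hS (0 + (S + 1)) ltac:(lra); lra.
Qed.

(** * Plane waves and the profile equation *)

HB.instance Definition _ := Monoid.isComLaw.Build R 0 Rplus
  (fun x y z => esym (Rplus_assoc x y z)) Rplus_comm Rplus_0_l.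

Lemma dot_upd (m : nat) (nu x : Rm m) (i : 'I_m) (s : R) :
  dot m nu (upd m x i s) = dot m nu x + nu i * (s - x i).
Proof.
rewrite /dot (bigD1 i) //= [in RHS](bigD1 i) //= /upd eqxx.
rewrite (eq_bigr (fun j => nu j * x j)) => [|j /negbTE -> //].
by ring.
Qed.

Lemma dot0 (m : nat) (nu : Rm m) : dot m nu (fun _ => 0) = 0.
Proof. by apply: big1 => i _; apply: Rmult_0_r. Qed.

Lemma sum_scal (m : nat) (f : 'I_m -> R) (a : R) :
  \big[Rplus/0]_(i < m) (f i * a) = \big[Rplus/0]_(i < m) f i * a.
Proof.
elim/big_ind2: _ => [|x1 x2 y1 y2 -> ->|//]; first by rewrite Rmult_0_l.
by ring.
Qed.

Lemma enorm_dot (m : nat) (nu : Rm m) : enorm m nu = 1 -> dot m nu nu = 1.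
Proof.
rewrite /enorm => E; have d0 : 0 <= dot m nu nu.
  by apply: (big_ind (fun x => 0 <= x)) => [|x y|i _]; [lra | lra | apply: Rle_0_sqr].
by rewrite -(sqrt_sqrt _ d0) E Rmult_1_l.
Qed.

Lemma unit_vector (m : nat) : (1 <= m)%nat -> exists nu : Rm m, enorm m nu = 1.
Proof.
case: m => // m _; exists (fun i => if i == ord0 then 1 else 0).
rewrite /enorm /dot (bigD1 ord0) //= big1 => [|i /negbTE -> /=]; last by rewrite Rmult_0_l.
by rewrite Rmult_1_l Rplus_0_r sqrt_1.
Qed.

Lemma nonzero_coordinate (m : nat) (nu : Rm m) : enorm m nu = 1 -> exists i, nu i <> 0.
Proof.
move/enorm_dot => E; apply: Classical_Prop.NNPP => none.
suff : dot m nu nu = 0 by lra.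
apply: big1 => i _; rewrite (_ : nu i = 0) ?Rmult_0_l //.
by apply: Classical_Prop.NNPP => ne; apply: none; exists i.
Qed.

Lemma dot_continuous (m : nat) (nu : Rm m) (x : 'I_m -> R) :
  continuous (fun y : 'I_m -> R => dot m nu y) x.
Proof.
rewrite /dot; elim: (index_enum _) => [|i r IH].
  apply: (continuous_ext (fun _ => 0)); last exact: continuous_const.
  by move=> y; rewrite big_nil.
apply: (continuous_ext (fun y : 'I_m -> R => nu i * y i + \big[Rplus/0]_(j <- r) (nu j * y j))).
  by move=> y; rewrite big_cons.
apply: (continuous_plus (fun y : 'I_m -> R => nu i * y i)) IH.
apply: (continuous_mult (fun _ : 'I_m -> R => nu i) (fun y : 'I_m -> R => y i)).
  exact: continuous_const.
by move=> P [d hd]; exists d => y hy; apply: hd; apply: hy.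
Qed.

Section PlaneWave.
Variables (m : nat) (nu : Rm m) (c : R).

Definition plane_wave (V : R -> R) : R -> Rm m -> R := fun t x => V (dot m nu x + c * t).

Lemma plane_wave_continuous (a : R) (V : R -> R) : (forall s, continuous V s) ->
  jointly_continuous m (plane_wave (fun s => a * V s)).
Proof.
move=> C [t x]; rewrite /plane_wave.
apply: (continuous_comp (fun q : R * ('I_m -> R) => dot m nu (snd q) + c * fst q)
  (fun s => a * V s)).
  apply: (continuous_plus (fun q : R * ('I_m -> R) => dot m nu (snd q))).
    apply: (continuous_comp snd (fun y : 'I_m -> R => dot m nu y)); last exact: dot_continuous.
    exact: continuous_snd.
  apply: (continuous_mult (fun _ : R * ('I_m -> R) => c) fst); first exact: continuous_const.
  exact: continuous_fst.
by apply: (continuous_mult (fun _ => a) V) => //; apply: continuous_const.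
Qed.

Variables (V dV : R -> R).
Hypothesis D : forall s, is_derive V s (dV s).

Lemma plane_wave_derive_t (a t : R) (x : Rm m) :
  is_derive (fun s => plane_wave (fun s => a * V s) s x) t
    (c * a * dV (dot m nu x + c * t)).
Proof.
have Dt := D (dot m nu x + c * t); rewrite /plane_wave; auto_derive; first by derivable.
by rewrite (is_derive_unique (fun x => V x) _ _ Dt); ring.
Qed.

Lemma plane_wave_derive_x (a t : R) (x : Rm m) (i : 'I_m) :
  is_derive (fun s => plane_wave (fun s => a * V s) t (upd m x i s)) (x i)
    (nu i * a * dV (dot m nu x + c * t)).
Proof.
rewrite /plane_wave.
apply: (is_derive_ext (fun s => a * V (dot m nu x + nu i * (s - x i) + c * t))).
  by move=> s; rewrite dot_upd.
have Dt := D (dot m nu x + nu i * (x i - x i) + c * t).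
auto_derive; first by derivable.
rewrite (_ : dot m nu x + nu i * (x i + - x i) + c * t = dot m nu x + nu i * (x i - x i) + c * t) //.
rewrite (is_derive_unique (fun x => V x) _ _ Dt).
by rewrite (_ : dot m nu x + nu i * (x i - x i) + c * t = dot m nu x + c * t); ring.
Qed.

Lemma plane_wave_d_t (a : R) :
  d_t m (plane_wave (fun s => a * V s)) = plane_wave (fun s => c * a * dV s).
Proof.
apply: FunctionalExtensionality.functional_extensionality => t.
apply: FunctionalExtensionality.functional_extensionality => x.
exact: is_derive_unique (plane_wave_derive_t a t x).
Qed.

Lemma plane_wave_d_x (a : R) (i : 'I_m) :
  d_x m i (plane_wave (fun s => a * V s)) = plane_wave (fun s => nu i * a * dV s).
Proof.
apply: FunctionalExtensionality.functional_extensionality => t.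
apply: FunctionalExtensionality.functional_extensionality => x.
exact: is_derive_unique (plane_wave_derive_x a t x i).
Qed.

End PlaneWave.

Lemma plane_wave_1 (m : nat) (nu : Rm m) (c : R) (V : R -> R) :
  plane_wave m nu c V = plane_wave m nu c (fun s => 1 * V s).
Proof.
congr plane_wave; apply: FunctionalExtensionality.functional_extensionality => s.
by rewrite Rmult_1_l.
Qed.

Lemma plane_wave_laplacian (m : nat) (nu : Rm m) (c : R) (V dV ddV : R -> R) :
  enorm m nu = 1 -> (forall s, is_derive V s (dV s)) -> (forall s, is_derive dV s (ddV s)) ->
  forall t x, laplacian m (plane_wave m nu c V) t x = ddV (dot m nu x + c * t).
Proof.
move=> n1 D DD t x; rewrite /laplacian plane_wave_1.
rewrite (eq_bigr (fun i => nu i * nu i * ddV (dot m nu x + c * t))) => [|i _].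
  by rewrite sum_scal -/(dot m nu nu) enorm_dot // Rmult_1_l.
by rewrite (plane_wave_d_x m nu c V dV D) (plane_wave_d_x m nu c dV ddV DD) Rmult_1_r.
Qed.

Lemma plane_wave_C12 (m : nat) (nu : Rm m) (c : R) (V dV ddV : R -> R) :
  (forall s, is_derive V s (dV s)) -> (forall s, is_derive dV s (ddV s)) ->
  (forall s, continuous ddV s) -> C12 m (plane_wave m nu c V).
Proof.
move=> D DD C; rewrite plane_wave_1.
have CV s : continuous V s by apply: derivable_continuous (D s).
have CdV s : continuous dV s by apply: derivable_continuous (DD s).
split; first exact: plane_wave_continuous.
split; first by move=> t x; eexists; apply: (plane_wave_derive_t m nu c V dV D).
split; first by rewrite (plane_wave_d_t m nu c V dV D); apply: plane_wave_continuous.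
split; first by move=> i t x; eexists; apply: (plane_wave_derive_x m nu c V dV D).
split; first by move=> i; rewrite (plane_wave_d_x m nu c V dV D); apply: plane_wave_continuous.
split=> i j.
  by move=> t x; rewrite (plane_wave_d_x m nu c V dV D); eexists;
    apply: (plane_wave_derive_x m nu c dV ddV DD).
rewrite (plane_wave_d_x m nu c V dV D) (plane_wave_d_x m nu c dV ddV DD).
exact: plane_wave_continuous.
Qed.

(** Smoothness of the wave gives that of its profile: differentiate in time
    once, and twice along a coordinate on which the direction does not vanish. *)
Lemma plane_wave_smooth (m : nat) (nu : Rm m) (c : R) (V : R -> R) : 0 < c ->
  enorm m nu = 1 -> C12 m (plane_wave m nu c V) ->
  exists dV ddV : R -> R, (forall s, is_derive V s (dV s)) /\
    (forall s, is_derive dV s (ddV s)).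
Proof.
move=> c0 n1 [_ [Dt [_ [_ [_ [Dxx _]]]]]]; have [i ni] := nonzero_coordinate m nu n1.
have D s : is_derive V s (Derive V s).
  apply: Derive_correct; have [l Dl] := Dt (s / c) (fun _ => 0).
  apply: (ex_derive_ext (fun y => plane_wave m nu c V (y / c) (fun _ => 0))).
    by move=> y; rewrite /plane_wave dot0; congr V; field; lra.
  apply: (ex_derive_comp (fun y => plane_wave m nu c V y (fun _ => 0)) (fun y => y / c)).
    by exists l.
  by auto_derive.
exists (Derive V), (Derive (Derive V)); split=> // s; apply: Derive_correct.
have := Dxx i i (s / c) (fun _ => 0); rewrite plane_wave_1 (plane_wave_d_x m nu c V _ D).
move=> [l Dl].
apply: (ex_derive_ext (fun y => / nu i * plane_wave m nu c (fun s => nu i * 1 * Derive V s)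
  (s / c) (upd m (fun _ => 0) i ((y - s) / nu i)))).
  move=> y; rewrite /plane_wave dot_upd dot0.
  rewrite (_ : 0 + nu i * ((y - s) / nu i - 0) + c * (s / c) = y); last by field; lra.
  by rewrite Rmult_1_r -Rmult_assoc Rinv_l // Rmult_1_l.
apply: (ex_derive_mult (fun _ => / nu i)); first by auto_derive.
apply: (ex_derive_comp (fun y => plane_wave m nu c (fun s => nu i * 1 * Derive V s)
  (s / c) (upd m (fun _ => 0) i y)) (fun y => (y - s) / nu i)); last by auto_derive.
by rewrite (_ : (s - s) / nu i = 0); [exists l | field].
Qed.

Lemma is_lim_scale (f : R -> R) (a k : R) : 0 < k ->
  (is_lim f p_infty a -> is_lim (fun t => f (k * t)) p_infty a) /\
  (is_lim f m_infty a -> is_lim (fun t => f (k * t)) m_infty a).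
Proof.
move=> k0; split=> /is_lim_spec lf; apply/is_lim_spec => d; have [M hM] := lf d;
  exists (M / k) => t ht; apply: hM.
  by have := Rmult_lt_compat_l k _ _ k0 ht; rewrite (_ : k * (M / k) = M) //; field; lra.
by have := Rmult_lt_compat_l k _ _ k0 ht; rewrite (_ : k * (M / k) = M) //; field; lra.
Qed.

Lemma profile_of_wavefront (m : nat) (h c : R) (nu : Rm m) (V : R -> R) : 0 < c ->
  monotone_wavefront m h c nu V -> exists p, profile h (eps c) (fun s => V (c * s)) p.
Proof.
move=> c0 [[n1 [[smooth [_ eq]] [pos [l0 l1]]]] mono].
have [dV [ddV [D DD]]] := plane_wave_smooth m nu c V c0 n1 smooth.
have ode s : c * dV (c * s) = ddV (c * s) + V (c * s) * (1 - V (c * s - c * h)).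
  have := eq s (fun _ => 0).
  rewrite -/(plane_wave m nu c V) (plane_wave_laplacian m nu c V dV ddV n1 D DD).
  rewrite plane_wave_1 (plane_wave_d_t m nu c V dV D) /plane_wave dot0 !Rplus_0_l.
  by rewrite Rmult_1_r (_ : c * s - c * h = c * (s - h)) //; ring.
exists (fun s => c * dV (c * s)); split=> [s|s|s|s t st|] //.
- have Ds := D (c * s); auto_derive; first by derivable.
  by rewrite (is_derive_unique (fun x => V x) _ _ Ds); ring.
- have Ds := DD (c * s); auto_derive; first by derivable.
  rewrite (is_derive_unique (fun x => dV x) _ _ Ds) ode /eps.
  by rewrite (_ : c * s - c * h = c * (s - h)); [field; lra | ring].
- case: mono => [inc|dec]; first by apply: inc; nra.
  have /is_lim_spec/(_ (mkposreal (1 / 2) ltac:(lra))) /= [M hM] := l0.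
  have /is_lim_spec/(_ (mkposreal (1 / 2) ltac:(lra))) /= [N hN] := l1.
  have := hM (Rmin (M - 1) N) ltac:(have := Rmin_l (M - 1) N; lra).
  have := hN (N + 1) ltac:(lra).
  have := dec (Rmin (M - 1) N) (N + 1) ltac:(have := Rmin_r (M - 1) N; lra).
  by move=> a /Rabs_def2 b /Rabs_def2; lra.
- by have [sp sm] := is_lim_scale V 0 c c0; have [sp' _] := is_lim_scale V 1 c c0;
    split; [apply: sm | apply: sp'].
Qed.

Lemma wavefront_of_profile (m : nat) (h c : R) (nu : Rm m) (phi p : R -> R) : 0 < c ->
  enorm m nu = 1 -> profile h (eps c) phi p ->
  monotone_wavefront m h c nu (fun s => phi (s / c)).
Proof.
move=> c0 n1 [D DD pos nd [l0 l1]].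
pose V s := phi (s / c); pose dV s := p (s / c) / c.
pose ddV s := p (s / c) - phi (s / c) * (1 - phi (s / c - h)).
have DV s : is_derive V s (dV s).
  have Ds := D (s / c); rewrite /V /dV; auto_derive; first by derivable.
  by rewrite (is_derive_unique (fun x => phi x) _ _ Ds); field; lra.
have DDV s : is_derive dV s (ddV s).
  have Ds := DD (s / c); rewrite /dV /ddV; auto_derive; first by derivable.
  by rewrite (is_derive_unique (fun x => p x) _ _ Ds) /eps; field; lra.
have CddV s : continuous ddV s.
  have Ds := D (s / c); have Dh := D (s / c - h); have DDs := DD (s / c).
  by apply: ex_derive_continuous; rewrite /ddV; auto_derive; derivable.
have c0' : 0 < / c by apply: Rinv_0_lt_compat.
split; last first.
  by left=> s t st; apply: nd; apply: Rmult_le_compat_r; lra.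
split=> //; split.
  split; first exact: (plane_wave_C12 m nu c V dV ddV).
  split=> [t x|t x]; first by apply/Rlt_le/pos.
  rewrite -/(plane_wave m nu c V) (plane_wave_laplacian m nu c V dV ddV n1 DV DDV).
  rewrite plane_wave_1 (plane_wave_d_t m nu c V dV DV) /plane_wave /ddV /dV /V.
  rewrite (_ : (dot m nu x + c * (t - h)) / c = (dot m nu x + c * t) / c - h); last by field; lra.
  by field; lra.
split=> [s|]; first exact: pos.
have [_ sm] := is_lim_scale phi 0 (/ c) c0'; have [sp _] := is_lim_scale phi 1 (/ c) c0'.
by split; [move: (sm l0) | move: (sp l1)]; apply: is_lim_ext => s; rewrite Rmult_comm.
Qed.

(** * Wavefronts obtained by iteration *)

Lemma iteration_operator (h c : R) : 2 <= c -> exists T : (R -> R) -> R -> R,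
  [/\ forall f, admissible f -> solves (eps c) (lambda c) (mu c) (source h f) (T f),
      2 < c -> T = opA h c & c = 2 -> T = opB h].
Proof.
case=> [lt|<-].
  by exists (opA h c); split=> // [f Af|]; [apply: opA_solves | lra].
by exists (opB h); split=> // [f Af|]; [apply: opB_solves | lra].
Qed.

Lemma wavefront_from_iteration (m : nat) (h c : R) (T : (R -> R) -> R -> R) (f phi : R -> R) :
  0 < c -> (2 < c -> T = opA h c) -> (c = 2 -> T = opB h) ->
  (exists p, profile h (eps c) phi p) -> iterates_converge T f phi ->
  wavefront_from m h c f phi.
Proof.
move=> c0 TA TB [p P] it; split=> [nu n1|].
  exact: wavefront_of_profile P.
by split=> [/TA <- | /TB <-].
Qed.

Lemma subcritical_wavefront (m : nat) (h c : R) : 0 <= h -> 2 <= c ->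
  subcritical h (eps c) -> exists phi p : R -> R,
    [/\ wavefront_from m h c (phi_minus h c) phi, profile h (eps c) phi p,
        asymptotic_at_1 (lambda2 h c) phi &
        asymptotic_at_1 (lambda2 h c) (phi_minus h c)].
Proof.
move=> h0 c2 sub; have c0 : 0 < c by lra.
have kr := roots_spec c c2; have [T [TS TA TB]] := iteration_operator h c c2.
have [z0 pz zmax dpz [d [hd pd]]] := lambda2_subcritical h c c0 sub.
have adm := phi_minus_admissible (eps c) (lambda c) (mu c) _ kr z0.
have ge := phi_minus_ge (eps c) (lambda c) (mu c) _ kr z0.
have nd := phi_minus_nondecreasing (eps c) (lambda c) (mu c) _ kr z0.
have lim := phi_minus_limit (eps c) (lambda c) (mu c) _ kr z0.
have subsol := phi_minus_subsolution h (eps c) (lambda c) (mu c) _ T kr TS z0 pz.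
have asym := phi_minus_asymptotic (eps c) (lambda c) (mu c) _ kr z0.
have [g [sup fg g1 [K gK]]] :=
  subcritical_supersolution h (eps c) (lambda c) (mu c) _ T kr TS z0 pz d hd pd.
have [phi [p [P it bd]]] := iterates_converge_to_profile h (eps c) (lambda c) (mu c) T h0 kr TS
  _ g adm nd lim subsol sup fg g1.
exists phi, p; split=> //; first by apply: wavefront_from_iteration TA TB _ it => //; exists p.
apply: (asymptotic_of_bounds _ d K) => //; first by lra.
apply: filter_imp gK => t gt; have [lo up] := bd t; have := ge t.
by rewrite gt in up; lra.
Qed.

Lemma critical_wavefront (m : nat) (h c A : R) : 2 <= c -> critical h (eps c) ->
  1 < A -> (exp (- lambda2 h c * h) - 1) / h < A ->
  exists phi p : R -> R, wavefront_from m h c (phi_minus_crit h c A) phi /\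
    profile h (eps c) phi p.
Proof.
move=> c2 crit A1 hA; have c0 : 0 < c by lra.
have hp : 0 < h by case: crit.
have kr := roots_spec c c2; have [T [TS TA TB]] := iteration_operator h c c2.
have [z0 pz dpz neg] := lambda2_critical h c c0 crit.
have [ht tp et] := tau_crit_spec h c A hp z0 hA.
have adm := phi_crit_admissible h (lambda2 h c) A _ hp z0 A1 ht et.
have nd := phi_crit_nondecreasing h (lambda2 h c) A _ hp z0 A1 ht et.
have lim := phi_crit_limit h (lambda2 h c) A _ hp z0 A1 ht et.
have subsol := phi_crit_subsolution h (eps c) (lambda c) (mu c) _ A _ T hp kr TS z0 pz dpz A1 ht et.
have [g [sup fg g1]] :=
  critical_supersolution h (eps c) (lambda c) (mu c) _ A _ T hp kr TS z0 pz dpz A1 ht et neg.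
have [phi [p [P it _]]] := iterates_converge_to_profile h (eps c) (lambda c) (mu c) T
  (Rlt_le _ _ hp) kr TS _ g adm nd lim subsol sup fg g1.
by exists phi, p; split=> //; apply: wavefront_from_iteration TA TB _ it => //; exists p.
Qed.

Theorem theorem4 (m : nat) (h c : R) (Hm : (1 <= m)%nat) (Hh : 0 <= h) (Hc : 0 < c) :
  ((exists (nu : Rm m) (varphi : R -> R), monotone_wavefront m h c nu varphi) <->
   (cond1 h c \/ cond2 h c)) /\
  (cond1 h c \/ cond2 h c ->
   (Rbar_lt c (c_star h) ->
      exists phi : R -> R,
        wavefront_from m h c (phi_minus h c) phi /\
        unique_profile m h c phi /\
        asymptotic_at_1 (lambda2 h c) phi /\
        asymptotic_at_1 (lambda2 h c) (phi_minus h c)) /\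
   (Finite c = c_star h ->
      exists A0 : R, forall A : R, A0 < A -> (exp (- lambda2 h c * h) - 1) / h < A ->
        exists phi : R -> R, wavefront_from m h c (phi_minus_crit h c A) phi)).
Proof.
have [iff lt_sub eq_crit] := conditions_iff h c Hh Hc.
split; first split.
- move=> [nu [V wave]]; have [p P] := profile_of_wavefront m h c nu V Hc wave.
  have e0 := eps_pos c Hc; apply/iff; split.
    have := profile_speed h (eps c) _ p Hh e0 P; rewrite /eps => e4.
    apply: Rnot_lt_le => lt; have cc : 0 < c ^ 2 by nra.
    have : c ^ 2 * / c ^ 2 <= c ^ 2 * (1 / 4) by apply: Rmult_le_compat_l; lra.
    by rewrite Rinv_r; [nra | lra].
  case: (Rle_lt_or_eq_dec 0 h Hh) => [hp|<-]; last by left; left.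
  case: (profile_delay h (eps c) _ p Hh e0 P hp) => [lt|eq]; last by right.
  by left; right.
- move/iff => [c2 sc]; have [nu n1] := unit_vector m Hm.
  suff [phi [p P]] : exists phi p, profile h (eps c) phi p.
    by exists nu, (fun s => phi (s / c)); apply: wavefront_of_profile P.
  case: sc => [sub|crit].
    by have [phi [p [_ P _ _]]] := subcritical_wavefront m h c Hh c2 sub; exists phi, p.
  pose A := Rmax 1 ((exp (- lambda2 h c * h) - 1) / h) + 1.
  have := Rmax_l 1 ((exp (- lambda2 h c * h) - 1) / h) => a1.
  have := Rmax_r 1 ((exp (- lambda2 h c * h) - 1) / h) => a2.
  have [||phi [p [_ P]]] := critical_wavefront m h c A c2 crit; try by rewrite /A; lra.
  by exists phi, p.
move=> cond; have [c2 _] := proj1 iff cond; split=> [/(lt_sub cond) sub | /(eq_crit cond) crit].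
  have [phi [p [from P asym1 asym2]]] := subcritical_wavefront m h c Hh c2 sub.
  exists phi; split=> //; split=> // nu V wave.
  have [q Q] := profile_of_wavefront m h c nu V Hc wave.
  have [z0 pz zmax dpz _] := lambda2_subcritical h c Hc sub.
  exact: (profile_unique h (eps c) (lambda c) (mu c) _ phi p _ q Hh (roots_spec c c2)
    z0 pz dpz zmax P Q asym1).
exists 1 => A A1 hA; have [phi [_ [from _]]] := critical_wavefront m h c A c2 crit A1 hA.
by exists phi.
Qed.
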